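(* Let $s\in(0,1)$, let $\Omega\subset\mathbb{R}^n$ be a bounded open set with Lipschitz boundary and let $E\subset\mathbb{R}^n$. Then $E$ has finite $s$-perimeter in $\Omega$, i.e. $P_s(E,\Omega)<\infty$, if and only if there exist a sequence $\{E_h\}_{h\in\mathbb{N}}$ of open subsets of $\mathbb{R}^n$ with smooth boundary and a sequence $\varepsilon_h\to0^+$ such that (i) $E_h\xrightarrow{loc}E$ and $\sup_{h\in\mathbb{N}}P_s(E_h,\Omega)<\infty$; (ii) $\lim_{h\to\infty}P_s(E_h,\Omega)=P_s(E,\Omega)$; (iii) $\partial E_h\setminus N_{\varepsilon_h}(\partial\Omega)\subset N_{\varepsilon_h}(\partial E)$ for every $h$.
   Context: All sets are Lebesgue measurable, $|\cdot|$ is Lebesgue measure. For disjoint $A,B\subset\mathbb{R}^n$ put $\mathcal{L}_s(A,B)=\int_A\int_B\frac{dx\,dy}{|x-y|^{n+s}}\in[0,\infty]$. The $s$-perimeter of $E\subset\mathbb{R}^n$ in an open set $\Omega\subset\mathbb{R}^n$ is, writing $E^c=\mathbb{R}^n\setminus E$, $$P_s(E,\Omega)=\mathcal{L}_s(E\cap\Omega,E^c\cap\Omega)+\mathcal{L}_s(E\cap\Omega,E^c\setminus\Omega)+\mathcal{L}_s(E\setminus\Omega,E^c\cap\Omega).$$ $E_h\xrightarrow{loc}E$ means $\chi_{E_h}\to\chi_E$ in $L^1_{loc}(\mathbb{R}^n)$. $N_\rho(\Gamma)=\{x\in\mathbb{R}^n : d(x,\Gamma)<\rho\}$ (with $N_\rho(\emptyset)=\emptyset$).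 Sets are identified up to measure zero, and the representative of $E$ is chosen so that its topological boundary equals its measure theoretic boundary: $\partial E=\{x\in\mathbb{R}^n : 0<|E\cap B_r(x)|<|B_r(x)|\text{ for every }r>0\}$. Smooth means $C^\infty$. *)

(* Defs.v *)
From HB Require Import structures.
From mathcomp Require Import all_boot all_order all_algebra.
From mathcomp Require Import all_classical all_reals all_analysis.

Set Implicit Arguments.
Unset Strict Implicit.
Unset Printing Implicit Defensive.

Import Order.TTheory GRing.Theory Num.Theory.
Import numFieldNormedType.Exports.

Local Open Scope classical_set_scope.
Local Open Scope ring_scope.

(* The sigma-algebra on R^n generated by the coordinates, i.e. the Borel
   sets, and the n-fold product of the one-dimensional Lebesgue measure on it,
   transported along R * R^n ~ R^n.+1. *)

Definition coord_display : measure_display.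
Proof. exact: default_measure_display. Qed.

Section measurable_rV.
Context {R : realType} (n : nat).

Definition coord (i : 'I_n) (v : 'rV[R]_n) : measurableTypeR R := v ord0 i.

Let rV_set0 : g_sigma_preimage coord set0.
Proof. exact: sigma_algebra0. Qed.

Let rV_setC A : g_sigma_preimage coord A -> g_sigma_preimage coord (~` A).
Proof. exact: sigma_algebraC. Qed.

Let rV_bigcup (F : (set 'rV[R]_n)^nat) :
  (forall i, g_sigma_preimage coord (F i)) ->
  g_sigma_preimage coord (\bigcup_i (F i)).
Proof. exact: sigma_algebra_bigcup. Qed.

HB.instance Definition _ := @isMeasurable.Build coord_display
  'rV[R]_n (g_sigma_preimage coord) rV_set0 rV_setC rV_bigcup.

Lemma measurable_coord (i : 'I_n) : measurable_fun [set: 'rV[R]_n] (coord i).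
Proof.
move=> _ Y mY; rewrite setTI; apply: sub_sigma_algebra => /=.
rewrite -bigcup_seq/=; exists i => /=; first by rewrite mem_index_enum.
by exists Y => //; rewrite setTI.
Qed.

Lemma measurable_fun_rV d (T : measurableType d) (f : T -> 'rV[R]_n) :
  (forall i, measurable_fun [set: T] (coord i \o f)) ->
  measurable_fun [set: T] f.
Proof.
move=> mf _ A mA; rewrite setTI.
have : g_sigma_preimage (fun i => coord i \o f) `<=` measurable.
  apply: smallest_sub; first exact: sigma_algebra_measurable.
  move=> B; rewrite -bigcup_seq/= => -[i _ [C mC <-]].
  exact: mf.
rewrite g_sigma_preimage_comp; apply.
by exists A => //; rewrite setTI.
Qed.

End measurable_rV.

Section borel_lebesgue_rV.
Context {R : realType}.

Definition rV_cons n (p : measurableTypeR R * 'rV[R]_n) : 'rV[R]_n.+1 :=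
  \row_i oapp (fun j => p.2 ord0 j) p.1 (unlift ord0 i).

Definition rV_uncons n (v : 'rV[R]_n.+1) : measurableTypeR R * 'rV[R]_n :=
  (v ord0 ord0, \row_j v ord0 (lift ord0 j)).

Lemma rV_consK n : cancel (@rV_cons n) (@rV_uncons n).
Proof.
move=> [t v]; congr pair; first by rewrite mxE unlift_none.
by apply/rowP => j; rewrite !mxE liftK.
Qed.

Lemma rV_unconsK n : cancel (@rV_uncons n) (@rV_cons n).
Proof.
move=> v; apply/rowP => i; rewrite mxE.
by case: unliftP => [j ->|->]//=; rewrite mxE.
Qed.

Lemma measurable_rV_cons n : measurable_fun setT (@rV_cons n).
Proof.
apply: measurable_fun_rV => i; have [j ->|->] := unliftP ord0 i.
  rewrite (_ : _ \o _ = coord j \o snd); last first.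
    by apply/funext => p; rewrite /= /coord mxE liftK.
  by apply: measurableT_comp => //; exact: measurable_coord.
rewrite (_ : _ \o _ = fst)//.
by apply/funext => p; rewrite /= /coord mxE unlift_none.
Qed.

Lemma measurable_rV_uncons n : measurable_fun setT (@rV_uncons n).
Proof.
apply/measurable_fun_pair; first exact: (measurable_coord ord0).
apply: measurable_fun_rV => i.
rewrite (_ : _ \o _ = coord (lift ord0 i)); first exact: measurable_coord.
by apply/funext => v; rewrite /= /coord mxE.
Qed.

Section step.
Context n (m : {sigma_finite_measure set 'rV[R]_n -> \bar R}).

Definition lebesgue_step : set 'rV[R]_n.+1 -> \bar R :=
  pushforward (lebesgue_measure \x m)%E (@rV_cons n).

Let step_measure : {measure set 'rV[R]_n.+1 -> \bar R} :=
  measure_function_pushforward__canonical__measure_function_Measure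
    (lebesgue_measure \x m)%E (@measurable_rV_cons n).

Let step0 : lebesgue_step set0 = 0%E.
Proof. exact: (measure0 step_measure). Qed.

Let step_ge0 A : (0 <= lebesgue_step A)%E.
Proof. exact: (measure_ge0 step_measure). Qed.

Let step_sigma_additive : semi_sigma_additive lebesgue_step.
Proof. exact: (@measure_semi_sigma_additive _ _ _ step_measure). Qed.

HB.instance Definition _ := isMeasure.Build _ _ _ lebesgue_step
  step0 step_ge0 step_sigma_additive.

Let step_sigma_finite : sigma_finite setT lebesgue_step.
Proof.
have /sigma_finiteP[F [TF ndF Foo]] :=
  sigma_finiteT (@lebesgue_measure R : {sigma_finite_measure set _ -> \bar R}).
have /sigma_finiteP[G [TG ndG Goo]] := sigma_finiteT m.
exists (fun k => @rV_uncons n @^-1` (F k `*` G k)).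
  apply/esym; rewrite -subTset => v _.
  have [i _ Fi] : (\bigcup_i F i) (rV_uncons v).1 by rewrite -TF.
  have [j _ Gj] : (\bigcup_i G i) (rV_uncons v).2 by rewrite -TG.
  exists (maxn i j) => //; split => /=.
  - by move: Fi; exact/subsetPset/ndF/leq_maxl.
  - by move: Gj; exact/subsetPset/ndG/leq_maxr.
move=> k; have [mF Fk] := Foo k; have [mG Gk] := Goo k; split.
  rewrite -[X in measurable X]setTI; apply: measurable_rV_uncons => //.
  exact: measurableX.
rewrite /lebesgue_step /pushforward (_ : _ @^-1` _ = F k `*` G k); last first.
  rewrite -comp_preimage (_ : _ \o _ = id) ?preimage_id//.
  by apply/funext => p; exact: rV_consK.
by rewrite product_measure1E// lte_mul_pinfty// ge0_fin_numE.
Qed.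

HB.instance Definition _ := Measure_isSigmaFinite.Build _ _ _ lebesgue_step
  step_sigma_finite.

End step.

Fixpoint borel_lebesgue n : {sigma_finite_measure set 'rV[R]_n -> \bar R} :=
  match n with
  | 0%N => \d_(0 : 'rV[R]_0)
  | n'.+1 => lebesgue_step (borel_lebesgue n')
  end.

End borel_lebesgue_rV.

Section geometry.
Context {R : realType} {n : nat}.
Local Notation Rn := 'rV[R]_n.
Implicit Types (A B E Omega : set Rn) (x y nu : Rn) (r : R).

Definition dot x y : R := \sum_(i < n) x ord0 i * y ord0 i.

(* The library's norm on 'rV[R]_n is the sup norm (same topology). *)
Definition enorm x : R := Num.sqrt (dot x x).

Definition eball x r : set Rn := [set y | enorm (y - x) < r].

Definition topo_boundary A : set Rn := closure A `\` A^°.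

Definition edist x A : \bar R :=
  ereal_inf [set (enorm (x - y))%:E | y in A].

(* [edist x set0 = +oo], so [tubular_nbhd r set0 = set0]. *)
Definition tubular_nbhd r A : set Rn := [set x | (edist x A < r%:E)%E].

(* Continuity of f need not be repeated at successor stages: it follows from
   the existence and continuity of the first partial derivatives. *)
Fixpoint Ck (k : nat) (f : Rn -> R) : Prop :=
  match k with
  | 0%N => continuous f
  | k'.+1 => forall i : 'I_n,
      (forall x, derivable f x (delta_mx ord0 i)) /\
      Ck k' (fun x => 'D_(delta_mx ord0 i) f x)
  end.

Definition smooth_fun (f : Rn -> R) : Prop := forall k, Ck k f.

Definition lipschitz_fun (f : Rn -> R) : Prop :=
  exists L : R, forall x y, `|f x - f y| <= L * enorm (x - y).

(* In a ball around each of its boundary points, A is the region strictly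
   above the graph of a function of class K over the hyperplane orthogonal to
   some unit vector nu, i.e. {x_n > g(x')} in orthonormal coordinates whose
   last axis is nu.  Only the values of g on that hyperplane matter: taking g
   defined on the whole space avoids a chart of the hyperplane, and costs
   nothing since g can be composed with the orthogonal projection. *)
Definition boundary_of_class (K : set (Rn -> R)) A : Prop :=
  forall p, topo_boundary A p ->
    exists r nu (g : Rn -> R), [/\ 0 < r, enorm nu = 1, K g &
      forall x, eball p r x ->
        (A x <-> g (x - dot x nu *: nu) < dot x nu)].

Definition lipschitz_boundary A : Prop := boundary_of_class lipschitz_fun A.

Definition smooth_boundary A : Prop := boundary_of_class smooth_fun A.

End geometry.

(* Lebesgue measure on R^n: the completion of [borel_lebesgue]. Its
   measurable sets are the Lebesgue measurable subsets of R^n. *)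
Definition lebesgueT (R : realType) (n : nat) :=
  caratheodory_type ((@borel_lebesgue R n)^*)%mu.

Definition lebesgue {R : realType} {n : nat} : set (lebesgueT R n) -> \bar R :=
  @completed_measure_extension _ _ _ (@borel_lebesgue R n).

HB.instance Definition _ (R : realType) (n : nat) := Measure.on (@lebesgue R n).

Section perimeter.
Context {R : realType} {n : nat}.
Local Notation Rn := 'rV[R]_n.
Implicit Types (s : R) (A B E Omega : set Rn).

Definition lebesgue_measurable A : Prop :=
  ((@borel_lebesgue R n)^*)%mu.-cara.-measurable A.

(* Meant for disjoint A and B; off the diagonal the base of the power is
   positive. *)
Definition interaction s A B : \bar R :=
  (\int[lebesgue]_(x in (A : set (lebesgueT R n)))
   \int[lebesgue]_(y in (B : set (lebesgueT R n)))
     ((enorm (x - y) `^ (n%:R + s))^-1)%:E)%E.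

Definition perimeter s E Omega : \bar R :=
  (interaction s (E `&` Omega) (~` E `&` Omega) +
   interaction s (E `&` Omega) (~` E `\` Omega) +
   interaction s (E `\` Omega) (~` E `&` Omega))%E.

Definition measure_boundary E : set Rn :=
  [set x | forall r : R, 0 < r ->
     (0 < lebesgue (E `&` eball x r) < lebesgue (eball x r))%E].

Definition cvg_L1loc (Eh : nat -> set Rn) E : Prop :=
  forall K : set Rn, compact K ->
    (\int[lebesgue]_(x in (K : set (lebesgueT R n)))
       (`|\1_(Eh h) x - \1_E x|)%:E)%E @[h --> \oo] --> 0%E.

End perimeter.

(* Main.v *)
(* Write F(u) ([gagliardo]) for the integral of max(0, u x - u y) |x - y|^-(n+s)
   over the pairs (x, y) with x or y in Omega; then F(1_E) = P_s(E, Omega), and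
   the coarea formula says that the integral over t of F(1_{u > t}) is F(u).
   The converse implication is immediate since the limit is at most the sup.
   For the direct one, first remove from E the points outside Omega at distance
   less than d from Omega: as Omega is Lipschitz this costs little perimeter,
   and then a translation of the set by less than d / 2 costs little as well,
   because the only new interactions are between a thin layer and points at
   distance at least d / 2 from it. By Jensen's inequality a mollification u of
   the truncated set has F(u) <= P_s(E, Omega) + small.
   Adding sum_i a_i atan(x_i) to u makes almost every level regular for almost
   every a (the critical pairs (t, a) are the image of a smooth map from R^n to
   R^(n+1), hence null), and costs little if a is small. Then coarea provides a
   regular level t in ]tau, 1 - tau[ of the perturbed function whose
   superlevel set has perimeter at most P_s(E, Omega) + small; it is smooth by
   the implicit function theorem, close to E by Chebyshev's inequality, and on
   its boundary 0 < u < 1, so that boundary points lie close to the boundary of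
   E unless they are close to the removed layer. Fatou's lemma gives the
   opposite inequality in the limit. *)

Require Import Defs.
From HB Require Import structures.
From mathcomp Require Import all_boot all_order all_algebra.
From mathcomp Require Import all_classical all_reals all_analysis.
From mathcomp Require Import ring lra measurable_realfun lebesgue_measure lebesgue_integral.

Set Implicit Arguments.
Unset Strict Implicit.
Unset Printing Implicit Defensive.

Import Order.TTheory GRing.Theory Num.Theory.
Import numFieldNormedType.Exports.

Local Open Scope classical_set_scope.
Local Open Scope ring_scope.

(** * Translation invariance *)

(** Mollifying averages translates of the set, and translating the set amounts to translating Omega:
    pairs of close points just outside Omega enter the energy, and the finiteness of P_s(E, Omega)
    says nothing about them. This is the reason for emptying an outer layer beforehand. Its width d
    is fixed before the mollification radius, because the cost of a translation contains the
    integral of the kernel over |w| >= d / 2, which blows up as d tends to 0. The positive part in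
    F, in place of an absolute value, counts each pair once, so that coarea loses no constant and
    the limit of the perimeters is exact. The perturbation has n parameters so that the vanishing of
    the gradient at x determines all of them, and the level too; regularity then rests on Lipschitz
    bounds for a map into one more dimension. The arctangent is bounded and Lipschitz, so that the
    energy of the perturbation in the bounded set Omega is finite. The analysis takes place on Borel
    sets and the product measure, where Tonelli applies; E enters through a Borel set that differs
    from it by a null set. *)

Section lebesgue_rV.
Context {R : realType}.

Lemma measurable_forall d (T : measurableType d) (I : finType) (P : I -> T -> Prop) :
  (forall i, measurable [set x | P i x]) -> measurable [set x | forall i, P i x].
Proof.
move=> mP; rewrite -[X in measurable X]setCK; apply: measurableC.
rewrite (_ : ~` _ = \bigcup_(i in [set: I]) ~` [set x | P i x]).
  by apply: fin_bigcup_measurable => // i _; exact: measurableC.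
by apply/seteqP; split => x /=; [move/existsNP => [i] ?; exists i|move=> [i _ nP] aP; exact/nP/aP].
Qed.

Lemma measurable_shiftR (a : R) :
  measurable_fun setT ((fun t => t + a) : measurableTypeR R -> measurableTypeR R).
Proof. exact: measurable_funD. Qed.

Lemma lebesgue_measure_shift (a : R) (A : set (measurableTypeR R)) :
  measurable A -> lebesgue_measure ((fun t => t + a) @^-1` A) = lebesgue_measure A.
Proof.
move=> mA.
pose m := measure_function_pushforward__canonical__measure_function_Measure
  (@lebesgue_measure R) (measurable_shiftR a).
apply/esym; apply: (@lebesgue_measure_unique R m) => // _ [[x y]] _ <-.
rewrite /m /= /pushforward.
rewrite (_ : _ @^-1` _ = `]x - a, y - a]%classic); last first.
  by apply/seteqP; split => t /=; rewrite !in_itv/= ltrBlDr lerBrDr.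
rewrite !lebesgue_measure_itv/= !lte_fin ltrD2r; case: ifP => // _.
by rewrite -!EFinB; congr (_%:E); ring.
Qed.

Lemma measurable_shift {n} (z : 'rV[R]_n) : measurable_fun setT (shift z).
Proof.
apply: measurable_fun_rV => i.
rewrite (_ : _ \o _ = (fun t => t + z ord0 i) \o Defs.coord i); last first.
  by apply/funext => x; rewrite /= /Defs.coord /shift mxE.
by apply: measurableT_comp; [exact: measurable_shiftR|exact: measurable_coord].
Qed.

Lemma measurable_shift_preimage {n} (z : 'rV[R]_n) (A : set 'rV[R]_n) :
  measurable A -> measurable (shift z @^-1` A).
Proof. by move=> mA; rewrite -[X in measurable X]setTI; exact: measurable_shift. Qed.

(** Induction on the dimension: the translated product measure agrees with the product measure on
    rectangles, and uniqueness of the product measure concludes. *)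
Lemma borel_lebesgue_shift {n} (z : 'rV[R]_n) (A : set 'rV[R]_n) :
  measurable A -> borel_lebesgue n (shift z @^-1` A) = borel_lebesgue n A.
Proof.
elim: n z A => [|n ih] z A mA.
  by congr (_ _); apply/funext => x; congr (A _); apply/rowP => -[].
pose m := @borel_lebesgue R n.
pose sh (p : measurableTypeR R * 'rV[R]_n) : measurableTypeR R * 'rV[R]_n :=
  (p.1 + z ord0 ord0, shift (\row_j z ord0 (lift ord0 j)) p.2).
have msh : measurable_fun setT sh.
  apply/measurable_fun_pair.
    exact: (measurableT_comp (measurable_shiftR _) measurable_fst).
  exact: (measurableT_comp (measurable_shift _) measurable_snd).
pose m' := measure_function_pushforward__canonical__measure_function_Measure
  (@lebesgue_measure R \x m)%E msh.
have mB : measurable (@rV_cons _ n @^-1` A).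
  by rewrite -[X in measurable X]setTI; exact: measurable_rV_cons.
change ((lebesgue_measure \x m)%E (@rV_cons R n @^-1` (shift z @^-1` A)) =
  (lebesgue_measure \x m)%E (@rV_cons R n @^-1` A)).
rewrite [RHS](@product_measure_unique _ _ _ _ _ _ _ m')//; last first.
  move=> X Y mX mY; rewrite /m'/= /pushforward.
  rewrite (_ : sh @^-1` (X `*` Y) = ((fun t => t + z ord0 ord0) @^-1` X) `*`
    (shift (\row_j z ord0 (lift ord0 j)) @^-1` Y))//.
  rewrite product_measure1E//=; last 2 first.
  - by rewrite -[X in measurable X]setTI; exact: measurable_shiftR.
  - exact: measurable_shift_preimage.
  by rewrite lebesgue_measure_shift// ih.
congr (_ _); apply/seteqP; split => -[t w]/=;
  congr A; apply/rowP => i; rewrite /shift !mxE/=;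
  by case: unliftP => [j ->|->]/=; rewrite ?mxE.
Qed.

(** Balls of the sup norm: as products of intervals they have an explicit measure, and they serve as
    windows in the local statements. *)
Definition cube n (r : R) : set 'rV[R]_n := [set v | forall i, `|v ord0 i| < r].
Arguments cube : clear implicits.

Lemma measurable_cube n r : measurable (cube n r).
Proof.
apply: (@measurable_forall _ _ _ (fun (i : 'I_n) (v : 'rV[R]_n) => `|v ord0 i| < r)).
move=> i; rewrite (_ : mkset _ = Defs.coord i @^-1` ball (0 : R) r).
  rewrite -[X in measurable X]setTI; apply: measurable_coord => //.
  exact: measurable_ball.
by apply/seteqP; split => v; rewrite /ball/= sub0r normrN.
Qed.

Lemma borel_lebesgue_cube n r : 0 <= r -> borel_lebesgue n (cube n r) = ((r *+ 2) ^+ n)%:E.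
Proof.
move=> r0; elim: n => [|n ih].
  by rewrite expr0 /= diracE mem_set// => -[].
change ((lebesgue_measure \x borel_lebesgue n)%E (@rV_cons R n @^-1` cube n.+1 r) = ((r *+ 2) ^+ n.+1)%:E).
rewrite (_ : _ @^-1` _ = ball (0:R) r `*` cube n r); last first.
  apply/seteqP; split => -[t w] /=; rewrite /ball/= sub0r normrN.
    move=> h; split => [|i]; first by have := h ord0; rewrite mxE unlift_none.
    by have := h (lift ord0 i); rewrite mxE liftK.
  by move=> [h1 h2] i; rewrite mxE; case: unliftP => [j _|_] //=.
rewrite product_measure1E//=; [|exact: measurable_ball|exact: measurable_cube].
by rewrite lebesgue_measure_ball// ih exprS.
Qed.

End lebesgue_rV.
Arguments cube {R} n r.

(** * Euclidean norm and Borel sets *)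

Section enorm_theory.
Context {R : realType} {n : nat}.
Implicit Types x y z : 'rV[R]_n.

Lemma dotxx_ge0 x : 0 <= dot x x.
Proof. by apply: sumr_ge0 => i _; rewrite -expr2 sqr_ge0. Qed.

Lemma enorm_ge0 x : 0 <= enorm x.
Proof. exact: sqrtr_ge0. Qed.

Lemma sqr_enorm x : enorm x ^+ 2 = dot x x.
Proof. by rewrite sqr_sqrtr// dotxx_ge0. Qed.

Lemma normr_coord_enorm x i : `|x ord0 i| <= enorm x.
Proof.
rewrite -(ler_pXn2r (n := 2))// ?nnegrE ?enorm_ge0// sqr_enorm real_normK ?num_real//.
by rewrite /dot (bigD1 i)//= expr2 lerDl sumr_ge0// => j _; rewrite -expr2 sqr_ge0.
Qed.

Lemma enorm_eq0 x : (enorm x == 0) = (x == 0).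
Proof.
apply/eqP/eqP => [x0|->]; last first.
  rewrite /enorm /dot big1 ?sqrtr0// => i _; by rewrite mxE mul0r.
apply/rowP => i; rewrite mxE; apply/eqP; rewrite -normr_le0 -x0.
exact: normr_coord_enorm.
Qed.

Lemma enorm0 : enorm (0 : 'rV[R]_n) = 0.
Proof. by apply/eqP; rewrite enorm_eq0. Qed.

Lemma dotZl a x y : dot (a *: x) y = a * dot x y.
Proof. by rewrite /dot mulr_sumr; apply: eq_bigr => i _; rewrite mxE mulrA. Qed.

Lemma dotC x y : dot x y = dot y x.
Proof. by apply: eq_bigr => i _; rewrite mulrC. Qed.

Lemma dotDl x y z : dot (x + y) z = dot x z + dot y z.
Proof. by rewrite /dot -big_split; apply: eq_bigr => i _; rewrite mxE mulrDl. Qed.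

Lemma dotNl x z : dot (- x) z = - dot x z.
Proof. by rewrite -scaleN1r dotZl mulN1r. Qed.

Lemma enormZ a x : enorm (a *: x) = `|a| * enorm x.
Proof.
rewrite /enorm dotZl dotC dotZl mulrA -expr2 sqrtrM ?sqr_ge0//.
by rewrite sqrtr_sqr.
Qed.

Lemma enormN x : enorm (- x) = enorm x.
Proof. by rewrite -scaleN1r enormZ normrN1 mul1r. Qed.

Lemma enormB x y : enorm (x - y) = enorm (y - x).
Proof. by rewrite -opprB enormN. Qed.

Lemma dot_le_enorm x y : dot x y <= enorm x * enorm y.
Proof.
have [x0|x0] := eqVneq (enorm x) 0.
  move/eqP: (x0); rewrite enorm_eq0 => /eqP ->.
  by rewrite enorm0 mul0r /dot big1// => i _; rewrite mxE mul0r.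
have [y0|y0] := eqVneq (enorm y) 0.
  move/eqP: (y0); rewrite enorm_eq0 => /eqP ->.
  by rewrite enorm0 mulr0 /dot big1// => i _; rewrite mxE mulr0.
have px : 0 < enorm x by rewrite lt_neqAle eq_sym x0 enorm_ge0.
have py : 0 < enorm y by rewrite lt_neqAle eq_sym y0 enorm_ge0.
have := dotxx_ge0 ((enorm x)^-1 *: x - (enorm y)^-1 *: y).
rewrite dotDl dotNl !dotZl ![dot _ (_ - _)]dotC !dotDl !dotNl !dotZl -!sqr_enorm.
rewrite (dotC y x).
set a := enorm x in px x0 *; set b := enorm y in py y0 *; set d := dot x y.
have -> : a^-1 * (a^-1 * a ^+ 2 - b^-1 * d) - b^-1 * (a^-1 * d - b^-1 * b ^+ 2) =
  2 - 2 * d / (a * b) by field; rewrite x0 y0.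
rewrite subr_ge0 ler_pdivrMr ?mulr_gt0// => ?; lra.
Qed.

Lemma ler_enormD x y : enorm (x + y) <= enorm x + enorm y.
Proof.
rewrite -(ler_pXn2r (n := 2))// ?nnegrE ?addr_ge0 ?enorm_ge0//.
rewrite sqr_enorm dotDl ![dot _ (x + y)]dotC !dotDl -!sqr_enorm (dotC y x) sqrrD.
have := dot_le_enorm x y; lra.
Qed.

Lemma ler_enorm_triangle z x y : enorm (x - y) <= enorm (x - z) + enorm (z - y).
Proof. by have := ler_enormD (x - z) (z - y); rewrite addrA subrK. Qed.

Lemma normr_coord_mx_norm x i : `|x ord0 i| <= `|x|.
Proof.
rewrite -[`|x|]/(mx_norm x) mx_normrE; apply/bigmax_geP; right => /=.
by exists (ord0, i).
Qed.

Lemma mx_norm_le x c : 0 <= c -> (forall i, `|x ord0 i| <= c) -> `|x| <= c.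
Proof.
move=> c0 xc; rewrite -[`|x|]/(mx_norm x) mx_normrE; apply/bigmax_leP; split => //.
by move=> [i j] _ /=; rewrite ord1.
Qed.

Lemma norm_le_enorm x : `|x| <= enorm x.
Proof. by apply: mx_norm_le => [|i]; rewrite ?enorm_ge0 ?normr_coord_enorm. Qed.

Lemma enorm_le_norm x : enorm x <= n%:R * `|x|.
Proof.
rewrite -(ler_pXn2r (n := 2))// ?nnegrE ?mulr_ge0 ?enorm_ge0//.
rewrite sqr_enorm /dot.
apply: (@le_trans _ _ (\sum_(i < n) `|x| ^+ 2)).
  apply: ler_sum => i _; rewrite -expr2 -real_normK ?num_real//.
  by rewrite ler_pXn2r ?nnegrE// normr_coord_mx_norm.
rewrite sumr_const card_ord exprMn -[leLHS]mulr_natl ler_wpM2r ?sqr_ge0//.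
by rewrite -natrX ler_nat; case: (n) => // m; rewrite expnS leq_pmulr// expn_gt0.
Qed.

Lemma enorm_lt_norm x r : 0 < r -> `|x| < r / n.+1%:R -> enorm x < r.
Proof.
move=> r0 xr; apply: le_lt_trans (enorm_le_norm x) _.
apply: (@le_lt_trans _ _ (n%:R * (r / n.+1%:R))); first by rewrite ler_wpM2l// ltW.
rewrite mulrCA -[ltRHS]mulr1 ltr_pM2l// ltr_pdivrMr ?ltr0n// mul1r ltr_nat//.
Qed.

Lemma nbhs_eballP x (A : set 'rV[R]_n) :
  nbhs x A <-> exists2 r, 0 < r & eball x r `<=` A.
Proof.
split.
  move=> /nbhs_ballP[r r0 rA]; exists r => // y yr; apply: rA.
  rewrite -ball_normE /ball_/=; apply: le_lt_trans (norm_le_enorm _) _.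
  by rewrite enormB.
move=> [r r0 rA]; apply/nbhs_ballP; exists (r / n.+1%:R) => /=.
  by rewrite divr_gt0// ltr0n.
move=> y; rewrite -ball_normE /ball_/= => xy; apply: rA.
rewrite /eball/= enormB; exact: enorm_lt_norm.
Qed.

Lemma eball_center x r : 0 < r -> eball x r x.
Proof. by move=> r0; rewrite /eball/= subrr enorm0. Qed.

Lemma open_eball x r : open (eball x r).
Proof.
rewrite openE => y /= xy; apply/nbhs_eballP; exists (r - enorm (y - x)).
  by rewrite subr_gt0.
move=> z; rewrite /eball/= => zy.
by apply: le_lt_trans (ler_enorm_triangle y _ _) _; rewrite -ltrBrDr.
Qed.

Lemma cvg_enormP (f : 'rV[R]_n -> R) x (l : R) : f y @[y --> x] --> l <->
  forall e, 0 < e -> exists2 r, 0 < r & forall y, enorm (y - x) < r -> `|l - f y| < e.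
Proof.
have H := @cvgrPdist_lt R R^o 'rV[R]_n (nbhs x) _ f l.
split => [/H h e e0|h]; first by apply/nbhs_eballP; exact: h.
by apply/H => e e0; apply/nbhs_eballP; exact: h.
Qed.

Lemma continuous_enormP (f : 'rV[R]_n -> R) : continuous f <->
  forall x e, 0 < e ->
    exists2 r, 0 < r & forall y, enorm (y - x) < r -> `|f x - f y| < e.
Proof. by split=> h x; apply/cvg_enormP; exact: h. Qed.

Lemma enorm_continuous : continuous (@enorm R n).
Proof.
apply/continuous_enormP => x e e0; exists e => // y yx.
rewrite ltr_norml; apply/andP; split.
  have := ler_enormD x (y - x); rewrite addrC subrK; lra.
have := ler_enormD y (x - y); rewrite addrC subrK (enormB x); lra.
Qed.

Lemma edist_ltP x A (r : R) :
  (Defs.edist x A < r%:E)%E <-> exists2 y, A y & enorm (x - y) < r.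
Proof.
split.
  by move=> /ereal_inf_lt[_ [y Ay <-]]; rewrite lte_fin => ?; exists y.
move=> [y Ay xy]; apply: (@le_lt_trans _ _ (enorm (x - y))%:E); last by rewrite lte_fin.
by apply: ereal_inf_lbound; exists y.
Qed.

Lemma tubular_nbhdP r A x :
  tubular_nbhd r A x <-> exists2 y, A y & enorm (x - y) < r.
Proof. exact: edist_ltP. Qed.

End enorm_theory.

Section borel_rV.
Context {R : realType} {n : nat}.
Notation V := 'rV[R]_n.
Implicit Types A B : set V.

(** A countable base of the topology, enumerated through [pickle]: boxes with rational centre and
    half-side 1 / (m + 1), the empty set for the other codes. It yields the measurability of open
    sets and a Lindelof property. *)
Definition rat_box (k : nat) : set V :=
  if unpickle k is Some (q, m) then
    [set x | forall i, `|x ord0 i - ratr ((q : 'rV[rat]_n) ord0 i)| < m.+1%:R^-1]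
  else set0.

Lemma measurable_rat_box k : measurable (rat_box k).
Proof.
rewrite /rat_box; case: unpickle => [[q m]|]; last exact: measurable0.
apply: (@measurable_forall _ _ _ (fun (i : 'I_n) (v : V) => `|v ord0 i - ratr (q ord0 i)| < m.+1%:R^-1)).
move=> i; rewrite (_ : mkset _ = Defs.coord i @^-1` ball (ratr (q ord0 i) : R) m.+1%:R^-1).
  rewrite -[X in measurable X]setTI; apply: measurable_coord => //.
  exact: measurable_ball.
by apply/seteqP; split => v; rewrite /ball/= distrC.
Qed.

Lemma nbhs_rat_box (x : V) A : nbhs x A -> exists2 k, rat_box k x & rat_box k `<=` A.
Proof.
move=> /nbhs_ballP[e /= e0 eA].
pose m := Num.truncn (2 / e).
have me : m.+1%:R^-1 < e / 2.
  rewrite -[ltRHS]invrK ltf_pV2 ?posrE ?ltr0n// ?invr_gt0 ?divr_gt0// invf_div.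
  exact: truncnS_gt.
have qx i : exists q, `|x ord0 i - ratr q| < m.+1%:R^-1 :> R.
  have : x ord0 i - m.+1%:R^-1 < x ord0 i + m.+1%:R^-1.
    by rewrite ltrD2l gtrN// invr_gt0 ltr0n.
  move=> /rat_in_itvoo[q]; rewrite in_itv/= => /andP[q1 q2]; exists q.
  by rewrite ltr_distlC q1 q2.
have [q qP] := choice qx.
exists (pickle (\row_i q i, m)).
  by rewrite /rat_box pickleK => i /=; rewrite mxE.
rewrite /rat_box pickleK => y/= yq; apply: eA.
rewrite -ball_normE /ball_/=; apply: (@le_lt_trans _ _ (m.+1%:R^-1 + m.+1%:R^-1)); last by rewrite [ltRHS]splitr ltrD.
apply: mx_norm_le => [|i]; first by rewrite addr_ge0// invr_ge0.
rewrite !mxE -(subrKA (ratr (q i))); apply: le_trans (ler_normD _ _) _.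
have := yq i; rewrite mxE distrC => /ltW yqi.
by rewrite lerD// ltW.
Qed.

Lemma open_measurable_rV A : open A -> measurable A.
Proof.
move=> oA; rewrite (_ : A = \bigcup_(k in [set k | rat_box k `<=` A]) rat_box k).
  by apply: bigcup_measurable => k _; exact: measurable_rat_box.
apply/seteqP; split => [x Ax|x [k kA /kA]//].
have /nbhs_rat_box[k kx kA] : nbhs x A by exact: open_nbhs_nbhs.
by exists k.
Qed.

Lemma continuous_measurable_rV (f : V -> R) :
  continuous f -> measurable_fun setT f.
Proof.
move=> cf; apply: (measurability _ (RGenOpens.measurableE R)).
move=> _ [_ [a [b ->] <-]]; rewrite setTI; apply: open_measurable_rV.
by apply: open_comp => [x _|]; [exact: cf|exact: interval_open].
Qed.

Local Notation mu := (@borel_lebesgue R n).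

Lemma measurable_eball (x : V) r : measurable (eball x r).
Proof. by apply: open_measurable_rV; exact: open_eball. Qed.

(** The boxes of the countable base in which A is null cover A. *)
Lemma lindelof_null A : measurable A ->
  (forall x, A x -> exists U, [/\ open U, U x & mu (A `&` U) = 0%E]) -> mu A = 0%E.
Proof.
move=> mA h; apply/eqP; rewrite eq_le measure_ge0 andbT.
pose D k := if pselect (mu (A `&` rat_box k) = 0%E) then A `&` rat_box k else set0.
have mD k : measurable (D k).
  rewrite /D; case: pselect => p; last exact: measurable0.
  by apply: measurableI => //; exact: measurable_rat_box.
have AD : A `<=` \bigcup_k D k; last first.
  apply: (le_trans (measure_sigma_subadditive mu mD mA AD)).
  by rewrite eseries0// => k _ _; rewrite /D; case: pselect => //=.
move=> x Ax; have [U [oU Ux AU0]] := h _ Ax.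
have /nbhs_rat_box[k kx kU] : nbhs x U by exact: open_nbhs_nbhs.
exists k => //; rewrite /D; case: pselect => [//|]; case.
apply/eqP; rewrite eq_le measure_ge0 andbT -AU0 le_measure ?inE//.
- by apply: measurableI => //; exact: measurable_rat_box.
- by apply: measurableI => //; exact: open_measurable_rV.
- exact: setIS.
Qed.

Lemma cubeE (r : R) : 0 < r -> cube n r = ball (0 : V) r.
Proof.
move=> r0; rewrite -ball_normE; apply/seteqP; split => x; rewrite /ball_/= sub0r normrN.
  move=> xr; have : `|x| <= \big[Num.max/0]_i `|x ord0 i|.
    apply: mx_norm_le => [|i]; first exact: bigmax_ge_id.
    exact: (@le_bigmax _ _ _ 0 (fun i => `|x ord0 i|)).
  by move=> /le_lt_trans; apply; apply/bigmax_ltP; split => // i _; exact: xr.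
by move=> xr i; apply: le_lt_trans xr; exact: normr_coord_mx_norm.
Qed.

Lemma borel_lebesgue_ball (x : V) (r : R) : 0 < r -> mu (ball x r) = ((r *+ 2) ^+ n)%:E.
Proof.
move=> r0; rewrite -borel_lebesgue_cube ?ltW// -(@borel_lebesgue_shift _ _ x (ball x r)).
  congr (_ _); rewrite cubeE// -!ball_normE; apply/seteqP.
  by split => y; rewrite /ball_/= /shift sub0r opprD addrCA subrr addr0.
by apply: open_measurable_rV; exact: ball_open.
Qed.

Lemma bounded_lebesgue_lty A : measurable A -> bounded_set A -> (mu A < +oo)%E.
Proof.
move=> mA [M [_ AM]]; have M0 : 0 < `|M| + 2 by apply: ltr_wpDl.
apply: (@le_lt_trans _ _ (mu (ball 0 (`|M| + 2)))); last first.
  by rewrite borel_lebesgue_ball// ltry.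
rewrite le_measure ?inE//; first by apply: open_measurable_rV; exact: ball_open.
move=> x Ax; rewrite -ball_normE /ball_/= sub0r normrN.
apply: le_lt_trans (AM (`|M| + 1) _ _ Ax) _; last by rewrite ltrD2l ltrDr.
by rewrite (le_lt_trans (ler_norm _))// ltrDl.
Qed.

Lemma bounded_eball (x : V) r : bounded_set (eball x r).
Proof.
exists (`|x| + r); split; first exact: num_real.
move=> M xM y; rewrite /eball/= => yx; apply/ltW; apply: le_lt_trans xM.
rewrite -(subrK x y) addrC; apply: le_trans (ler_normD _ _) _.
by rewrite lerD2l ltW// (le_lt_trans (norm_le_enorm _)).
Qed.

Lemma open_lebesgue_gt0 A : open A -> A !=set0 -> (0 < mu A)%E.
Proof.
move=> oA [x Ax]; have /nbhs_ballP[r r0 rA] : nbhs x A by exact: open_nbhs_nbhs.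
apply: (@lt_le_trans _ _ (mu (ball x r))).
  by rewrite borel_lebesgue_ball// lte_fin exprn_gt0// pmulrn_lgt0.
by rewrite le_measure// inE; apply: open_measurable_rV => //; exact: ball_open.
Qed.

Lemma ge0_integral_shift (z : V) (f : V -> \bar R) : measurable_fun setT f ->
  (forall x, 0 <= f x)%E -> (\int[mu]_x f (x + z)%R = \int[mu]_x f x)%E.
Proof.
move=> mf f0.
transitivity (\int[pushforward mu (shift z)]_x f x)%E; last first.
  apply: (@eq_measure_integral _ _ _ _ mu
    (measure_function_pushforward__canonical__measure_function_Measure
      mu (measurable_shift z))) => A mA _.
  exact: borel_lebesgue_shift.
by rewrite ge0_integral_pushforward//; exact: measurable_shift.
Qed.

End borel_rV.

(** * The kernel *)

Section kernel.
Context {R : realType} {n : nat}.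
Notation V := 'rV[R]_n.
Local Notation mu := (@borel_lebesgue R n).

Lemma measurable_enorm : measurable_fun setT (@enorm R n).
Proof. by apply: continuous_measurable_rV; exact: enorm_continuous. Qed.

(** For n + s > 0 the conventions on powers of 0 and on 0^-1 make the kernel vanish at the origin,
    so that the diagonal carries no energy. *)
Definition kern (s : R) (z : V) : R := (enorm z `^ (n%:R + s))^-1.

Lemma kern_ge0 s z : 0 <= kern s z.
Proof. by rewrite invr_ge0 powR_ge0. Qed.

Lemma measurable_kern s : measurable_fun setT (kern s).
Proof.
rewrite (_ : kern s = (fun t => t `^ (- (n%:R + s))) \o (@enorm R n)).
  by apply: measurableT_comp; [exact: measurable_powR|exact: measurable_enorm].
by apply/funext => z; rewrite /kern/= powRN.
Qed.

Lemma kernN s z : kern s (- z) = kern s z.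
Proof. by rewrite /kern enormN. Qed.

Lemma kern0 s : 0 < s -> kern s 0 = 0.
Proof.
move=> s0; rewrite /kern enorm0 powR0 ?invr0//.
by rewrite gt_eqF// ltr_wpDl.
Qed.

Let powRX (a r : R) k : 0 <= a -> (a `^ r) ^+ k = (a ^+ k) `^ r.
Proof. by move=> a0; rewrite -(powR_mulrn k (powR_ge0 _ _)) -(powR_mulrn k a0) powRAC. Qed.

(** A countable combination of indicators of cubes. It dominates a radial function shell by shell,
    and its integral is a series, geometric in the two uses below. *)
Let shell (c r : R^nat) (z : V) : \bar R :=
  (\sum_(k <oo) (c k * \1_(cube n (r k)) z)%:E)%E.

Let shell_lb c r z k : (forall k, 0 <= c k) ->
  cube n (r k) z -> ((c k)%:E <= shell c r z)%E.
Proof.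
move=> c0 zk; rewrite /shell (nneseriesD1 (n := k))//; last first.
  by move=> i _; rewrite lee_fin mulr_ge0.
rewrite indicE mem_set// mulr1 leeDl// nneseries_ge0// => i _ _.
by rewrite lee_fin mulr_ge0.
Qed.

Let mterm (c r : R) : measurable_fun setT (fun z : V => (c * \1_(cube n r) z)%:E).
Proof.
apply/measurable_EFinP; apply: measurable_funM => //.
by apply: measurable_indic; exact: measurable_cube.
Qed.

Let measurable_shell c r : (forall k, 0 <= c k) -> measurable_fun setT (shell c r).
Proof.
move=> c0; apply: ge0_emeasurable_sum => // k x _ _.
by rewrite lee_fin mulr_ge0.
Qed.

Let shell_lty c r a q : (forall k, 0 <= c k) -> (forall k, 0 <= r k) ->
  0 <= q < 1 -> (forall k, c k * (r k *+ 2) ^+ n = a * q ^+ k) ->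
  (\int[mu]_z shell c r z < +oo)%E.
Proof.
move=> c0 r0 /andP[q0 q1] cr; rewrite integral_nneseries//; last first.
  by move=> k z _; rewrite lee_fin mulr_ge0.
rewrite (eq_eseriesr (g := fun k => (geometric a q k)%:E)); last first.
  move=> k _; rewrite (_ : (fun z => _) = (fun z => (c k)%:E * (\1_(cube n (r k)) z)%:E)%E)//.
  rewrite ge0_integralZl_EFin//; last first.
    by apply/measurable_EFinP; apply: measurable_indic; exact: measurable_cube.
  rewrite integral_indic//; last exact: measurable_cube.
  by rewrite setIT /= borel_lebesgue_cube// -EFinM cr.
have := @cvg_geometric_series R a q; rewrite ger0_norm// => /(_ q1) h.
rewrite (_ : limn _ = (a * (1 - q)^-1)%:E) ?ltry//.
apply/cvg_lim => //; rewrite (_ : (fun n0 => _) = EFin \o series (geometric a q)).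
  by apply: cvg_EFin => //; exact: nearW.
by apply/funext => k /=; rewrite /series/= sumEFin.
Qed.

(** Near the origin the integrand is |z|^(1 - n - s), integrable because s < 1; at infinity it is
    |z|^(- n - s), integrable because s > 0. Both are dominated by geometric series over dyadic
    shells of the sup norm. *)
Lemma kern_integrable s : (0 < n)%N -> 0 < s < 1 ->
  (\int[mu]_z (Num.min 1 (enorm z) * kern s z)%:E < +oo)%E.
Proof.
move=> n0 /andP[s0 s1].
(* The shells are rho k <= |z| < 2 rho k in the unit ball and 2^k <= |z| < 2^(k+1) outside it; [c k]
   and [c' k] bound the integrand there. The two series have ratios 2^(s - 1) and 2^(- s). *)
pose rho k : R := 2^-1 ^+ k.+1.
have rho0 k : 0 < rho k by rewrite exprn_gt0// invr_gt0.
pose c k := (rho k `^ (n%:R + s - 1))^-1.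
have ns1 : 0 <= n%:R + s - 1.
  have : 1 <= n%:R :> R by rewrite ler1n.
  lra.
have ns : 0 < n%:R + s by rewrite ltr_wpDl.
pose c' k : R := ((2 ^+ k) `^ (n%:R + s))^-1.
pose g1 := shell c (fun k => rho k *+ 2).
pose g2 := shell c' (fun k => 2 ^+ k.+1).
have c0 k : 0 <= c k by rewrite invr_ge0 powR_ge0.
have c'0 k : 0 <= c' k by rewrite invr_ge0 powR_ge0.
have g1oo : (\int[mu]_z g1 z < +oo)%E.
  apply: (@shell_lty _ _ (4 ^+ n * (2^-1 `^ (1 - s))) (2^-1 `^ (1 - s))) => //.
  - by move=> k; rewrite mulrn_wge0// ltW.
  - have : (2^-1 : R) `^ (1 - s) < 1 `^ (1 - s).
      by apply: gt0_ltr_powR; rewrite ?nnegrE; lra.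
    by rewrite powR1 powR_ge0.
  move=> k; rewrite -mulrA -exprS powRX; last lra.
  have -> : rho k *+ 2 *+ 2 = 4 * rho k by ring.
  rewrite exprMn mulrCA; congr (_ * _).
  rewrite /c -powRN -(powR_mulrn n (ltW (rho0 k))) -powRD; last by apply/implyP => _; rewrite gt_eqF.
  by congr (_ `^ _); ring.
have g2oo : (\int[mu]_z g2 z < +oo)%E.
  apply: (@shell_lty _ _ (4 ^+ n) ((2 `^ s)^-1)) => //.
  - have : 1 `^ s < (2 : R) `^ s.
      by apply: gt0_ltr_powR; rewrite ?nnegrE; lra.
    by rewrite powR1 invr_ge0 powR_ge0/= => h; rewrite invf_lt1 ?powR_gt0.
  move=> k; rewrite exprVn powRX; last lra.
  have -> : 2 ^+ k.+1 *+ 2 = 4 * 2 ^+ k :> R by rewrite exprS; ring.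
  rewrite exprMn mulrCA; congr (_ * _).
  have k0 : 0 < 2 ^+ k :> R by rewrite exprn_gt0.
  rewrite /c' -(powR_mulrn n (ltW k0)) -!powRN -powRD; last by apply/implyP => _; rewrite gt_eqF.
  by congr (_ `^ _); ring.
apply: (@le_lt_trans _ _ (\int[mu]_z (g1 z + g2 z))%E); last first.
  rewrite ge0_integralD//; first exact: lte_add_pinfty.
  - by move=> z _; apply: nneseries_ge0 => k _ _; rewrite lee_fin mulr_ge0.
  - exact: measurable_shell.
  - by move=> z _; apply: nneseries_ge0 => k _ _; rewrite lee_fin mulr_ge0.
  - exact: measurable_shell.
apply: ge0_le_integral => //.
- move=> z _; rewrite lee_fin mulr_ge0 ?kern_ge0// le_min ler01 enorm_ge0//.
- apply/measurable_EFinP; apply: measurable_funM; last exact: measurable_kern.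
  by apply: measurable_minr => //; exact: measurable_enorm.
- by apply: emeasurable_funD; exact: measurable_shell.
move=> z _.
have g10 : (0 <= g1 z)%E by apply: nneseries_ge0 => k _ _; rewrite lee_fin mulr_ge0.
have g20 : (0 <= g2 z)%E by apply: nneseries_ge0 => k _ _; rewrite lee_fin mulr_ge0.
have [z0|z0] := eqVneq z 0; first by rewrite [in X in X%:E]z0 kern0// mulr0 adde_ge0.
have ez0 : 0 < enorm z by rewrite lt_neqAle eq_sym enorm_eq0 z0 enorm_ge0.
have [z1|z1] := ltP `|z| 1.
- have nz : 0 < `|z| by rewrite normr_gt0.
  have ex : exists k, rho k <= `|z|.
    exists (Num.truncn (`|z|^-1)); rewrite /rho exprVn invf_ple ?posrE//.
    apply/ltW/(lt_trans (truncnS_gt _)); rewrite -natrX ltr_nat.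
    exact: ltn_expl.
  case: (ex_minnP ex) => k rk mink.
  have zk : cube n (rho k *+ 2) z.
    rewrite cubeE ?pmulrn_lgt0// -ball_normE /ball_/= sub0r normrN.
    case: k rk mink => [|k] rk mink.
      by apply: lt_le_trans z1 _; rewrite /rho expr1 -[leRHS]mulr_natr mulVf.
    rewrite ltNge; apply/negP => h.
    have : rho k <= `|z|.
      apply: le_trans h; rewrite /rho [in leRHS]exprS.
      by rewrite -[leRHS]mulr_natr mulrAC mulVf// mul1r.
    by move=> /mink; rewrite ltnn.
  apply: (@le_trans _ _ (c k)%:E); last first.
    by apply: le_trans (@shell_lb c (fun k => rho k *+ 2) z k c0 zk) _; rewrite leeDl.
  rewrite lee_fin.
  apply: (@le_trans _ _ (enorm z * kern s z)).
    by rewrite ler_wpM2r ?kern_ge0// ge_min lexx orbT.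
  have -> : enorm z * kern s z = (enorm z `^ (n%:R + s - 1))^-1.
    rewrite /kern -(mulr_powRB1 (ltW ez0) ns) invfM mulrA mulfV ?mul1r ?gt_eqF//.
  rewrite /c lef_pV2 ?posrE ?powR_gt0//; apply: ge0_ler_powR; rewrite ?nnegrE ?enorm_ge0//.
    exact: ltW.
  exact: le_trans rk (norm_le_enorm _).
- have ex : exists k, `|z| < 2 ^+ k.+1.
    exists (Num.truncn `|z|); apply/(lt_trans (truncnS_gt _)); rewrite -natrX ltr_nat.
    exact: ltn_expl.
  case: (ex_minnP ex) => k rk mink.
  have k0 : 0 < 2 ^+ k :> R by rewrite exprn_gt0.
  have zk : 2 ^+ k <= `|z|.
    case: k rk mink {k0} => [|k] rk mink; first by rewrite expr0.
    by rewrite leNgt; apply/negP => /mink; rewrite ltnn.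
  apply: (@le_trans _ _ (c' k)%:E); last first.
    apply: (@le_trans _ _ (g2 z)); last by rewrite leeDr.
    apply: (@shell_lb c' (fun k => 2 ^+ k.+1) z k c'0); rewrite cubeE ?exprn_gt0// -ball_normE /ball_/= sub0r normrN//.
  rewrite lee_fin.
  apply: (@le_trans _ _ (kern s z)).
    by rewrite -[leRHS]mul1r ler_wpM2r ?kern_ge0// ge_min lexx.
  rewrite /c' /kern lef_pV2 ?posrE ?powR_gt0//; apply: ge0_ler_powR; rewrite ?nnegrE ?enorm_ge0//.
  - exact: ltW.
  exact: le_trans zk (norm_le_enorm _).
Qed.

End kernel.

(** * The Gagliardo functional and the coarea formula *)

Section pair_integrals.
Context {R : realType} {n : nat}.
Notation V := 'rV[R]_n.
Local Notation mu := (@borel_lebesgue R n).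
Local Notation mu2 := (mu \x mu)%E.

Lemma measurable_addV d (T : measurableType d) (f g : T -> V) :
  measurable_fun setT f -> measurable_fun setT g ->
  measurable_fun setT (fun t => f t + g t).
Proof.
move=> mf mg; apply: measurable_fun_rV => i.
rewrite (_ : _ \o _ = (Defs.coord i \o f) \+ (Defs.coord i \o g)); last first.
  by apply/funext => t; rewrite /Defs.coord/= mxE.
by apply: measurable_funD; apply: measurableT_comp => //; exact: measurable_coord.
Qed.

Lemma measurable_oppV d (T : measurableType d) (f : T -> V) :
  measurable_fun setT f -> measurable_fun setT (fun t => - f t).
Proof.
move=> mf; apply: measurable_fun_rV => i.
rewrite (_ : _ \o _ = \- (Defs.coord i \o f)); last first.
  by apply/funext => t; rewrite /Defs.coord/= mxE.
by apply: measurable_funN; apply: measurableT_comp => //; exact: measurable_coord.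
Qed.

Lemma measurable_subV d (T : measurableType d) (f g : T -> V) :
  measurable_fun setT f -> measurable_fun setT g ->
  measurable_fun setT (fun t => f t - g t).
Proof. by move=> mf mg; apply: measurable_addV => //; exact: measurable_oppV. Qed.

Lemma mem_setb (T : Type) (P : T -> bool) (x : T) : (x \in [set y | P y]) = P x.
Proof. by apply/idP/idP; rewrite inE. Qed.

Lemma measurable_set_preimage d1 d2 (T1 : measurableType d1) (T2 : measurableType d2)
  (f : T1 -> T2) (A : set T2) :
  measurable_fun setT f -> measurable A -> measurable (f @^-1` A).
Proof. by move=> mf mA; rewrite -[X in measurable X]setTI; exact: mf. Qed.

Lemma ge0_integralTD d (T : measurableType d) (m : {measure set T -> \bar R})
  (f g : T -> \bar R) :
  (forall x, 0 <= f x)%E -> measurable_fun setT f ->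
  (forall x, 0 <= g x)%E -> measurable_fun setT g ->
  (\int[m]_x (f x + g x) = \int[m]_x f x + \int[m]_x g x)%E.
Proof. by move=> f0 mf g0 mg; rewrite ge0_integralD. Qed.

Lemma ge0_integralTZl d (T : measurableType d) (m : {measure set T -> \bar R})
  (f : T -> \bar R) (k : R) :
  measurable_fun setT f -> (forall x, 0 <= f x)%E -> 0 <= k ->
  (\int[m]_x (k%:E * f x) = k%:E * \int[m]_x f x)%E.
Proof. by move=> mf f0 k0; rewrite ge0_integralZl_EFin. Qed.

Lemma ge0_le_integralT d (T : measurableType d) (m : {measure set T -> \bar R})
  (f g : T -> \bar R) :
  (forall x, 0 <= f x)%E -> measurable_fun setT f -> measurable_fun setT g ->
  (forall x, f x <= g x)%E -> (\int[m]_x f x <= \int[m]_x g x)%E.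
Proof. by move=> f0 mf mg fg; apply: ge0_le_integral => // x _; exact: fg. Qed.

Lemma ge0_integral_pair_swap (f : V * V -> \bar R) : measurable_fun setT f ->
  (forall p, 0 <= f p)%E -> (\int[mu2]_p f (p.2, p.1) = \int[mu2]_p f p)%E.
Proof.
move=> mf f0.
have msw : measurable_fun setT (fun p : V * V => (p.2, p.1)).
  by apply/measurable_fun_pair; [exact: measurable_snd|exact: measurable_fst].
rewrite fubini_tonelli2//; last first.
  exact: (measurableT_comp mf msw).
by rewrite fubini_tonelli1.
Qed.

Lemma ge0_integral_pair_shift (z : V) (f : V * V -> \bar R) : measurable_fun setT f ->
  (forall p, 0 <= f p)%E ->
  (\int[mu2]_p f (p.1 + z, p.2 + z)%R = \int[mu2]_p f p)%E.
Proof.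
move=> mf f0.
have msh : measurable_fun setT (fun p : V * V => (p.1 + z, p.2 + z)).
  by apply/measurable_fun_pair; apply: measurable_addV => //.
have f0' p : (0 <= (f \o (fun p => (p.1 + z, p.2 + z)%R)) p)%E by exact: f0.
rewrite [LHS](@fubini_tonelli1 _ _ _ _ _ mu mu _ (measurableT_comp mf msh) f0').
rewrite [RHS](@fubini_tonelli1 _ _ _ _ _ mu mu f mf f0) /fubini_F/=.
have mfx x : measurable_fun setT (fun y => f (x, y)).
  by apply: measurableT_comp => //; exact: measurable_pair1.
transitivity (\int[mu]_x (\int[mu]_y f (x + z, y)%R))%E.
  apply: eq_integral => x _.
  by rewrite (@ge0_integral_shift R n z (fun y => f (x + z, y))).
rewrite (@ge0_integral_shift R n z (fun x => \int[mu]_y f (x, y))%E)//.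
- exact: measurable_fun_fubini_tonelli_F.
- by move=> x; exact: integral_ge0.
Qed.

(** Translation invariance in the inner integral of Tonelli. The new variables are a point and a
    difference, and the kernel depends on the difference only. *)
Lemma ge0_integral_pair_shear (f : V * V -> \bar R) : measurable_fun setT f ->
  (forall p, 0 <= f p)%E ->
  (\int[mu2]_p f p = \int[mu2]_p f (p.1, p.1 + p.2)%R)%E.
Proof.
move=> mf f0.
have msh : measurable_fun setT (fun p : V * V => (p.1, p.1 + p.2)).
  by apply/measurable_fun_pair => //; apply: measurable_addV.
have f0' p : (0 <= (f \o (fun p => (p.1, p.1 + p.2)%R)) p)%E by exact: f0.
rewrite [LHS](@fubini_tonelli1 _ _ _ _ _ mu mu f mf f0).
rewrite [RHS](@fubini_tonelli1 _ _ _ _ _ mu mu _ (measurableT_comp mf msh) f0').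
rewrite /fubini_F/=; apply: eq_integral => x _.
rewrite -(@ge0_integral_shift R n x (fun y => f (x, y)))//.
  by apply: eq_integral => y _; rewrite addrC.
by apply: measurableT_comp => //; exact: measurable_pair1.
Qed.

Lemma measurable_diff : measurable_fun setT (fun p : V * V => p.2 - p.1).
Proof. by apply: measurable_subV. Qed.

Lemma ge0_integral_pair_diffl (A : set V) (h : V -> R) : measurable A ->
  measurable_fun setT h -> (forall z, 0 <= h z) ->
  (\int[mu2]_p (\1_A p.1 * h (p.2 - p.1)%R)%:E = mu A * \int[mu]_z (h z)%:E)%E.
Proof.
move=> mA mh h0.
have m1 : measurable_fun setT (fun p : V * V => (\1_A p.1 * h (p.2 - p.1)%R)%:E).
  apply/measurable_EFinP; apply: measurable_funM.
    by apply: measurableT_comp => //; exact: measurable_indic.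
  by apply: measurableT_comp => //; exact: measurable_diff.
rewrite ge0_integral_pair_shear//=; last first.
  by move=> p; rewrite lee_fin mulr_ge0.
under eq_integral do rewrite addrC addKr.
rewrite fubini_tonelli1//=; first last.
- by move=> p; rewrite lee_fin mulr_ge0.
- apply/measurable_EFinP; apply: measurable_funM.
    by apply: measurableT_comp => //; exact: measurable_indic.
  by apply: measurableT_comp.
rewrite /fubini_F/=.
under eq_integral => x _.
  under eq_integral do rewrite EFinM.
  rewrite ge0_integralZl_EFin//; last 2 first.
  - by move=> z _; rewrite lee_fin.
  - exact/measurable_EFinP.
  over.
rewrite ge0_integralZr//; last 2 first.
- by apply/measurable_EFinP; exact: measurable_indic.
- by apply: integral_ge0 => z _; rewrite lee_fin.
by rewrite integral_indic// setIT.
Qed.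

End pair_integrals.

Section product_sigma_finite.
Context {R : realType} {n : nat}.
Notation V := 'rV[R]_n.
Local Notation mu := (@borel_lebesgue R n).

Lemma borel_lebesgue2_sigma_finite : sigma_finite setT (mu \x mu)%E.
Proof.
have /sigma_finiteP[F [TF ndF Foo]] := sigma_finiteT mu.
exists (fun k => F k `*` F k).
  apply/esym; rewrite -subTset => -[x y] _.
  have [i _ Fi] : (\bigcup_i F i) x by rewrite -TF.
  have [j _ Fj] : (\bigcup_i F i) y by rewrite -TF.
  exists (maxn i j) => //; split => /=.
  - by move: Fi; exact/subsetPset/ndF/leq_maxl.
  - by move: Fj; exact/subsetPset/ndF/leq_maxr.
move=> k; have [mF Fk] := Foo k; split; first exact: measurableX.
by rewrite product_measure1E// lte_mul_pinfty// ge0_fin_numE.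
Qed.

(** Packaged as a sigma-finite measure so that Tonelli also exchanges an integral over pairs with
    one over levels (coarea) or over translations (mollification). *)
Definition borel_lebesgue2 : {sigma_finite_measure set (V * V)%type -> \bar R} :=
  HB.pack_for {sigma_finite_measure set (V * V)%type -> \bar R} (mu \x mu)%E
  (Measure_isSigmaFinite.Build _ _ _ _ borel_lebesgue2_sigma_finite).

End product_sigma_finite.

Section gagliardo.
Context {R : realType} {n : nat}.
Notation V := 'rV[R]_n.
Local Notation mu := (@borel_lebesgue R n).
Local Notation mu2 := (mu \x mu)%E.
Implicit Types (s : R) (u : V -> R) (Omega A B E : set V).

Definition touching Omega : set (V * V) := [set p | Omega p.1 \/ Omega p.2].

Lemma measurable_touching Omega : measurable Omega -> measurable (touching Omega).
Proof.
move=> mO; rewrite (_ : touching Omega = (fst @^-1` Omega) `|` (snd @^-1` Omega))//.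
by apply: measurableU; apply: measurable_set_preimage.
Qed.

Definition posdiff u (p : V * V) : R := Num.max 0 (u p.1 - u p.2).

Lemma posdiff_ge0 u p : 0 <= posdiff u p.
Proof. by rewrite le_max lexx. Qed.

Lemma measurable_posdiff u : measurable_fun setT u -> measurable_fun setT (posdiff u).
Proof.
move=> mu_; apply: measurable_maxr => //; apply: measurable_funB;
  by apply: measurableT_comp.
Qed.

Lemma posdiff_indic A p : posdiff \1_A p = \1_A p.1 * \1_(~` A) p.2.
Proof.
rewrite /posdiff !indicE in_setC; case: (p.1 \in A); case: (p.2 \in A);
  rewrite /= ?subrr ?subr0 ?sub0r ?mulr0 ?mulr1 ?maxxx//.
- by apply/max_idPr.
- by apply/max_idPl; rewrite lerN10.
Qed.

Definition kernd s (p : V * V) := kern s (p.2 - p.1).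

Lemma kernd_ge0 s p : 0 <= kernd s p.
Proof. exact: kern_ge0. Qed.

Lemma measurable_kernd s : measurable_fun setT (kernd s).
Proof. by apply: measurableT_comp; [exact: measurable_kern|exact: measurable_diff]. Qed.

Definition gagliardo s Omega u : \bar R :=
  (\int[mu2]_p (posdiff u p * (\1_(touching Omega) p * kernd s p))%:E)%E.

Lemma measurable_gagliardo s Omega u : measurable Omega -> measurable_fun setT u ->
  measurable_fun setT (fun p => (posdiff u p * (\1_(touching Omega) p * kernd s p))%:E).
Proof.
move=> mO mu_; apply/measurable_EFinP; apply: measurable_funM.
  exact: measurable_posdiff.
apply: measurable_funM; last exact: measurable_kernd.
by apply: measurable_indic; exact: measurable_touching.
Qed.

Lemma gagliardo_integrand_ge0 s Omega u p :
  (0 <= (posdiff u p * (\1_(touching Omega) p * kernd s p))%:E)%E.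
Proof. by rewrite lee_fin !mulr_ge0 ?posdiff_ge0 ?kernd_ge0. Qed.

Section coarea_formula.
Variables (s : R) (Omega : set V) (u : V -> R).
Hypotheses (mO : measurable Omega) (mu_ : measurable_fun setT u).

Let h (q : (V * V) * measurableTypeR R) : \bar R :=
  (\1_[set q | u q.1.2 <= q.2 < u q.1.1]%R q * (\1_(touching Omega) q.1 * kernd s q.1))%:E.

Let h0 q : (0 <= h q)%E.
Proof. by rewrite lee_fin !mulr_ge0 ?kernd_ge0. Qed.

Let mS : measurable [set q : (V * V) * measurableTypeR R | u q.1.2 <= q.2 < u q.1.1].
Proof.
rewrite (_ : mkset _ = (fun q => u q.1.2 <= q.2) @^-1` [set true] `&`
   (fun q : (V * V) * measurableTypeR R => q.2 < u q.1.1) @^-1` [set true]); last first.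
  by apply/seteqP; split => q /=; [move=> /andP[-> ->]|move=> [-> ->]].
have m12 : measurable_fun setT (fun q : (V * V) * measurableTypeR R => u q.1.2).
  apply: measurableT_comp => //.
  exact: (measurableT_comp measurable_snd measurable_fst).
have m11 : measurable_fun setT (fun q : (V * V) * measurableTypeR R => u q.1.1).
  apply: measurableT_comp => //.
  exact: (measurableT_comp measurable_fst measurable_fst).
apply: measurableI; apply: measurable_set_preimage => //.
- by apply: measurable_fun_ler.
- by apply: measurable_fun_ltr.
Qed.

Let mh : measurable_fun setT h.
Proof.
apply/measurable_EFinP; apply: measurable_funM; first exact: measurable_indic.
apply: measurable_funM.
  by apply: measurableT_comp => //; apply: measurable_indic; exact: measurable_touching.
by apply: measurableT_comp => //; exact: measurable_kernd.
Qed.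

Let levelE t : (gagliardo s Omega (\1_[set x | t < u x]%R : V -> R) =
  \int[mu2]_p h (p, t))%E.
Proof.
apply: eq_integral => p _.
rewrite /h posdiff_indic; congr ((_ * _)%:E).
rewrite !indicE in_setC !mem_setb/= -leNgt.
by case: (u p.2 <= t); case: (t < u p.1); rewrite /= ?mulr1 ?mulr0.
Qed.

Lemma measurable_gagliardo_level :
  measurable_fun setT (fun t : measurableTypeR R =>
    gagliardo s Omega (\1_[set x | t < u x]%R : V -> R)).
Proof.
under eq_fun do rewrite levelE.
exact: (@measurable_fun_fubini_tonelli_G _ _ _ _ _ (@borel_lebesgue2 R n) h mh h0).
Qed.

(** max(0, u x - u y) is the length of [u y, u x[, the set of levels t for which {u > t} contains x
    and not y; Tonelli does the rest. *)
Lemma coarea : gagliardo s Omega u =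
  (\int[lebesgue_measure]_t gagliardo s Omega (\1_[set x | t < u x]%R : V -> R))%E.
Proof.
under eq_integral do rewrite levelE.
rewrite -[RHS](@fubini_tonelli _ _ _ _ _ (@borel_lebesgue2 R n) (@lebesgue_measure R) h mh h0).
apply: eq_integral => p _.
rewrite /h/=; under eq_integral do rewrite EFinM.
rewrite ge0_integralZr//; last 2 first.
- apply/measurable_EFinP; apply: measurableT_comp; first exact: measurable_indic.
  exact: measurable_pair1.
- by rewrite lee_fin mulr_ge0 ?kernd_ge0.
rewrite EFinM; congr (_ * _)%E.
transitivity (\int[lebesgue_measure]_t (\1_(`[u p.2, u p.1[%classic : set (measurableTypeR R)) t)%:E)%E.
  rewrite integral_indic// setIT /= lebesgue_measure_itv/= lte_fin /posdiff -EFinB.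
  case: ltP => h12; first by rewrite max_r// subr_ge0 ltW.
  by rewrite max_l// subr_le0.
by apply: eq_integral => t _; congr (_%:E); rewrite !indicE; congr (_%:R).
Qed.

End coarea_formula.

End gagliardo.

(** * Lebesgue versus Borel sets *)

Section lebesgue_vs_borel.
Context {R : realType} {n : nat}.
Notation V := 'rV[R]_n.
Local Notation mu := (@borel_lebesgue R n).
Local Notation leb := (@lebesgue R n).
Implicit Types (A B E : set V).

Lemma borel_lebesgue_measurable A : measurable A -> lebesgue_measurable A.
Proof. by move=> mA; exact: caratheodory_measurable_mu_ext. Qed.

Lemma lebesgueE A : measurable A -> leb A = mu A.
Proof. by move=> mA; exact: measurable_mu_extE. Qed.

Lemma measurable_id_lebesgueT :
  measurable_fun setT ((fun x => x) : lebesgueT R n -> V).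
Proof. by move=> _ A mA; rewrite setTI; exact: borel_lebesgue_measurable. Qed.

Lemma ge0_integral_lebesgueE A (f : V -> \bar R) : measurable A ->
  measurable_fun setT f -> (forall x, 0 <= f x)%E ->
  (\int[leb]_(x in (A : set (lebesgueT R n))) f x = \int[mu]_(x in A) f x)%E.
Proof.
move=> mA mf f0.
transitivity (\int[pushforward leb ((fun x => x) : lebesgueT R n -> V)]_(x in A) f x)%E.
  rewrite ge0_integral_pushforward//; first exact: measurable_id_lebesgueT.
  exact: measurable_funTS.
apply: (@eq_measure_integral _ _ _ _ mu
    (measure_function_pushforward__canonical__measure_function_Measure
      leb measurable_id_lebesgueT)) => B mB _.
exact: lebesgueE.
Qed.

(** G is the intersection of countable Borel covers exceeding the outer measure of A by at most 1 /
    (k + 1), or the whole space if that measure is infinite. *)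
Lemma lebesgue_hull A : exists G, [/\ measurable G, A `<=` G & leb G = leb A].
Proof.
have [Aoo|Afin] := eqVneq (leb A) +oo%E.
  exists setT; split => //; apply/eqP; rewrite eq_le; apply/andP; split.
    by rewrite Aoo leey.
  exact: le_mu_ext.
have fA : leb A \is a fin_num by rewrite ge0_fin_numE// ?ltey// mu_ext_ge0.
have ex k : exists U, [/\ measurable U, A `<=` U & (mu U <= leb A + (k.+1%:R^-1)%:E)%E].
  have k0 : 0 < k.+1%:R^-1 :> R by rewrite invr_gt0 ltr0n.
  have [_ [F [mF AF] <-] hF] := lb_ereal_inf_adherent k0 fA.
  exists (\bigcup_i F i); split => //; first exact: bigcupT_measurable.
  apply: (@le_trans _ _ (\sum_(i <oo) mu (F i))%E); last exact: ltW.
  by apply: measure_sigma_subadditive => //; exact: bigcupT_measurable.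
have [U /all_and3[mU AU muU]] := choice ex.
have mG : measurable (\bigcap_k U k) by exact: bigcapT_measurable.
exists (\bigcap_k U k); split => //; first by move=> x Ax k _; exact: AU.
apply/eqP; rewrite eq_le; apply/andP; split; last first.
  by apply: le_mu_ext => x Ax k _; exact: AU.
apply/lee_addgt0Pr => e e0.
pose k := Num.truncn (e^-1).
apply: (@le_trans _ _ (mu (U k))).
  rewrite lebesgueE// le_measure ?inE//.
  exact: bigcap_inf.
apply: (le_trans (muU k)); rewrite leeD2l// lee_fin.
rewrite invf_ple ?posrE ?ltr0n//; apply/ltW; exact: truncnS_gt.
Qed.

(** Deliberately asymmetric: a Lebesgue measurable set on the left, a Borel representative of it on
    the right. *)
Definition lebesgue_equiv A B :=
  [/\ lebesgue_measurable A, measurable B & leb (A `+` B) = 0%E].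

Lemma lebesgue_equiv_refl A : measurable A -> lebesgue_equiv A A.
Proof.
move=> mA; split => //; first exact: borel_lebesgue_measurable.
by rewrite setYK; exact: mu_ext0.
Qed.

Let mleb (A : set V) : lebesgue_measurable A ->
  measurable (A : set (lebesgueT R n)).
Proof. by []. Qed.

Let leb_subnull (A B : set V) : A `<=` B -> leb B = 0%E -> leb A = 0%E.
Proof.
move=> AB B0; apply/eqP; rewrite eq_le mu_ext_ge0// andbT -B0.
exact: le_mu_ext.
Qed.

(** Hulls are taken of A cut by cubes: the excess of a hull is null by subtraction, which requires
    finite measure. *)
Lemma exists_lebesgue_equiv A : lebesgue_measurable A -> exists B, lebesgue_equiv A B.
Proof.
move=> mA.
pose C k : set V := cube n k.+1%:R.
have mC k : measurable (C k) by exact: measurable_cube.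
have [G /all_and3[mG AG GA]] := choice (fun k => lebesgue_hull (A `&` C k)).
have mB : measurable (\bigcup_k G k) by exact: bigcupT_measurable.
have mLA k : measurable (A `&` C k : set (lebesgueT R n)).
  by apply: measurableI; [exact: mleb|apply: mleb; exact: borel_lebesgue_measurable].
have mLG k : measurable (G k : set (lebesgueT R n)).
  by apply: mleb; exact: borel_lebesgue_measurable.
have null k : leb (G k `\` (A `&` C k)) = 0%E.
  have fin : (leb (A `&` C k) < +oo)%E.
    apply: (@le_lt_trans _ _ (leb (C k))); first by apply: le_mu_ext; exact: subIsetr.
    by rewrite lebesgueE// borel_lebesgue_cube// ltry.
  rewrite (measureD (mLG k) (mLA k))/=; last by rewrite GA.
  rewrite setIidr; last exact: AG.
  by rewrite GA subee// ge0_fin_numE// mu_ext_ge0.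
exists (\bigcup_k G k); split => //.
apply: (@leb_subnull _ (\bigcup_k (G k `\` (A `&` C k)))).
  move=> x [[Ax nG]|[[k _ Gx] nA]].
    case: nG; pose k := Num.truncn `|x|.
    have Cx : C k x.
      rewrite /C cubeE ?ltr0n// -ball_normE /ball_/= sub0r normrN.
      exact: truncnS_gt.
    by exists k => //; apply: AG.
  by exists k => //; split => // -[].
apply/eqP; rewrite eq_le mu_ext_ge0 ?andbT//.
apply: (le_trans (mu_ext_sigma_subadditive _ _)) => //.
by rewrite eseries0// => i _ _; exact: null.
Qed.

Lemma lebesgue_equivI A B C : measurable C ->
  lebesgue_equiv A B -> lebesgue_equiv (A `&` C) (B `&` C).
Proof.
move=> mC [mA mB AB0]; split.
- by apply: (@measurableI _ (lebesgueT R n)); [exact: mleb|apply: mleb; exact: borel_lebesgue_measurable].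
- exact: measurableI.
apply: leb_subnull AB0 => x [[[Ax Cx] nB]|[[Bx Cx] nA]].
- by left; split => // Bx; exact: nB.
- by right; split => // Ax; exact: nA.
Qed.

Lemma lebesgue_equivC A B : lebesgue_equiv A B -> lebesgue_equiv (~` A) (~` B).
Proof.
move=> [mA mB AB0]; split.
- by apply: (@measurableC _ (lebesgueT R n)); exact: mleb.
- exact: measurableC.
apply: leb_subnull AB0 => x [[nA nnB]|[nB nnA]].
- by right; split => //; apply: contrapT.
- by left; split => //; apply: contrapT.
Qed.

Lemma ge0_integral_lebesgue_equiv A B (f : V -> \bar R) : lebesgue_equiv A B ->
  measurable_fun setT f -> (forall x, 0 <= f x)%E ->
  (\int[leb]_(x in (A : set (lebesgueT R n))) f x = \int[mu]_(x in B) f x)%E.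
Proof.
move=> [mA mB AB0] mf f0; rewrite -ge0_integral_lebesgueE//.
have mLA : measurable (A : set (lebesgueT R n)) by exact: mleb.
have mLB : measurable (B : set (lebesgueT R n)).
  by apply: mleb; exact: borel_lebesgue_measurable.
have mN : measurable (A `+` B : set (lebesgueT R n)).
  by apply: measurableU; apply: measurableD.
have mLf D : measurable_fun (D : set (lebesgueT R n)) f.
  apply: measurable_funTS; exact: (measurableT_comp mf measurable_id_lebesgueT).
rewrite (ge0_negligible_integral mN mLA)//.
rewrite [RHS](ge0_negligible_integral mN mLB)//.
congr (integral _ _ _); apply/seteqP; split => x [Dx nN]; split => //.
- by apply: contrapT => nB; apply: nN; left.
- by apply: contrapT => nA; apply: nN; right.
Qed.

Lemma lebesgue_equivE A B : lebesgue_equiv A B -> leb A = mu B.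
Proof.
move=> AB; have [mA mB _] := AB.
have := @ge0_integral_lebesgue_equiv A B (cst 1%E) AB.
rewrite (integral_cst _ mB) (@integral_cst _ (lebesgueT R n))// !mul1e.
by apply => //; exact: measurable_cst.
Qed.

Local Notation mu2 := (mu \x mu)%E.

(** The iterated integrals for the completed measure become one integral over pairs for the Borel
    product measure. The sets are exchanged one variable at a time, the integrand staying Borel
    throughout. *)
Lemma interaction_lebesgue_equiv s A B A0 B0 :
  lebesgue_equiv A A0 -> lebesgue_equiv B B0 ->
  interaction s A B = (\int[mu2]_p (\1_A0 p.1 * \1_B0 p.2 * kernd s p)%:E)%E.
Proof.
move=> AA0 BB0; have [_ mA0 _] := AA0; have [_ mB0 _] := BB0.
have mker (x : V) : measurable_fun setT (fun y : V => (kern s (x - y))%:E).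
  apply/measurable_EFinP; apply: measurableT_comp; first exact: measurable_kern.
  by apply: measurable_subV.
have mg : measurable_fun setT (fun p : V * V => (\1_A0 p.1 * \1_B0 p.2 * kernd s p)%:E).
  apply/measurable_EFinP; apply: measurable_funM; last exact: measurable_kernd.
  by apply: measurable_funM; apply: measurableT_comp => //; exact: measurable_indic.
have g0 (p : V * V) : (0 <= (\1_A0 p.1 * \1_B0 p.2 * kernd s p)%:E :> \bar R)%E.
  by rewrite lee_fin !mulr_ge0 ?kernd_ge0.
have mg1 : measurable_fun setT (fun p : V * V => (\1_B0 p.2 * kernd s p)%:E).
  apply/measurable_EFinP; apply: measurable_funM; last exact: measurable_kernd.
  by apply: measurableT_comp => //; exact: measurable_indic.
have g10 (p : V * V) : (0 <= (\1_B0 p.2 * kernd s p)%:E :> \bar R)%E.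
  by rewrite lee_fin !mulr_ge0 ?kernd_ge0.
rewrite (@fubini_tonelli1 _ _ _ _ _ mu mu _ mg g0) /interaction.
have inner (x : V) : (\int[leb]_(y in (B : set (lebesgueT R n)))
    ((enorm (x - y) `^ (n%:R + s))^-1)%:E = \int[mu]_y (\1_B0 y * kernd s (x, y))%:E)%E.
  rewrite (@ge0_integral_lebesgue_equiv _ _ (fun y => (kern s (x - y))%:E) BB0)//; last first.
    by move=> y; rewrite lee_fin kern_ge0.
  rewrite integral_mkcond; apply: eq_integral => y _.
  rewrite /patch indicE /kernd/= -kernN opprB; case: ifP => _; first by rewrite mul1r.
  by rewrite mul0r.
under eq_integral do rewrite inner.
rewrite (ge0_integral_lebesgue_equiv AA0)//; last 2 first.
- exact: (measurable_fun_fubini_tonelli_F _ mg1 g10).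
- by move=> x; apply: integral_ge0 => y _; exact: (g10 (x, y)).
rewrite integral_mkcond; apply: eq_integral => x _.
rewrite /patch /fubini_F/= [in RHS]indicE; case: ifP => _.
  by apply: eq_integral => y _; rewrite mul1r.
by rewrite integral0_eq// => y _; rewrite !mul0r.
Qed.

(** The three interactions split the pairs of E0 times its complement that touch Omega, according to
    which of the two points lie in Omega. The sixteen truth values at the end check this identity of
    indicators. *)
Lemma perimeter_gagliardo s E E0 Omega : measurable Omega -> lebesgue_equiv E E0 ->
  perimeter s E Omega = gagliardo s Omega (\1_E0 : V -> R).
Proof.
move=> mO EE0; have [_ mE0 _] := EE0.
rewrite /perimeter !setDE.
have mOc := measurableC mO.
have EC := lebesgue_equivC EE0.
have mE0c := measurableC mE0.
rewrite (interaction_lebesgue_equiv s (lebesgue_equivI mO EE0) (lebesgue_equivI mO EC)).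
rewrite (interaction_lebesgue_equiv s (lebesgue_equivI mO EE0) (lebesgue_equivI mOc EC)).
rewrite (interaction_lebesgue_equiv s (lebesgue_equivI mOc EE0) (lebesgue_equivI mO EC)).
have mg A B : measurable A -> measurable B ->
    measurable_fun setT (fun p : V * V => (\1_A p.1 * \1_B p.2 * kernd s p)%:E).
  move=> mA mB.
  apply/measurable_EFinP; apply: measurable_funM; last exact: measurable_kernd.
  by apply: measurable_funM; apply: measurableT_comp => //; exact: measurable_indic.
have g0 A B (p : V * V) : (0 <= (\1_A p.1 * \1_B p.2 * kernd s p)%:E :> \bar R)%E.
  by rewrite lee_fin !mulr_ge0 ?kernd_ge0.
pose f A B (p : V * V) : \bar R := (\1_A p.1 * \1_B p.2 * kernd s p)%:E.
have mI A B := @measurableI _ V A B.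
have E12 := ge0_integralTD mu2 (g0 (E0 `&` Omega) (~` E0 `&` Omega))
  (mg _ _ (mI _ _ mE0 mO) (mI _ _ mE0c mO)) (g0 (E0 `&` Omega) (~` E0 `&` ~` Omega))
  (mg _ _ (mI _ _ mE0 mO) (mI _ _ mE0c mOc)).
rewrite -E12.
have g120 p : (0 <= f (E0 `&` Omega) (~` E0 `&` Omega) p +
  f (E0 `&` Omega) (~` E0 `&` ~` Omega) p)%E by rewrite adde_ge0 ?g0.
have E3 := ge0_integralTD mu2 g120
  (emeasurable_funD (mg _ _ (mI _ _ mE0 mO) (mI _ _ mE0c mO))
    (mg _ _ (mI _ _ mE0 mO) (mI _ _ mE0c mOc))) (g0 (E0 `&` ~` Omega) (~` E0 `&` Omega))
  (mg _ _ (mI _ _ mE0 mOc) (mI _ _ mE0c mO)).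
rewrite -E3.
apply: eq_integral => p _; rewrite /f -!EFinD posdiff_indic; congr (_%:E).
rewrite !indicE !in_setI !in_setC [in RHS](_ : p \in touching Omega =
  (p.1 \in Omega) || (p.2 \in Omega)).
  by case: (p.1 \in E0); case: (p.2 \in E0); case: (p.1 \in Omega); case: (p.2 \in Omega) => /=; ring.
by apply/idP/orP; rewrite !inE /touching/=; [move=> [?|?]; [left|right]|move=> [?|?]; [left|right]]; rewrite ?inE//.
Qed.

End lebesgue_vs_borel.

(** * Neighborhoods of a Lipschitz boundary *)

Section neighborhoods.
Context {R : realType} {n : nat}.
Notation V := 'rV[R]_n.
Local Notation mu := (@borel_lebesgue R n).
Implicit Types (A B Omega : set V) (x y nu : V).

Lemma open_tubular_nbhd (r : R) A : open (tubular_nbhd r A).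
Proof.
rewrite openE => x /tubular_nbhdP[y Ay xy]; apply/nbhs_eballP.
exists (r - enorm (x - y)); first by rewrite subr_gt0.
move=> z; rewrite /eball/= => zx; apply/tubular_nbhdP; exists y => //.
by apply: le_lt_trans (ler_enorm_triangle x _ _) _; rewrite -ltrBrDr.
Qed.

Lemma measurable_tubular_nbhd (r : R) A : measurable (tubular_nbhd r A).
Proof. by apply: open_measurable_rV; exact: open_tubular_nbhd. Qed.

Lemma topo_boundary_open Omega x : open Omega ->
  topo_boundary Omega x <-> closure Omega x /\ ~ Omega x.
Proof. by move=> oO; rewrite /topo_boundary (proj1 (interior_id _) oO). Qed.

Lemma closure_enormP A x : closure A x <->
  forall e, 0 < e -> exists2 y, A y & enorm (y - x) < e.
Proof.
split.
  move=> cA e e0; have [|y [Ay xy]] := cA (eball x e); last by exists y.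
  by apply/nbhs_eballP; exists e.
move=> h B /nbhs_eballP[e e0 eB]; have [y Ay yx] := h e e0.
by exists y; split => //; exact: eB.
Qed.

(* The last point of the segment from x to y that is a limit of points of
   Omega on the segment belongs to the boundary. *)
Lemma segment_meets_topo_boundary Omega x y : open Omega -> Omega x -> ~ Omega y ->
  exists2 t : R, 0 <= t <= 1 & topo_boundary Omega (x + t *: (y - x)).
Proof.
move=> oO Ox nOy.
pose g (t : R) := x + t *: (y - x).
pose S := [set t : R | 0 <= t <= 1 /\ Omega (g t)].
have S0 : S 0 by split; rewrite ?lexx ?ler01// /g scale0r addr0.
have ubS : ubound S 1 by move=> t [/andP[]].
have hS : has_sup S by split; [exists 0|exists 1].
pose t := sup S.
have t0 : 0 <= t by apply: ub_le_sup => //; exact: hS.2.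
have t1 : t <= 1 by apply: ge_sup => //; exists 0.
have gB a b : g a - g b = (a - b) *: (y - x).
  by rewrite /g opprD addrACA subrr add0r scalerBl.
exists t; first by rewrite t0.
apply/(topo_boundary_open _ oO); split.
  apply/closure_enormP => e e0.
  pose d := e / (enorm (y - x) + 1).
  have d0 : 0 < d by rewrite divr_gt0// ltr_wpDl// enorm_ge0.
  have [u [Su0 Su1] ut] := sup_adherent d0 hS.
  exists (g u) => //; rewrite gB enormZ.
  have ut' : u <= t by apply: ub_le_sup => //; exact: hS.2.
  rewrite distrC ger0_norm ?subr_ge0//.
  have td : t - u < d by rewrite ltrBlDr -ltrBlDl -/t.
  apply: (@le_lt_trans _ _ (d * enorm (y - x))).
    by rewrite ler_wpM2r ?enorm_ge0// ltW.
  rewrite /d mulrAC ltr_pdivrMr; last by rewrite ltr_wpDl// enorm_ge0.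
  by rewrite ltr_pM2l// ltrDl.
move=> Ogt.
have : nbhs (g t) Omega by exact: open_nbhs_nbhs.
move=> /nbhs_eballP[e e0 eO].
have t1' : t < 1.
  rewrite lt_neqAle t1 andbT; apply/eqP => tE; apply: nOy.
  by move: Ogt; rewrite tE /g scale1r addrC subrK.
pose d := Num.min (1 - t) (e / 2 / (enorm (y - x) + 1)).
have h1 : 0 < enorm (y - x) + 1 by rewrite ltr_wpDl// enorm_ge0.
have d0 : 0 < d by rewrite lt_min subr_gt0 t1'/= !divr_gt0.
suff : S (t + d).
  move=> /(ub_le_sup hS.2); rewrite -/t gerDl leNgt => /negP; apply; exact: d0.
split; first by rewrite addr_ge0 ?(ltW d0)//= -lerBrDl ge_min lexx.
apply: eO; rewrite /eball/= gB [t + d]addrC addrK enormZ gtr0_norm//.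
apply: (@le_lt_trans _ _ (e / 2 / (enorm (y - x) + 1) * enorm (y - x))).
  by rewrite ler_wpM2r ?enorm_ge0// ge_min lexx orbT.
rewrite mulrAC ltr_pdivrMr// -[ltRHS]mulrC.
apply: (@le_lt_trans _ _ ((enorm (y - x) + 1) * (e / 2))).
  by rewrite mulrC ler_wpM2r ?divr_ge0 ?(ltW e0)// lerDl.
by rewrite ltr_pM2l// ltr_pdivrMr// ltr_pMr// ltr1n.
Qed.

Lemma segment_topo_boundary Omega x y : open Omega -> Omega x -> ~ Omega y ->
  exists2 w, topo_boundary Omega w & enorm (x - w) <= enorm (x - y) /\
    enorm (y - w) <= enorm (x - y).
Proof.
move=> oO Ox nOy.
have [t /andP[t0 t1] bw] := segment_meets_topo_boundary oO Ox nOy.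
exists (x + t *: (y - x)) => //.
have -> : x - (x + t *: (y - x)) = t *: (x - y).
  by rewrite opprD addrA subrr add0r -scalerN opprB.
have -> : y - (x + t *: (y - x)) = (1 - t) *: (y - x).
  by rewrite opprD addrA scalerBl scale1r.
rewrite !enormZ (enormB y) !ger0_norm ?subr_ge0//.
by split; apply: ler_piMl; rewrite ?enorm_ge0// gerBl.
Qed.

Lemma bounded_closure A : bounded_set A -> bounded_set (closure A).
Proof.
move=> [M [_ AM]]; exists (`|M| + 2); split; first exact: num_real.
move=> K MK x /closure_enormP/(_ 1 ltr01)[y Ay yx].
have := AM (`|M| + 1) _ y Ay; rewrite (le_lt_trans (ler_norm M)) ?ltrDl// => /(_ isT) yM.
apply: ltW; apply: le_lt_trans MK; rewrite -(subrK y x).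
apply: le_trans (ler_normD _ _) _; rewrite [leRHS](_ : _ = 1 + (`|M| + 1)); last by ring.
by rewrite lerD// (le_trans (norm_le_enorm _))// enormB ltW.
Qed.

(** Disjoint translates of A inside B. With v transversal to a thin slab, this bounds the volume of
    the slab by its thickness without straightening it. *)
Lemma lebesgue_packing A B (v : V) (N : nat) : measurable A -> measurable B ->
  (forall i j x, (i < N)%N -> (j < N)%N -> A (x - v *+ i) -> A (x - v *+ j) -> i = j) ->
  (forall i x, (i < N)%N -> A (x - v *+ i) -> B x) ->
  (N%:R%:E * mu A <= mu B)%E.
Proof.
move=> mA mB disj AB.
pose F i := shift (- (v *+ i)) @^-1` A.
have mF i : measurable (F i) by exact: measurable_shift_preimage.
have -> : (N%:R%:E * mu A = \sum_(i < N) mu (F i))%E.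
  rewrite (eq_bigr (fun => mu A)); last by move=> i _; exact: borel_lebesgue_shift.
  by rewrite sumr_const card_ord mule_natl.
rewrite -measure_bigsetU_ord//; last first.
  apply/trivIsetP => i j _ _ ij; apply/seteqP; split=> // x [/= Fi Fj].
  by move/negP: ij; apply; apply/eqP; apply: val_inj; apply: (disj i j x).
rewrite le_measure ?inE//; first by apply: bigsetU_measurable.
by rewrite -bigcup_mkord => x [i /= iN]; exact: AB.
Qed.

(** More than the name suggests: the volume of the r-neighbourhood is O(r), as for a set of finite
    (n - 1)-dimensional Minkowski content. The Lipschitz hypothesis on Omega enters the energy
    estimates in this form. *)
Definition minkowski_null A := exists C r0 : R, [/\ 0 <= C, 0 < r0 &
  forall r, 0 < r <= r0 -> (mu (tubular_nbhd r A) <= (C * r)%:E)%E].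

Lemma minkowski_nullU A B :
  minkowski_null A -> minkowski_null B -> minkowski_null (A `|` B).
Proof.
move=> [C1 [r1 [C10 r10 h1]]] [C2 [r2 [C20 r20 h2]]].
exists (C1 + C2), (Num.min r1 r2); split; [exact: addr_ge0|by rewrite lt_min r10|].
move=> r /andP[r0]; rewrite le_min => /andP[rr1 rr2].
have -> : tubular_nbhd r (A `|` B) = tubular_nbhd r A `|` tubular_nbhd r B.
  apply/seteqP; split => x.
    move=> /tubular_nbhdP[y [Ay|By] xy]; [left|right]; by apply/tubular_nbhdP; exists y.
  move=> [|] /tubular_nbhdP[y Ay xy]; apply/tubular_nbhdP; exists y => //; by [left|right].
apply: (le_trans (@measureU2 _ _ _ mu _ _ (measurable_tubular_nbhd _ _) (measurable_tubular_nbhd _ _))).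
by rewrite mulrDl EFinD leeD// ?h1 ?h2 ?r0.
Qed.

Lemma minkowski_nullS A B : A `<=` B -> minkowski_null B -> minkowski_null A.
Proof.
move=> AB [C [r0 [C0 r00 h]]]; exists C, r0; split => // r rr.
apply: le_trans (h r rr); rewrite le_measure ?inE//; try exact: measurable_tubular_nbhd.
by move=> x /tubular_nbhdP[y Ay xy]; apply/tubular_nbhdP; exists y => //; exact: AB.
Qed.

Lemma minkowski_null0 : minkowski_null set0.
Proof.
exists 0, 1; split => // r _; rewrite mul0r (_ : tubular_nbhd _ _ = set0) ?measure0//.
by rewrite -subset0 => x /tubular_nbhdP[].
Qed.

Lemma enorm_sub_dot nu x : enorm nu = 1 -> enorm (x - dot x nu *: nu) <= 2 * enorm x.
Proof.
move=> nu1; apply: le_trans (ler_enormD _ _) _.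
rewrite enormN enormZ nu1 mulr1 mulrDl !mul1r lerD2l ler_norml.
have h y : dot y nu <= enorm y by have := dot_le_enorm y nu; rewrite nu1 mulr1.
by rewrite h andbT lerNl -dotNl -(enormN x) h.
Qed.

(** The height h above the graph is Lipschitz and vanishes on the boundary, so that the
    r-neighbourhood lies in the slab |h| < K r. As h increases by exactly tau under a translation by
    tau nu, the translates of the slab by multiples of 2 K r nu are disjoint, and about rho / (2 K
    r) of them fit in a ball of radius 3 rho. *)
Lemma lipschitz_chart_minkowski_null Omega p : lipschitz_boundary Omega -> open Omega ->
  topo_boundary Omega p ->
  exists2 rho, 0 < rho & minkowski_null (topo_boundary Omega `&` eball p rho).
Proof.
move=> lO oO pO; have [rho [nu [g [rho0 nu1 [L gL] chart]]]] := lO p pO.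
have L' x y : `|g x - g y| <= `|L| * enorm (x - y).
  by apply: le_trans (gL x y) _; rewrite ler_wpM2r ?enorm_ge0// ler_norm.
pose h x := dot x nu - g (x - dot x nu *: nu).
(* The 1 comes from the coordinate along nu, the 2 from the crude bound of the projection orthogonal
   to nu by twice the norm. *)
pose K := 1 + 2 * `|L|.
have K0 : 0 < K by rewrite ltr_wpDr// mulr_ge0.
have hK x y : `|h x - h y| <= K * enorm (x - y).
  have -> : h x - h y = dot (x - y) nu -
      (g (x - dot x nu *: nu) - g (y - dot y nu *: nu)).
    by rewrite /h dotDl dotNl; ring.
  apply: le_trans (ler_normB _ _) _; rewrite mulrDl mul1r lerD//.
    have hh z : dot z nu <= enorm z by have := dot_le_enorm z nu; rewrite nu1 mulr1.
    by rewrite ler_norml hh andbT lerNl -dotNl -(enormN (x - y)) hh.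
  apply: le_trans (L' _ _) _; rewrite [leRHS](_ : _ = `|L| * (2 * enorm (x - y))); last by ring.
  rewrite ler_wpM2l//.
  rewrite (_ : _ - _ = (x - y) - dot (x - y) nu *: nu).
    exact: enorm_sub_dot.
  by rewrite dotDl dotNl scalerDl scaleNr !opprD !opprK addrACA.
have nunu : dot nu nu = 1 by rewrite -sqr_enorm nu1 expr1n.
have hshift x t : h (x + t *: nu) = h x + t.
  rewrite /h dotDl dotZl nunu mulr1.
  rewrite (_ : x + t *: nu - _ = x - dot x nu *: nu); first by ring.
  by rewrite scalerDl opprD addrACA subrr addr0.
have hc : continuous h.
  apply/continuous_enormP => x e e0; exists (e / K); first exact: divr_gt0.
  move=> y yx; apply: le_lt_trans (hK x y) _.
  by rewrite mulrC -ltr_pdivlMr// enormB.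
(* In the chart h > 0 on Omega and h <= 0 outside; continuity excludes h < 0 at a limit of points of
   Omega. *)
have h0 y : topo_boundary Omega y -> eball p rho y -> h y = 0.
  move=> yO yp; have [cy nOy] := (topo_boundary_open y oO).1 yO.
  have hy : h y <= 0.
    by rewrite leNgt; apply/negP => hy; apply: nOy; apply/(chart y yp); rewrite -subr_gt0.
  apply/eqP; rewrite eq_le hy/= leNgt; apply/negP => hy0.
  have hy0' : 0 < - h y by rewrite oppr_gt0.
  have [r r0 hr] := proj1 (continuous_enormP h) hc y _ hy0'.
  have /nbhs_eballP[r' r'0 hr'] : nbhs y (eball p rho).
    by apply: open_nbhs_nbhs; split => //; exact: open_eball.
  have m0 : 0 < Num.min r r' by rewrite lt_min r0.
  have [z Oz zy] := (closure_enormP _ _).1 cy _ m0.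
  have := hr z; rewrite (lt_le_trans zy) ?ge_min ?lexx// => /(_ isT).
  have pz : eball p rho z.
    by apply: hr'; rewrite /eball/= (lt_le_trans zy)// ge_min lexx orbT.
  have hz : 0 < h z by rewrite subr_gt0; exact/(chart z pz).
  by rewrite ltr_norml => /andP[+ _]; rewrite opprK; lra.
pose M := fine (mu (eball p (3 * rho))).
have ME : mu (eball p (3 * rho)) = M%:E.
  rewrite fineK// ge0_fin_numE//; apply: bounded_lebesgue_lty.
    exact: measurable_eball.
  exact: bounded_eball.
have M0 : 0 <= M by rewrite -lee_fin -ME.
exists rho => //.
exists (M * (4 * K / rho)), (rho / (2 * K)); split.
- by rewrite mulr_ge0// divr_ge0 ?ltW// mulr_gt0.
- by rewrite divr_gt0// mulr_gt0.
move=> r /andP[r0 rr].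
have Kr : 0 < 2 * K * r by rewrite !mulr_gt0.
pose S := eball p (2 * rho) `&` [set x | `|h x| < K * r].
have mS : measurable S.
  apply: measurableI; first exact: measurable_eball.
  apply: open_measurable_rV.
  rewrite (_ : mkset _ = h @^-1` ball 0 (K * r)); last first.
    by apply/seteqP; split => x /=; rewrite /ball/= sub0r normrN.
  by apply: open_comp => [x _|]; [exact: hc|exact: ball_open].
have K1 : 1 <= K by rewrite lerDl mulr_ge0.
have rrho : r <= rho.
  apply: (le_trans rr); rewrite ler_pdivrMr ?mulr_gt0//.
  by rewrite ler_peMr// ?ltW//; lra.
have NS : tubular_nbhd r (topo_boundary Omega `&` eball p rho) `<=` S.
  move=> x /tubular_nbhdP[y [yO yp] xy]; split.
    rewrite /eball/=; apply: le_lt_trans (ler_enorm_triangle y _ _) _.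
    rewrite mulrDl mul1r; apply: ltrD; last exact: yp.
    exact: lt_le_trans xy rrho.
  rewrite /= -[h x]subr0 -(h0 y yO yp); apply: le_lt_trans (hK _ _) _.
  by rewrite ltr_pM2l.
apply: (@le_trans _ _ (mu S)).
  by rewrite le_measure ?inE//; exact: measurable_tubular_nbhd.
(* N >= 1 because r <= rho / (2 K); then N + 1 <= 2 N turns the volume bound M / N into 4 K M r /
   rho. *)
pose N := Num.truncn (rho / (2 * K * r)).
have rN : rho < N.+1%:R * (2 * K * r) by rewrite -ltr_pdivrMr//; exact: truncnS_gt.
have Nr : N%:R * (2 * K * r) <= rho.
  by rewrite -ler_pdivlMr// truncn_le divr_ge0// ltW.
have N1 : (0 < N)%N.
  rewrite truncn_gt_nat ler_pdivlMr// mul1r.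
  by move: rr; rewrite ler_pdivlMr ?mulr_gt0// mulrC.
have NrR : N%:R > 0 :> R by rewrite ltr0n.
have hj x (j : nat) : h (x - ((2 * K * r) *: nu) *+ j) = h x - j%:R * (2 * K * r).
  by rewrite -scaler_nat scalerA -scaleNr hshift.
have pack : (N%:R%:E * mu S <= M%:E)%E.
  rewrite -ME; apply: (@lebesgue_packing _ _ ((2 * K * r) *: nu)) => //.
  - exact: measurable_eball.
  - move=> i j x iN jN [_ /=] + [_ /=]; rewrite !hj => hi hjj.
    have : `|(i%:R - j%:R) * (2 * K * r)| < 2 * K * r.
      rewrite (_ : _ * _ = (h x - j%:R * (2 * K * r)) - (h x - i%:R * (2 * K * r))); last by ring.
      apply: le_lt_trans (ler_normB _ _) _.
      by move: (ltrD hjj hi); rewrite (_ : K * r + K * r = 2 * K * r)//; ring.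
    rewrite normrM (gtr0_norm Kr) -ltr_pdivlMr// divff ?gt_eqF//.
    apply: contraTeq => ij; rewrite -leNgt.
    have [ltij|ltji|/eqP] := ltngtP i j; last by rewrite (negbTE ij).
    + by rewrite distrC -natrB ?(ltnW ltij)// normr_nat ler1n subn_gt0.
    + by rewrite -natrB ?(ltnW ltji)// normr_nat ler1n subn_gt0.
  - move=> i x iN [xp _]; rewrite /eball/=.
    have E : (2 * K * r) *: nu *+ i = (i%:R * (2 * K * r)) *: nu.
      by rewrite -(scaler_nat i) scalerA.
    rewrite E in xp.
    apply: le_lt_trans (ler_enorm_triangle (x - (i%:R * (2 * K * r)) *: nu) _ _) _.
    rewrite subKr enormZ nu1 mulr1.
    rewrite (_ : 3 * rho = 2 * rho + rho); last by ring.
    rewrite [ltLHS]addrC; apply: ltr_leD; first exact: xp.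
    rewrite ger0_norm; last by rewrite mulr_ge0// ltW.
    by apply: le_trans Nr; rewrite ler_pM2r// ler_nat ltnW.
have Sfin : mu S \is a fin_num.
  rewrite ge0_fin_numE//; apply: (@le_lt_trans _ _ (mu (eball p (2 * rho)))).
    rewrite le_measure ?inE//; first exact: measurable_eball.
    exact: subIsetl.
  apply: bounded_lebesgue_lty; [exact: measurable_eball|exact: bounded_eball].
move: pack; rewrite -(fineK Sfin) -EFinM !lee_fin => pack.
have -> : M * (4 * K / rho) * r = M * (4 * K * r / rho) by ring.
apply: (@le_trans _ _ (M * N%:R^-1)).
  by rewrite ler_pdivlMr// mulrC.
rewrite ler_wpM2l// ler_pdivlMr// mulrC ler_pdivrMr//.
apply: ltW; apply: (lt_le_trans rN).
rewrite (_ : 4 * K * r * N%:R = 2 * N%:R * (2 * K * r)); last by ring.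
by rewrite ler_wpM2r ?(ltW Kr)// -natrM ler_nat mul2n -addnn -addn1 leq_add2l.
Qed.

(** The boundary is compact, so finitely many charts suffice, and the linear bounds add up. *)
Lemma lipschitz_boundary_minkowski_null Omega : open Omega -> bounded_set Omega ->
  lipschitz_boundary Omega -> minkowski_null (topo_boundary Omega).
Proof.
move=> oO bO lO.
have cO : compact (topo_boundary Omega).
  apply: bounded_closed_compact.
    have [M [Mr h]] := bounded_closure bO; exists M; split => // x Mx y.
    by move=> /(topo_boundary_open _ oO)[cy _]; exact: h.
  rewrite (_ : topo_boundary Omega = closure Omega `&` ~` Omega).
    apply: closedI; first exact: closed_closure.
    exact: open_closedC.
  by apply/seteqP; split => x; [move/(topo_boundary_open _ oO)|move=> ?; apply/(topo_boundary_open _ oO)].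
have ex (p : V) : exists rho : R, 0 < rho /\ (topo_boundary Omega p ->
    minkowski_null (topo_boundary Omega `&` eball p rho)).
  have [pO|pO] := pselect (topo_boundary Omega p); last by exists 1.
  by have [rho rho0 h] := lipschitz_chart_minkowski_null lO oO pO; exists rho.
have [rho /all_and2[rho0 hrho]] := choice ex.
move: cO; rewrite compact_cover => /(_ V (topo_boundary Omega) (fun p => eball p (rho p))).
move=> h; have [||D DO cD] := h.
- by move=> p _; exact: open_eball.
- by move=> x Ox; exists x => //; exact: eball_center.
pose s := finmap.enum_fset D.
have sub : topo_boundary Omega `<=`
    \big[setU/set0]_(p <- s) (topo_boundary Omega `&` eball p (rho p)).
  by move=> x Ox; have [p pD px] := cD x Ox; rewrite -bigcup_seq; exists p.
apply: (minkowski_nullS sub).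
rewrite big_seq; elim/big_ind: _ => [||p pD]; first exact: minkowski_null0.
  exact: minkowski_nullU.
by apply: hrho; have := DO p pD; rewrite inE.
Qed.

End neighborhoods.

(** * Interaction with an outer layer *)

Section layer.
Context {R : realType} {n : nat}.
Notation V := 'rV[R]_n.
Local Notation mu := (@borel_lebesgue R n).
Local Notation mu2 := (mu \x mu)%E.
Implicit Types (s : R) (A B E Omega : set V).

(* The functional L_s of the paper, for Borel sets *)
Definition linteraction s A B : \bar R :=
  (\int[mu2]_p (\1_A p.1 * \1_B p.2 * kernd s p)%:E)%E.

Lemma measurable_linteraction s A B : measurable A -> measurable B ->
  measurable_fun setT (fun p : V * V => (\1_A p.1 * \1_B p.2 * kernd s p)%:E).
Proof.
move=> mA mB.
apply/measurable_EFinP; apply: measurable_funM; last exact: measurable_kernd.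
by apply: measurable_funM; apply: measurableT_comp => //; exact: measurable_indic.
Qed.

Lemma linteraction_integrand_ge0 s A B (p : V * V) :
  (0 <= (\1_A p.1 * \1_B p.2 * kernd s p)%:E :> \bar R)%E.
Proof. by rewrite lee_fin !mulr_ge0 ?kernd_ge0. Qed.

(** With z = y - x, integrating in x first leaves the kernel against the volume of the part of A
    that z sends into B. *)
Lemma linteractionE s A B : measurable A -> measurable B ->
  linteraction s A B =
  (\int[mu]_z ((kern s z)%:E * mu (A `&` shift z @^-1` B)))%E.
Proof.
move=> mA mB; rewrite /linteraction ge0_integral_pair_shear; last 2 first.
- exact: measurable_linteraction.
- by move=> p; exact: linteraction_integrand_ge0.
have msh : measurable_fun setT (fun p : V * V => (p.1, p.1 + p.2)).
  by apply/measurable_fun_pair => //; apply: measurable_addV.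
have mf := measurableT_comp (measurable_linteraction s mA mB) msh.
have f0 p : (0 <= ((fun p : V * V => (\1_A p.1 * \1_B p.2 * kernd s p)%:E) \o
    (fun p : V * V => (p.1, (p.1 + p.2)%R))) p)%E.
  exact: (linteraction_integrand_ge0 s A B).
rewrite [LHS](@fubini_tonelli2 _ _ _ _ _ mu mu _ mf f0).
apply: eq_integral => z _; rewrite /fubini_G/=.
have mAz : measurable (A `&` shift z @^-1` B).
  by apply: measurableI => //; exact: measurable_shift_preimage.
transitivity (\int[mu]_x ((kern s z)%:E * (\1_(A `&` shift z @^-1` B) x)%:E))%E.
  apply: eq_integral => x _; rewrite -EFinM /kernd/= [x + z]addrC addrK; congr (_%:E).
  by rewrite mulrC indicI/=; congr (_ * (_ * _)); rewrite !indicE /shift addrC.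
rewrite ge0_integralZl_EFin ?kern_ge0//.
  by rewrite integral_indic// setIT.
by apply/measurable_EFinP; exact: measurable_indic.
Qed.

Definition outer_layer (d : R) Omega : set V := tubular_nbhd d Omega `\` Omega.

Lemma measurable_outer_layer d Omega : measurable Omega ->
  measurable (outer_layer d Omega).
Proof. by move=> mO; apply: measurableD => //; exact: measurable_tubular_nbhd. Qed.

Lemma outer_layer_sub d Omega : open Omega ->
  outer_layer d Omega `<=` tubular_nbhd d (topo_boundary Omega).
Proof.
move=> oO x [/tubular_nbhdP[y Oy xy] nOx].
have [w wO [_ xw]] := segment_topo_boundary oO Oy nOx.
by apply/tubular_nbhdP; exists w => //; apply: le_lt_trans xw _; rewrite enormB.
Qed.

Lemma shift_setD_sub Omega (z : V) r : open Omega -> enorm z < r ->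
  Omega `&` shift z @^-1` (~` Omega) `<=` tubular_nbhd r (topo_boundary Omega).
Proof.
move=> oO zr x [Ox nOx].
have [w wO [xw _]] := segment_topo_boundary oO Ox nOx.
apply/tubular_nbhdP; exists w => //; apply: le_lt_trans xw _.
by rewrite /shift opprD addNKr enormN.
Qed.

Section finite.
Variables (Omega : set V) (oO : open Omega) (bO : bounded_set Omega).
Hypothesis (nO : minkowski_null (topo_boundary Omega)).
Variables (s : R) (n0 : (0 < n)%N) (hs : 0 < s < 1).
Let mO : measurable Omega := open_measurable_rV oO.

(** The segment from x in Omega to x + z outside crosses the boundary, whence a volume O(|z|) for
    small z; for the others the volume of Omega is enough. Integrability of this bound against the
    kernel amounts to the finiteness of the perimeter of Omega itself. *)
Lemma shift_setD_bound : exists2 C : R, 0 <= C & forall z : V,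
  (mu (Omega `&` shift z @^-1` (~` Omega)) <= (C * Num.min 1 (enorm z))%:E)%E.
Proof.
have [C [r0 [C0 r00 hC]]] := nO.
have Ofin : mu Omega \is a fin_num by rewrite ge0_fin_numE// bounded_lebesgue_lty.
pose M := fine (mu Omega).
have M0 : 0 <= M by rewrite fine_ge0.
pose m := Num.min 1 (r0 / 2).
have m0 : 0 < m by rewrite lt_min ltr01 divr_gt0.
have mD z : measurable (Omega `&` shift z @^-1` (~` Omega)).
  by apply: measurableI => //; apply: measurable_shift_preimage; exact: measurableC.
(* 2 C comes from the neighbourhood of radius 2 |z|, whose radius must exceed |z| strictly, and M /
   m from the z with |z| >= m. *)
exists (2 * C + M / m); first by rewrite addr_ge0 ?mulr_ge0// invr_ge0 ltW.
move=> z; have [->|z0] := eqVneq z 0.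
  rewrite enorm0 (_ : _ `&` _ = set0) ?measure0//.
    by rewrite (min_idPr ler01) mulr0.
  by rewrite -subset0 => x [Ox]; rewrite /shift/= addr0.
have ez0 : 0 < enorm z by rewrite lt_neqAle eq_sym enorm_eq0 z0 enorm_ge0.
have [zm|zm] := ltP (enorm z) m.
  have zr : 0 < 2 * enorm z <= r0.
    rewrite mulr_gt0//= -ler_pdivlMl// mulrC; apply: ltW; apply: (lt_le_trans zm).
    by rewrite ge_min lexx orbT.
  apply: (@le_trans _ _ (mu (tubular_nbhd (2 * enorm z) (topo_boundary Omega)))).
    rewrite le_measure ?inE//; first exact: measurable_tubular_nbhd.
    by apply: shift_setD_sub => //; rewrite ltr_pMl// ltr1n.
  apply: (le_trans (hC _ zr)); rewrite lee_fin.
  have z1 : enorm z <= 1 by apply: ltW; apply: (lt_le_trans zm); rewrite ge_min lexx.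
  rewrite (min_idPr z1) mulrA [C * 2]mulrC ler_wpM2r ?enorm_ge0//.
  by rewrite lerDl divr_ge0// ltW.
apply: (@le_trans _ _ (mu Omega)); first by rewrite le_measure ?inE//; exact: subIsetl.
rewrite -(fineK Ofin) lee_fin -/M.
have mz : m <= Num.min 1 (enorm z) by rewrite le_min zm ge_min lexx.
apply: (@le_trans _ _ (M / m * Num.min 1 (enorm z))).
  by rewrite mulrAC ler_pdivlMr// ler_wpM2l.
by rewrite ler_wpM2r ?lerDr ?mulr_ge0// (le_trans (ltW m0)).
Qed.

Lemma kern_min_integrable (C : R) : 0 <= C ->
  (\int[mu]_z (C * (Num.min 1 (enorm z) * kern s z))%:E < +oo)%E.
Proof.
move=> C0; under eq_integral do rewrite EFinM.
rewrite ge0_integralZl_EFin//.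
- by apply: lte_mul_pinfty => //; exact: kern_integrable.
- by move=> z _; rewrite lee_fin mulr_ge0 ?kern_ge0// le_min ler01 enorm_ge0.
- apply/measurable_EFinP; apply: measurable_funM; last exact: measurable_kern.
  by apply: measurable_minr => //; exact: measurable_enorm.
Qed.

(* dominated convergence in z, with dominating function C min(1,|z|) K(z) *)
Lemma linteraction_outer_layer_cvg0 (e : R) : 0 < e ->
  exists2 d : R, 0 < d <= e & (linteraction s Omega (outer_layer d Omega) <= e%:E)%E.
Proof.
move=> e0; have [C C0 hC] := shift_setD_bound.
have [C' [r0 [C'0 r00 hC']]] := nO.
have min0 (z : V) : 0 <= Num.min 1 (enorm z) by rewrite le_min ler01 enorm_ge0.
have mmin : measurable_fun setT (fun z : V => Num.min 1 (enorm z)).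
  by apply: measurable_minr => //; exact: measurable_enorm.
(* Two bounds for the volume of the points of Omega that z sends into the layer of width 1 / (k +
   1): the one in |z| makes the family dominated, the volume of the layer makes it tend to 0. *)
pose f (k : nat) (z : V) : R := kern s z * Num.min (C * Num.min 1 (enorm z)) (C' * k.+1%:R^-1).
have f0 k z : 0 <= f k z.
  by rewrite mulr_ge0 ?kern_ge0// le_min !mulr_ge0// invr_ge0.
have mf k : measurable_fun setT (f k).
  apply: measurable_funM; first exact: measurable_kern.
  by apply: measurable_minr => //; apply: measurable_funM.
pose g (z : V) : R := C * (Num.min 1 (enorm z) * kern s z).
have mg : measurable_fun setT g.
  by apply: measurable_funM => //; apply: measurable_funM => //; exact: measurable_kern.
have g0 z : 0 <= g z by rewrite !mulr_ge0 ?kern_ge0.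
have intg : mu.-integrable setT (EFin \o g).
  apply/integrableP; split; first exact/measurable_EFinP.
  under eq_integral do rewrite /= ger0_norm ?g0//.
  exact: kern_min_integrable.
have cvf z : (EFin \o f ^~ z) k @[k --> \oo] --> 0%E.
  apply: cvg_EFin; first exact: nearW.
  apply: (@squeeze_cvgr _ _ _ _ (cst 0) (fun k => kern s z * (C' * k.+1%:R^-1))).
  - by apply: nearW => k; rewrite f0/= ler_wpM2l ?kern_ge0// ge_min lexx orbT.
  - exact: cvg_cst.
  have -> : 0 = kern s z * (C' * 0) :> R by rewrite !mulr0.
  apply: cvgMr; apply: cvgMr; exact: cvg_harmonic.
have domf k z : (`|(EFin \o f k) z| <= (EFin \o g) z)%E.
  rewrite /= lee_fin ger0_norm ?f0// /f /g mulrA mulrC ler_wpM2r ?kern_ge0//.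
  by rewrite ge_min lexx.
have [_ _ cvI] := @dominated_convergence _ _ _ mu _ measurableT (fun k => EFin \o f k)
  (cst 0%E) (EFin \o g) (fun k => proj2 (measurable_EFinP _ _) (mf k)) (measurable_cst _)
  (aeW _ (fun z _ => cvf z)) intg (aeW _ (fun z k _ => domf k z)).
rewrite integral0 in cvI.
have : \forall k \near \oo, (\int[mu]_z (f k z)%:E <= e%:E)%E.
  have /fine_cvgP[finI cvfine] := cvI.
  move/cvgrPdist_le : cvfine => /(_ e e0) cvfine.
  near=> k; rewrite -[leLHS]fineK; last by near: k.
  rewrite lee_fin; have : `|0 - fine (\int[mu]_z (f k z)%:E)%E| <= e by near: k.
  by rewrite sub0r normrN; exact: le_trans (ler_norm _).
move=> [k0 _ hk0].
pose k := maxn k0 (Num.truncn ((Num.min r0 e)^-1)).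
have m0 : 0 < Num.min r0 e by rewrite lt_min r00.
have kr : k.+1%:R^-1 <= Num.min r0 e.
  rewrite invf_ple ?posrE ?ltr0n//; apply/ltW; apply: (lt_le_trans (truncnS_gt _)).
  by rewrite ler_nat ltnS leq_maxr.
have k1 : 0 < k.+1%:R^-1 :> R by rewrite invr_gt0 ltr0n.
exists (k.+1%:R^-1); first by rewrite k1/= (le_trans kr)// ge_min lexx orbT.
have mL := measurable_outer_layer (k.+1%:R^-1) mO.
apply: (le_trans _ (hk0 k (leq_maxl _ _))); rewrite linteractionE//.
have mI z : measurable (Omega `&` shift z @^-1` outer_layer k.+1%:R^-1 Omega).
  by apply: measurableI => //; exact: measurable_shift_preimage.
have bnd z : (mu (Omega `&` shift z @^-1` outer_layer k.+1%:R^-1 Omega) <=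
    (Num.min (C * Num.min 1 (enorm z)) (C' * k.+1%:R^-1))%:E)%E.
  rewrite EFin_min le_min; apply/andP; split.
    apply: le_trans (hC z); rewrite le_measure ?inE//.
      by apply: measurableI => //; apply: measurable_shift_preimage; exact: measurableC.
    by apply: setIS => x [].
  apply: (@le_trans _ _ (mu (tubular_nbhd k.+1%:R^-1 (topo_boundary Omega)))).
    rewrite -(borel_lebesgue_shift z (measurable_tubular_nbhd _ _)).
    rewrite le_measure ?inE//.
      by apply: measurable_shift_preimage; exact: measurable_tubular_nbhd.
    by move=> x [_ hx]; exact: outer_layer_sub.
  by apply: hC'; rewrite k1 (le_trans kr)// ge_min lexx.
have fE z : ((f k z)%:E = (kern s z)%:E *
   (Num.min (C * Num.min 1 (enorm z)) (C' * k.+1%:R^-1))%:E)%E by [].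
apply: ge0_le_integralT.
- by move=> z; rewrite mule_ge0// lee_fin kern_ge0.
- have -> : (fun z => (kern s z)%:E * mu (Omega `&` shift z @^-1` outer_layer k.+1%:R^-1 Omega))%E =
     fubini_G mu (fun p : V * V => (\1_Omega p.1 * \1_(outer_layer k.+1%:R^-1 Omega) (p.1 + p.2) * kern s p.2)%:E).
    apply/funext => z; rewrite /fubini_G/=.
    transitivity (\int[mu]_x ((kern s z)%:E * (\1_(Omega `&` shift z @^-1` outer_layer k.+1%:R^-1 Omega) x)%:E))%E.
      rewrite ge0_integralZl_EFin ?kern_ge0//.
        by rewrite integral_indic// setIT.
      by apply/measurable_EFinP; exact: measurable_indic.
    by apply: eq_integral => x _; rewrite -EFinM mulrC indicI.
  apply: measurable_fun_fubini_tonelli_G.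
    apply/measurable_EFinP; apply: measurable_funM; last first.
      by apply: measurableT_comp => //; exact: measurable_kern.
    apply: measurable_funM.
      by apply: measurableT_comp => //; exact: measurable_indic.
    apply: measurableT_comp; first exact: measurable_indic.
    by apply: measurable_addV.
  by move=> p; rewrite lee_fin !mulr_ge0 ?kern_ge0.
- exact/measurable_EFinP.
- by move=> z; rewrite fE lee_wpmul2l// lee_fin kern_ge0.
Unshelve. all: by end_near. Qed.

End finite.
End layer.

(** * Mollification *)

Section translation_continuity.
Context {R : realType} {n : nat}.
Notation V := 'rV[R]_n.
Local Notation mu := (@borel_lebesgue R n).
Implicit Types (A B : set V) (z : V).

(** Restricted to cubes since A may have infinite measure. It is stated as a property of A because
    the sets having it form a sigma-algebra; this one contains the coordinate half-spaces, hence all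
    Borel sets. *)
Definition translation_continuous A := measurable A /\ forall rho e : R, 0 < rho -> 0 < e ->
  exists2 r : R, 0 < r & forall z, enorm z < r ->
    (mu ((A `+` shift z @^-1` A) `&` cube n rho) <= e%:E)%E.

Let msub A B : measurable A -> measurable B -> A `<=` B -> (mu A <= mu B)%E.
Proof. by move=> mA mB AB; rewrite le_measure ?inE. Qed.

Let mY A z rho : measurable A ->
  measurable ((A `+` shift z @^-1` A) `&` cube n rho).
Proof.
move=> mA; apply: measurableI; last exact: measurable_cube.
by apply: measurableU; apply: measurableD => //; exact: measurable_shift_preimage.
Qed.

Lemma translation_continuousC A : translation_continuous A -> translation_continuous (~` A).
Proof.
move=> [mA hA]; split; first exact: measurableC.
move=> rho e rho0 e0; have [r r0 h] := hA rho e rho0 e0; exists r => // z zr.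
apply: le_trans (h z zr); apply: msub; [by apply: mY; exact: measurableC|exact: mY|].
apply: setSI => x [[nA nnA]|[nA nnA]].
  by right; split => //; apply: contrapT.
by left; split => //; apply: contrapT.
Qed.

Lemma translation_continuousU A B : translation_continuous A ->
  translation_continuous B -> translation_continuous (A `|` B).
Proof.
move=> [mA hA] [mB hB]; split; first exact: measurableU.
move=> rho e rho0 e0.
have e20 : 0 < e / 2 by rewrite divr_gt0.
have [r1 r10 h1] := hA rho (e / 2) rho0 e20.
have [r2 r20 h2] := hB rho (e / 2) rho0 e20.
exists (Num.min r1 r2); first by rewrite lt_min r10.
move=> z; rewrite lt_min => /andP[z1 z2].
rewrite [e]splitr EFinD; apply: le_trans (leeD (h1 z z1) (h2 z z2)).
apply: le_trans (measureU2 _ (mY _ _ mA) (mY _ _ mB)).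
apply: msub; [by apply: mY; exact: measurableU|by apply: measurableU; exact: mY|].
rewrite -setIUl; apply: setSI => x [[[Ax|Bx] nAB]|[[Ax|Bx] nAB]].
- by left; left; split => // h; apply: nAB; left.
- by right; left; split => // h; apply: nAB; right.
- by left; right; split => // h; apply: nAB; left.
- by right; right; split => // h; apply: nAB; right.
Qed.

Lemma translation_continuous0 : translation_continuous set0.
Proof.
split => // rho e rho0 e0; exists 1 => // z _.
by rewrite preimage_set0 setYK set0I measure0 lee_fin ltW.
Qed.

Lemma translation_continuous_bigcup (F : (set V)^nat) :
  (forall k, translation_continuous (F k)) -> translation_continuous (\bigcup_k F k).
Proof.
move=> tF; have mF k : measurable (F k) := proj1 (tF k).
have mU : measurable (\bigcup_k F k) by exact: bigcupT_measurable.
split => // rho e rho0 e0.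
pose G k := \big[setU/set0]_(i < k) F i.
have tG k : translation_continuous (G k).
  rewrite /G; elim: k => [|k ih]; first by rewrite big_ord0; exact: translation_continuous0.
  by rewrite big_ord_recr; exact: translation_continuousU.
have mG k := proj1 (tG k).
(* What the finite union misses, in a cube larger by 1 so that it also contains x + z for x in the
   original cube and |z| < 1. Three errors e / 3 result: one for the finite union, two for the
   missed part, at x and at x + z. *)
pose D k := (\bigcup_k F k `\` G k) `&` cube n (rho + 1).
have mD k : measurable (D k).
  by apply: measurableI; [exact: measurableD|exact: measurable_cube].
have cD : mu (D k) @[k --> \oo] --> 0%E.
  rewrite -(@measure0 _ _ _ mu) -(_ : \bigcap_k D k = set0); last first.
    rewrite -subset0 => x h; have [[[i _ Fi] _] _] := h 0%N I.
    have [[_ nG] _] := h i.+1 I; apply: nG; rewrite /G big_ord_recr/=; by right.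
  apply: nonincreasing_cvg_mu => //.
  - apply: (@le_lt_trans _ _ (mu (cube n (rho + 1)))).
      by apply: msub => //; [exact: measurable_cube|exact: subIsetr].
    by rewrite borel_lebesgue_cube ?ltry// addr_ge0// ltW.
  - exact: bigcapT_measurable.
  - move=> i j ij; apply/subsetPset; apply: setSI; apply: setDS.
    exact: subset_bigsetU.
have e30 : 0 < e / 3 by rewrite divr_gt0.
have [k Dk] : exists k, (mu (D k) <= (e / 3)%:E)%E.
  have /fine_cvgP[finD cvD] := cD.
  move/cvgrPdist_le : cvD => /(_ _ e30) cvD.
  have : \forall k \near \oo, (mu (D k) <= (e / 3)%:E)%E.
    near=> k; rewrite -[leLHS]fineK; last by near: k.
    rewrite lee_fin; have : `|0 - fine (mu (D k))| <= e / 3 by near: k.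
    by rewrite sub0r normrN; exact: le_trans (ler_norm _).
  by move=> [k _ hk]; exists k; apply: hk => /=.
have [r r0 hr] := proj2 (tG k) rho (e / 3) rho0 e30.
exists (Num.min r 1); first by rewrite lt_min r0 ltr01.
move=> z; rewrite lt_min => /andP[zr z1].
have mS := measurable_shift_preimage z (mD k).
have -> : e%:E = ((e / 3)%:E + (e / 3)%:E + (e / 3)%:E)%E.
  by rewrite -!EFinD; congr (_%:E); field.
apply: le_trans (leeD (leeD (hr z zr) Dk) Dk).
rewrite -[X in (_ + X)%E](borel_lebesgue_shift z (mD k)).
apply: le_trans (leeD (measureU2 _ (mY z rho (mG k)) (mD k)) (lexx _)).
apply: le_trans (measureU2 _ (measurableU _ _ (mY z rho (mG k)) (mD k)) mS).
apply: msub; [exact: mY|by apply: measurableU => //; apply: measurableU => //; exact: mY|].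
have GU : G k `<=` \bigcup_k F k.
  by rewrite /G -bigcup_mkord => x [i _ Fi]; exists i.
have c1 x : cube n rho x -> cube n (rho + 1) x.
  by move=> cx i; apply: (lt_trans (cx i)); rewrite ltrDl.
have c2 x : cube n rho x -> cube n (rho + 1) (shift z x).
  move=> cx i; rewrite /shift mxE; apply: le_lt_trans (ler_normD _ _) _.
  by apply: ltrD => //; exact: le_lt_trans (normr_coord_enorm _ _) z1.
move=> x [[[Ux nU]|[Ux nU]] cx].
- have [Gx|nGx] := pselect (G k x); last by left; right; split; [|exact: c1].
  by left; left; split => //; left; split => // Gx'; apply: nU; exact: GU.
- have [Gx|nGx] := pselect (G k (shift z x)); last by right; split; [|exact: c2].
  by left; left; split => //; right; split => // Gx'; apply: nU; exact: GU.
Unshelve. all: by end_near. Qed.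

(** For |z| < r the symmetric difference lies in the slab |x_i - t| <= r, and N disjoint translates
    of the slab, cut by the cube, fit in the cube enlarged by 1. *)
Lemma translation_continuous_halfspace (i : 'I_n) (t : R) :
  translation_continuous (Defs.coord i @^-1` `]t, +oo[%classic).
Proof.
have mA : measurable (Defs.coord i @^-1` (`]t, +oo[%classic : set (measurableTypeR R))).
  by rewrite -[X in measurable X]setTI; apply: measurable_coord.
split => // rho e rho0 e0.
have Mfin : mu (cube n (rho + 1)) \is a fin_num.
  by rewrite borel_lebesgue_cube// addr_ge0// ltW.
pose M := fine (mu (cube n (rho + 1))).
pose N := (Num.truncn (M / e)).+1.
have N0 : 0 < N%:R :> R by rewrite ltr0n.
have MN : M / N%:R <= e.
  rewrite ler_pdivrMr// mulrC -ler_pdivrMr//; apply: ltW; exact: truncnS_gt.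
(* The slab has width 2 r, so its translates by multiples of 3 r are disjoint, and N of them move
   points by less than 3 N r = 1. *)
pose r : R := (3 * N%:R)^-1.
have r0 : 0 < r by rewrite invr_gt0 mulr_gt0.
pose S := [set x : V | `|x ord0 i - t| <= r] `&` cube n rho.
have mS : measurable S.
  apply: measurableI; last exact: measurable_cube.
  rewrite (_ : mkset _ = Defs.coord i @^-1` (`[t - r, t + r]%classic : set (measurableTypeR R))).
    by rewrite -[X in measurable X]setTI; apply: measurable_coord.
  by apply/seteqP; split => x; rewrite /= in_itv/= ler_distl.
have id3 (a b c d u : R) : (a - b) * d = (c - b * d - u) - (c - a * d - u) by ring.
have cs (x : V) c (j : nat) k :
    (x - (c *: delta_mx ord0 i) *+ j) ord0 k = x ord0 k - j%:R * c * (k == i)%:R.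
  by rewrite -(scaler_nat j) scalerA !mxE.
have pack : (N%:R%:E * mu S <= mu (cube n (rho + 1)))%E.
  apply: (@lebesgue_packing _ _ _ _ ((3 * r) *: delta_mx ord0 i)) => //.
  - exact: measurable_cube.
  - move=> j k x jN kN [/= + _] [/= + _].
    rewrite !cs eqxx !mulr1 => hj hk.
    have : `|(j%:R - k%:R) * (3 * r)| <= 2 * r.
      rewrite (id3 j%:R k%:R (x ord0 i) (3 * r) t).
      apply: le_trans (ler_normB _ _) _.
      by have -> : 2 * r = r + r; [rewrite mulrDl mul1r|exact: lerD].
    apply: contraTeq => jk; rewrite -ltNge normrM (@gtr0_norm _ (3 * r)) ?mulr_gt0//.
    have : 1 <= `|j%:R - k%:R| :> R.
      have [ltij|ltji|/eqP] := ltngtP j k; last by rewrite (negbTE jk).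
      + by rewrite distrC -natrB ?(ltnW ltij)// normr_nat ler1n subn_gt0.
      + by rewrite -natrB ?(ltnW ltji)// normr_nat ler1n subn_gt0.
    by move=> h1; apply: (@lt_le_trans _ _ (3 * r)); [rewrite ltr_pM2r// ltr_nat|rewrite ler_peMl// mulr_ge0// ltW].
  - move=> j x jN [_ cx] k.
    have := cx k; rewrite cs => h.
    rewrite -(subrK (j%:R * (3 * r) * (k == i)%:R) (x ord0 k)).
    apply: le_lt_trans (ler_normD _ _) _; apply: ltr_leD => //.
    rewrite normrM [X in _ * X]ger0_norm ?ler0n//.
    apply: (@le_trans _ _ `|j%:R * (3 * r)|).
      by rewrite ler_piMr// lern1 leq_b1.
    rewrite ger0_norm; last by rewrite !mulr_ge0// ltW.
    rewrite /r invfM mulVKf ?pnatr_eq0// ler_pdivrMr// mul1r ler_nat ltnW//.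
have Sfin : mu S \is a fin_num.
  rewrite ge0_fin_numE//; apply: (@le_lt_trans _ _ (mu (cube n rho))).
    by apply: msub => //; [exact: measurable_cube|exact: subIsetr].
  by rewrite borel_lebesgue_cube ?ltry// ltW.
exists r => // z zr; apply: (@le_trans _ _ (mu S)).
  apply: msub; [exact: mY|exact: mS|].
  apply: setSI => x /= h.
  have zi : `|z ord0 i| <= r by apply: ltW; exact: le_lt_trans (normr_coord_enorm _ _) zr.
  move: zi h; rewrite /setY /setD /Defs.coord/= !in_itv/= !andbT mxE => /ler_normlP[z1 z2].
  by case=> -[h1 /negP]; rewrite -leNgt => h2; apply/ler_normlP; split; lra.
move: pack; rewrite -(fineK Sfin) -(fineK Mfin) -EFinM !lee_fin -/M => pack.
by apply: le_trans MN; rewrite ler_pdivlMr// mulrC.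
Qed.

Lemma measurable_translation_continuous A : measurable A -> translation_continuous A.
Proof.
move=> mA.
suff : g_sigma_preimage (@Defs.coord R n) `<=` translation_continuous by apply.
have sa : sigma_algebra setT translation_continuous.
  split; first exact: translation_continuous0.
  - by move=> B tB; rewrite setTD; exact: translation_continuousC.
  - exact: translation_continuous_bigcup.
apply: smallest_sub => // B; rewrite -bigcup_seq/= => -[i _ [C mC <-]].
rewrite setTI.
suff : (measurable : set (set (measurableTypeR R))) `<=`
    [set C | translation_continuous (Defs.coord i @^-1` C)] by apply.
change (((@ocitv R).-sigma).-measurable `<=` [set C | translation_continuous (Defs.coord i @^-1` C)]).
rewrite RGenOInfty.measurableE; apply: smallest_sub.
  split => /=; first by rewrite preimage_set0; exact: translation_continuous0.
  - by move=> D tD /=; rewrite setTD preimage_setC; exact: translation_continuousC.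
  - by move=> D tD /=; rewrite preimage_bigcup; exact: translation_continuous_bigcup.
by move=> _ [t ->] /=; exact: translation_continuous_halfspace.
Qed.

End translation_continuity.

(** * Averages of translates of a set *)

Section mollification.
Context {R : realType} {n : nat}.
Notation V := 'rV[R]_n.
Local Notation mu := (@borel_lebesgue R n).
Local Notation mu2 := (mu \x mu)%E.
Implicit Types (s : R) (A B E Omega : set V) (z : V).

Section convolution.
Variables (eta : V -> R) (A : set V) (mA : measurable A).
Hypotheses (meta : measurable_fun setT eta) (eta0 : forall z, 0 <= eta z).
Hypothesis (eta1 : (\int[mu]_z (eta z)%:E = 1)%E).

(** The average of the indicators of the translates A - z with weight eta, that is, the convolution
    with the reflected kernel. *)
Definition convol (x : V) : R := fine (\int[mu]_z (eta z * \1_A (x + z))%:E)%E.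

Let mint : measurable_fun setT (fun p : V * V => (eta p.2 * \1_A (p.1 + p.2))%:E).
Proof.
apply/measurable_EFinP; apply: measurable_funM; first by apply: measurableT_comp.
by apply: measurableT_comp; [exact: measurable_indic|apply: measurable_addV].
Qed.

Let int0 (p : V * V) : (0 <= (eta p.2 * \1_A (p.1 + p.2))%:E :> \bar R)%E.
Proof. by rewrite lee_fin mulr_ge0. Qed.

Let mintx (x : V) : measurable_fun setT (fun z => (eta z * \1_A (x + z))%:E).
Proof.
exact: (measurableT_comp mint (measurable_pair1 x)).
Qed.

Lemma convolE (x : V) : (\int[mu]_z (eta z * \1_A (x + z))%:E = (convol x)%:E)%E.
Proof.
rewrite fineK// ge0_fin_numE; last by apply: integral_ge0 => z _; exact: (int0 (x, z)).
apply: (@le_lt_trans _ _ 1%E); last exact: ltry.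
rewrite -eta1; apply: ge0_le_integralT => //; first by move=> z; exact: (int0 (x, z)).
  exact/measurable_EFinP.
by move=> z; rewrite lee_fin ler_piMr// indicE lern1 leq_b1.
Qed.

Lemma convol_ge0 x : 0 <= convol x.
Proof.
by rewrite -lee_fin -convolE; apply: integral_ge0 => z _; exact: (int0 (x, z)).
Qed.

Lemma measurable_convol : measurable_fun setT convol.
Proof.
apply/measurable_EFinP.
rewrite (_ : EFin \o convol = fubini_F mu (fun p : V * V => (eta p.2 * \1_A (p.1 + p.2))%:E)).
  exact: measurable_fun_fubini_tonelli_F.
by apply/funext => x; rewrite /fubini_F /= convolE.
Qed.

(** An equality, because the sign of 1_A(x + z) - 1_A(x) is dictated by 1_A(x), whatever z: nothing
    cancels in the average. *)
Lemma convol_dist_indic (x : V) :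
  (`|convol x - \1_A x|)%:E = (\int[mu]_z (eta z * \1_(A `+` shift z @^-1` A) x)%:E)%E.
Proof.
have iC y : \1_(~` A) y = 1 - \1_A y :> R by rewrite !indicE in_setC; case: (y \in A); rewrite /= ?subrr ?subr0.
have iY z : \1_(A `+` shift z @^-1` A) x = if x \in A then 1 - \1_A (x + z) else \1_A (x + z) :> R.
  rewrite !indicE /setY in_setU !in_setD.
  rewrite (_ : (x \in shift z @^-1` A) = (x + z \in A)); last first.
    by apply/idP/idP; rewrite !inE.
  by case: (x \in A); case: (x + z \in A); rewrite /= ?subrr ?subr0.
have [xA|xA] := boolP (x \in A); last first.
  rewrite indicE (negbTE xA) subr0 ger0_norm ?convol_ge0// -convolE.
  by apply: eq_integral => z _; rewrite iY (negbTE xA).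
have E : (1%E = (convol x)%:E + \int[mu]_z (eta z * (1 - \1_A (x + z)))%:E)%E.
  rewrite -eta1 -convolE -ge0_integralTD//.
  - by apply: eq_integral => z _; rewrite -EFinD; congr (_%:E); ring.
  - by move=> z; exact: (int0 (x, z)).
  - by move=> z; rewrite lee_fin mulr_ge0// subr_ge0 indicE lern1 leq_b1.
  - apply/measurable_EFinP; apply: measurable_funM => //; apply: measurable_funB => //.
    apply: measurableT_comp; [exact: measurable_indic|].
    by apply: measurable_addV.
have I0 : (0 <= \int[mu]_z (eta z * (1 - \1_A (x + z)))%:E)%E.
  by apply: integral_ge0 => z _; rewrite lee_fin mulr_ge0// subr_ge0 indicE lern1 leq_b1.
have If : (\int[mu]_z (eta z * (1 - \1_A (x + z)))%:E)%E \is a fin_num.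
  by move: E I0; case: (\int[mu]_z (eta z * (1 - \1_A (x + z)))%:E)%E => [r _ _|/esym|].
transitivity (\int[mu]_z (eta z * (1 - \1_A (x + z)))%:E)%E; last first.
  by apply: eq_integral => z _; rewrite iY xA.
move: E; rewrite -(fineK If) -EFinD => -[E].
set J := fine _ in E *.
have -> : convol x = 1 - J by rewrite E addrK.
by rewrite indicE xA distrC subKr ger0_norm// fine_ge0.
Qed.

Lemma convol_L1_bound (rho e : R) :
  (forall z, eta z != 0 ->
    (mu ((A `+` shift z @^-1` A) `&` cube n rho) <= e%:E)%E) ->
  (\int[mu]_x (\1_(cube n rho) x * `|convol x - \1_A x|)%:E <= e%:E)%E.
Proof.
move=> h.
have mS : measurable [set p : V * V | (A `+` shift p.2 @^-1` A) p.1].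
  have m1 : measurable [set p : V * V | A p.1] by exact: measurable_set_preimage.
  have m2 : measurable [set p : V * V | A (p.1 + p.2)].
    by apply: (measurable_set_preimage (f := fun p : V * V => p.1 + p.2)) => //; apply: measurable_addV.
  by apply: measurableU; apply: measurableD.
have mf : measurable_fun setT (fun p : V * V =>
    (\1_(cube n rho) p.1 * (eta p.2 * \1_[set p : V * V | (A `+` shift p.2 @^-1` A) p.1] p))%:E).
  apply/measurable_EFinP; apply: measurable_funM.
    by apply: measurableT_comp => //; apply: measurable_indic; exact: measurable_cube.
  by apply: measurable_funM; [apply: measurableT_comp|exact: measurable_indic].
have f0 (p : V * V) : (0 <= (\1_(cube n rho) p.1 *
    (eta p.2 * \1_[set p : V * V | (A `+` shift p.2 @^-1` A) p.1] p))%:E :> \bar R)%E.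
  by rewrite lee_fin !mulr_ge0.
have meq (x z : V) : \1_[set p : V * V | (A `+` shift p.2 @^-1` A) p.1] (x, z) =
    \1_(A `+` shift z @^-1` A) x :> R by [].
have mY z : measurable (A `+` shift z @^-1` A).
  by apply: measurableU; apply: measurableD => //; exact: measurable_shift_preimage.
have -> : (\int[mu]_x (\1_(cube n rho) x * `|convol x - \1_A x|)%:E =
    \int[mu]_x \int[mu]_z (\1_(cube n rho) x *
    (eta z * \1_[set p : V * V | (A `+` shift p.2 @^-1` A) p.1] (x, z)))%:E)%E.
  apply: eq_integral => x _; rewrite EFinM convol_dist_indic.
  under [in RHS]eq_integral do rewrite EFinM.
  rewrite ge0_integralZl_EFin//.
  - by move=> z _; rewrite lee_fin mulr_ge0.
  - apply/measurable_EFinP; apply: measurable_funM => //.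
    by apply: measurableT_comp; [exact: measurable_indic|exact: measurable_pair1].
rewrite (@fubini_tonelli _ _ _ _ _ mu mu _ mf f0) /=.
apply: (@le_trans _ _ (\int[mu]_z ((eta z)%:E * e%:E))%E); last first.
  rewrite ge0_integralZr//; last 3 first.
  - exact/measurable_EFinP.
  - by move=> z _; rewrite lee_fin.
  - have [z z0] : exists z, eta z != 0.
      apply: contrapT => /forallNP z0; move: eta1.
      rewrite integral0_eq => [/eqP|z _]; first by rewrite lt_eqF// lte01.
      by congr (_%:E); apply/eqP; move/negP: (z0 z); rewrite negbK.
    by apply: le_trans (h z z0).
  by rewrite eta1 mul1e.
apply: ge0_le_integralT.
- by move=> z; apply: integral_ge0 => x _; exact: (f0 (x, z)).
- exact: (measurable_fun_fubini_tonelli_G _ mf f0).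
- by apply/measurable_EFinP; apply: measurable_funM.
move=> z; rewrite (eq_integral (fun x => (eta z)%:E * (\1_((A `+` shift z @^-1` A) `&` cube n rho) x)%:E)%E); last first.
  move=> x _; rewrite -EFinM indicI /=; congr (_%:E).
  by rewrite -[\1_[set p | _] (x, z)]/(\1_(A `+` shift z @^-1` A) x : R); ring.
rewrite ge0_integralZl_EFin//; last first.
  by apply/measurable_EFinP; apply: measurable_indic; apply: measurableI => //; exact: measurable_cube.
rewrite integral_indic//; last by apply: measurableI => //; exact: measurable_cube.
rewrite setIT; have [->|z0] := eqVneq (eta z) 0; first by rewrite !mul0e.
by rewrite lee_wpmul2l// ?lee_fin//; exact: h.
Qed.

(* Jensen's inequality for the convex function max(0, a - b) *)
Lemma posdiff_convol (p : V * V) : ((posdiff convol p)%:E <=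
  \int[mu]_z (eta z * posdiff (\1_A : V -> R) (p.1 + z, p.2 + z)%R)%:E)%E.
Proof.
have mpd : measurable_fun setT (fun z => (eta z * posdiff (\1_A : V -> R) (p.1 + z, p.2 + z)%R)%:E).
  apply/measurable_EFinP; apply: measurable_funM => //.
  apply: measurableT_comp; first by apply: measurable_posdiff; exact: measurable_indic.
  by apply/measurable_fun_pair; apply: measurable_addV.
have I0 : (0 <= \int[mu]_z (eta z * posdiff (\1_A : V -> R) (p.1 + z, p.2 + z)%R)%:E)%E.
  by apply: integral_ge0 => z _; rewrite lee_fin mulr_ge0 ?posdiff_ge0.
rewrite /posdiff EFin_max ge_max I0/= EFinB leeBlDr//.
rewrite -!convolE -ge0_integralTD//.
- apply: ge0_le_integralT => //.
  + by move=> z; exact: (int0 (p.1, z)).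
  + by apply: emeasurable_funD.
  move=> z; rewrite -EFinD lee_fin -mulrDr ler_wpM2l// -lerBlDr /posdiff/=.
  by rewrite le_max lexx orbT.
- by move=> z; rewrite lee_fin mulr_ge0 ?posdiff_ge0.
- by move=> z; exact: (int0 (p.2, z)).
Qed.

(** Jensen's inequality integrated over the pairs: the energy of the average is at most the average
    of the energies of the translates, and only the z that eta weights matter. *)
Lemma gagliardo_convol s Omega (P : \bar R) : measurable Omega ->
  (forall z, eta z != 0 ->
    (gagliardo s Omega (\1_(shift z @^-1` A) : V -> R) <= P)%E) ->
  (gagliardo s Omega convol <= P)%E.
Proof.
move=> mO h.
pose f (q : (V * V) * V) : \bar R := (eta q.2 * posdiff (\1_A : V -> R) (q.1.1 + q.2, q.1.2 + q.2) *
   (\1_(touching Omega) q.1 * kernd s q.1))%:E.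
have mf : measurable_fun setT f.
  have m1 : measurable_fun setT (fun q : (V * V) * V => (q.1.1 + q.2, q.1.2 + q.2)).
    apply/measurable_fun_pair; apply: measurable_addV => //.
      exact: (measurableT_comp measurable_fst measurable_fst).
    exact: (measurableT_comp measurable_snd measurable_fst).
  apply/measurable_EFinP; apply: measurable_funM.
    apply: measurable_funM; first by apply: measurableT_comp.
    by apply: measurableT_comp => //; apply: measurable_posdiff; exact: measurable_indic.
  apply: measurable_funM.
    by apply: measurableT_comp => //; apply: measurable_indic; exact: measurable_touching.
  by apply: measurableT_comp => //; exact: measurable_kernd.
have f0 q : (0 <= f q)%E by rewrite lee_fin !mulr_ge0 ?posdiff_ge0 ?kernd_ge0.
have FT := @fubini_tonelli _ _ _ _ _ (@borel_lebesgue2 R n) mu f mf f0.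
apply: (@le_trans _ _ (\int[mu2]_p \int[mu]_z f (p, z))%E).
  apply: ge0_le_integralT.
  - by move=> p; exact: gagliardo_integrand_ge0.
  - by apply: measurable_gagliardo => //; exact: measurable_convol.
  - exact: (measurable_fun_fubini_tonelli_F _ mf f0).
  move=> p; rewrite EFinM /f/=.
  under eq_integral do rewrite EFinM.
  rewrite ge0_integralZr//.
  - apply: lee_wpmul2r; first by rewrite lee_fin mulr_ge0 ?kernd_ge0.
    exact: posdiff_convol.
  - apply/measurable_EFinP; apply: measurable_funM => //.
    apply: measurableT_comp; first by apply: measurable_posdiff; exact: measurable_indic.
    by apply/measurable_fun_pair; apply: measurable_addV.
  - by move=> z _; rewrite lee_fin mulr_ge0 ?posdiff_ge0.
  - by rewrite lee_fin mulr_ge0 ?kernd_ge0.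
rewrite [leLHS]FT.
apply: (@le_trans _ _ (\int[mu]_z ((eta z)%:E * P))%E); last first.
  rewrite ge0_integralZr//; last 3 first.
  - exact/measurable_EFinP.
  - by move=> z _; rewrite lee_fin.
  (* Such a z exists because the integral of eta is 1; it provides 0 <= P, needed to take the
     constant P out of the integral. *)
  - have [z z0] : exists z, eta z != 0.
      apply: contrapT => /forallNP z0; move: eta1.
      rewrite integral0_eq => [/eqP|z _]; first by rewrite lt_eqF// lte01.
      by congr (_%:E); apply/eqP; move/negP: (z0 z); rewrite negbK.
    apply: le_trans (h z z0); apply: integral_ge0 => p _; exact: gagliardo_integrand_ge0.
  by rewrite eta1 mul1e.
apply: ge0_le_integralT.
- by move=> z; apply: integral_ge0 => p _; exact: f0.
- exact: (measurable_fun_fubini_tonelli_G _ mf f0).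
- apply: emeasurable_funM => //; exact/measurable_EFinP.
move=> z; rewrite /f/=.
under eq_integral do rewrite -mulrA EFinM.
have mg := measurable_gagliardo s mO (measurable_indic (measurable_shift_preimage z mA)).
have E := ge0_integralTZl mu2 mg (gagliardo_integrand_ge0 s Omega _) (eta0 z).
apply: (@le_trans _ _ ((eta z)%:E * gagliardo s Omega (\1_(shift z @^-1` A) : V -> R))%E).
  by rewrite le_eqVlt; apply/orP; left; apply/eqP; exact: E.
have [->|z0] := eqVneq (eta z) 0; first by rewrite !mul0e.
rewrite lee_wpmul2l ?lee_fin//; exact: h.
Qed.

End convolution.
End mollification.

(** * Smooth functions *)

Section gradient.
Context {R : realType} {n : nat}.
Notation V := 'rV[R]_n.
Implicit Types (f g : V -> R) (x y h : V).

Definition pd (i : 'I_n) f : V -> R := fun x => 'D_(delta_mx ord0 i) f x.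

Lemma row_sum_coord x : x = \sum_i x ord0 i *: delta_mx ord0 i.
Proof. by rewrite [LHS]row_sum_delta. Qed.

Lemma diff_pd f x h : differentiable f x -> 'd f x h = \sum_i h ord0 i * pd i f x.
Proof.
move=> df; rewrite [in LHS](row_sum_coord h) linear_sum; apply: eq_bigr => i _.
by rewrite linearZ/= /pd deriveE.
Qed.

Lemma differentiable_remainder f x : differentiable f x -> forall e, 0 < e ->
  exists2 r, 0 < r & forall h, enorm h < r ->
    `|f (x + h) - f x - \sum_i h ord0 i * pd i f x| <= e * enorm h.
Proof.
move=> df e e0; have [_ /eqaddoP/(_ e e0)] := (diff_locallyP _ _).1 df.
move=> /nbhs_eballP[r r0 hr]; exists r => // h hr0.
have := hr h; rewrite /eball/= subr0 => /(_ hr0).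
rewrite /= !fctE /= diff_pd// opprD addrA [h + x]addrC => /le_trans; apply.
by rewrite ler_wpM2l ?(ltW e0)// norm_le_enorm.
Qed.

Definition lincomb (a : 'I_n -> R) (h : V) : R := \sum_i h ord0 i * a i.

Lemma lincomb_is_linear a : linear (lincomb a).
Proof.
move=> k u v; rewrite /lincomb scaler_sumr -big_split; apply: eq_bigr => i _.
by rewrite !mxE mulrDl /= /GRing.scale/= mulrA.
Qed.

HB.instance Definition _ a := GRing.isLinear.Build R V R _ (lincomb a) (lincomb_is_linear a).

Lemma lincomb_continuous a : continuous (lincomb a).
Proof.
move=> x; apply: differentiable_continuous.
rewrite (_ : lincomb a = \sum_i (fun h => h ord0 i * a i)); last first.
  by apply/funext => h; rewrite fct_sumE.
apply: differentiable_sum => i; apply: differentiableM => //.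
exact: differentiable_coord.
Qed.

Lemma lincomb_delta a i : lincomb a (delta_mx ord0 i) = a i.
Proof.
rewrite /lincomb (bigD1 i)//= mxE !eqxx mul1r big1 ?addr0// => j ji.
by rewrite mxE (negbTE ji) mul0r.
Qed.

Lemma remainder_differentiable f x (a : 'I_n -> R) :
  (forall e, 0 < e -> exists2 r, 0 < r & forall h, enorm h < r ->
    `|f (x + h) - f x - lincomb a h| <= e * enorm h) ->
  differentiable f x /\ forall i, pd i f x = a i.
Proof.
move=> hf.
have E : f \o pseudometric_normed_Zmodule.shift x = cst (f x) + (lincomb a : V -> R) +o_ (0 : V) id.
  apply/eqaddoP => e e0; have en0 : 0 < e / n.+1%:R by rewrite divr_gt0.
  have [r r0 hr] := hf _ en0.
  apply/nbhs_eballP; exists r => // h; rewrite /eball/= subr0 => /hr.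
  rewrite /= !fctE /= opprD addrA [h + x]addrC => /le_trans; apply.
  rewrite mulrAC ler_pdivrMr// -mulrA ler_wpM2l ?(ltW e0)//.
  apply: le_trans (enorm_le_norm _) _; rewrite mulrC ler_wpM2l// ler_nat.
  exact: leqnSn.
have D := @diff_unique _ _ _ f (lincomb a) x (@lincomb_continuous a) E.
have df : differentiable f x.
  apply/diff_locallyP; rewrite D; split => //; exact: lincomb_continuous.
split => // i; rewrite /pd deriveE// D; exact: lincomb_delta.
Qed.

Lemma line_mvt f x h : (forall x, differentiable f x) ->
  exists2 t : R, 0 < t < 1 & f (x + h) - f x = \sum_i h ord0 i * pd i f (x + t *: h).
Proof.
move=> df; pose phi (t : R) := f (x + t *: h).
have dg (t : R) : is_diff t (fun t : R => x + t *: h) ( *:%R^~ h).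
  by apply: is_diff_eq; rewrite add0r.
have dphi (t : R) : is_derive t 1 phi ('d f (x + t *: h) h).
  have dt : differentiable phi t.
    apply: (@differentiable_comp _ _ _ _ (fun t : R => x + t *: h) f) => //.
  apply: DeriveDef; first exact: diff_derivable.
  rewrite deriveE// (@diff_comp _ _ _ _ (fun t : R => x + t *: h) f)//=.
    by have [_ ->] := dg t; rewrite scale1r.
have [|t] := @MVT R phi (fun t => 'd f (x + t *: h) h) 0 1 ltr01 (fun t _ => dphi t).
  apply: continuous_subspaceT => t.
  by apply: differentiable_continuous; apply/derivable1_diffP; by have [] := dphi t.
rewrite in_itv/= => t01; rewrite /phi scale1r scale0r addr0 subr0 mulr1 => ->.
by exists t => //; rewrite diff_pd.
Qed.

End gradient.

Section smooth.
Context {R : realType} {n : nat}.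
Notation V := 'rV[R]_n.
Implicit Types (f g v : V -> R) (x y h : V).

(* Exhibiting a family of differentiable functions closed under partial
   derivatives avoids the Leibniz and chain rules at order k. *)
Definition smooth : set (V -> R) :=
  [set f | exists2 F : set (V -> R), F f &
    forall g, F g -> (forall x, differentiable g x) /\ forall i, F (pd i g)].

Lemma smooth_differentiable f x : smooth f -> differentiable f x.
Proof. by case=> F Ff /(_ _ Ff)[]. Qed.

Lemma smooth_pd i f : smooth f -> smooth (pd i f).
Proof. by case=> F Ff hF; exists F => //; have [] := hF _ Ff. Qed.

Lemma smooth_continuous f : smooth f -> continuous f.
Proof. by move=> sf x; exact/differentiable_continuous/smooth_differentiable. Qed.

Lemma smooth_smooth_fun f : smooth f -> smooth_fun f.
Proof.
move=> sf k; elim: k f sf => [|k ih] f sf /=; first exact: smooth_continuous.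
move=> i; split; last exact/ih/smooth_pd.
by move=> x; exact/diff_derivable/smooth_differentiable.
Qed.

Inductive generated (G : set (V -> R)) : set (V -> R) :=
| generated_gen g of G g : generated G g
| generated_cst c : generated G (fun=> c)
| generated_add f g of generated G f & generated G g : generated G (fun x => f x + g x)
| generated_mul f g of generated G f & generated G g : generated G (fun x => f x * g x).

Lemma pd_cst i c : pd i (fun _ : V => c) = (fun=> 0).
Proof. by apply/funext => x; rewrite /pd (derive_cst c). Qed.

Lemma pd_add i f g x : differentiable f x -> differentiable g x ->
  pd i (fun x => f x + g x) x = pd i f x + pd i g x.
Proof. by move=> df dg; apply: deriveD; exact: diff_derivable. Qed.

Lemma pd_mul i f g x : differentiable f x -> differentiable g x ->
  pd i (fun x => f x * g x) x = f x * pd i g x + g x * pd i f x.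
Proof. by move=> df dg; apply: deriveM; exact: diff_derivable. Qed.

(* A set of differentiable functions whose partial derivatives lie in the
   algebra it generates consists of smooth functions. *)
Lemma smooth_generated (G : set (V -> R)) f :
  (forall g, G g -> (forall x, differentiable g x) /\ forall i, generated G (pd i g)) ->
  generated G f -> smooth f.
Proof.
move=> hG Gf; exists (generated G) => // {Gf} {}f.
elim=> {f} [g /hG//|c|f g Gf [df pf] Gg [dg pg]|f g Gf [df pf] Gg [dg pg]].
- split=> [x|i]; first exact: differentiable_cst.
  by rewrite pd_cst; exact: generated_cst.
- split=> [x|i]; first exact: differentiableD.
  rewrite (_ : pd _ _ = (fun x => pd i f x + pd i g x)); first exact: generated_add.
  by apply/funext => x; exact: pd_add.
- split=> [x|i]; first exact: differentiableM.
  rewrite (_ : pd _ _ = (fun x => f x * pd i g x + g x * pd i f x)).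
    by apply: generated_add; exact: generated_mul.
  by apply/funext => x; exact: pd_mul.
Qed.

Lemma smooth_generatedS f : generated smooth f -> smooth f.
Proof.
apply: smooth_generated => g sg; split=> [x|i]; first exact: smooth_differentiable.
exact/generated_gen/smooth_pd.
Qed.

Lemma smooth_cst c : smooth (fun=> c).
Proof. exact/smooth_generatedS/generated_cst. Qed.

Lemma smooth_add f g : smooth f -> smooth g -> smooth (fun x => f x + g x).
Proof.
by move=> sf sg; apply/smooth_generatedS/generated_add; exact: generated_gen.
Qed.

Lemma smooth_mul f g : smooth f -> smooth g -> smooth (fun x => f x * g x).
Proof.
by move=> sf sg; apply/smooth_generatedS/generated_mul; exact: generated_gen.
Qed.

Lemma smooth_scale c f : smooth f -> smooth (fun x => c * f x).
Proof. by move=> sf; exact: (smooth_mul (smooth_cst c) sf). Qed.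

Lemma smooth_opp f : smooth f -> smooth (fun x => - f x).
Proof.
by move=> /(smooth_scale (-1)); under eq_fun do rewrite mulN1r.
Qed.

Lemma smooth_sub f g : smooth f -> smooth g -> smooth (fun x => f x - g x).
Proof. by move=> sf /smooth_opp; exact: smooth_add. Qed.

Lemma smooth_sum I (r : seq I) (F : I -> V -> R) :
  (forall i, smooth (F i)) -> smooth (fun x => \sum_(i <- r) F i x).
Proof.
move=> sF; elim: r => [|i r ih].
  by under eq_fun do rewrite big_nil; exact: smooth_cst.
by under eq_fun do rewrite big_cons; exact: smooth_add.
Qed.

Lemma smooth_primitive f : (forall x, differentiable f x) ->
  (forall i, smooth (pd i f)) -> smooth f.
Proof.
move=> df sf; apply: (@smooth_generated (smooth `|` [set f])); last first.
  by apply: generated_gen; right.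
move=> g [sg|->]; split=> // i.
- by move: i => x; exact: smooth_differentiable.
- by apply: generated_gen; left; exact: smooth_pd.
- by apply: generated_gen; left.
Qed.

Lemma pd_coord i j x : pd j (fun x : V => x ord0 i) x = (i == j)%:R.
Proof.
have [|_ ->//] := @remainder_differentiable _ _ (fun x : V => x ord0 i) x (fun j => (i == j)%:R).
move=> e e0; exists 1 => // h _; rewrite /lincomb (bigD1 i)//= eqxx mulr1 big1 => [|k].
  by rewrite mxE addr0 (addrC (x _ _)) addrK subrr normr0 mulr_ge0 ?enorm_ge0// ltW.
by rewrite eq_sym => /negbTE ->; rewrite mulr0.
Qed.

Lemma smooth_coord i : smooth (fun x : V => x ord0 i).
Proof.
apply: smooth_primitive => [x|j]; first exact: differentiable_coord.
rewrite (_ : pd _ _ = fun=> (i == j)%:R); first exact: smooth_cst.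
by apply/funext => x; exact: pd_coord.
Qed.

(** The derivative of 1 / v is a smooth function times the square of 1 / v: the algebra generated by
    the smooth functions and 1 / v is closed under partial derivatives. *)
Lemma smooth_inv v : (forall x, v x != 0) -> smooth v -> smooth (fun x => (v x)^-1).
Proof.
move=> v0 sv.
apply: (@smooth_generated (smooth `|` [set fun x => (v x)^-1])); last first.
  by apply: generated_gen; right.
move=> g [sg|->].
  split=> [x|i]; first exact: smooth_differentiable.
  by apply: generated_gen; left; exact: smooth_pd.
split=> [x|i]; first by apply: differentiableV => //; exact: smooth_differentiable.
rewrite (_ : pd _ _ = fun x => (-1 * pd i v x) * ((v x)^-1 * (v x)^-1)).
  apply: generated_mul; last by apply: generated_mul; apply: generated_gen; right.
  by apply: generated_gen; left; exact/smooth_scale/smooth_pd.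
apply/funext => x; rewrite {1}/pd deriveV//; last first.
  exact/diff_derivable/smooth_differentiable.
by rewrite /pd; set d := derive _ _ _; rewrite /GRing.scale/=; field; exact: v0.
Qed.

Lemma comp_differentiable (phi : R -> R) (v : V -> R) x d :
  is_derive (v x) 1 phi d -> differentiable v x ->
  differentiable (phi \o v) x /\ forall i, pd i (phi \o v) x = d * pd i v x.
Proof.
move=> [/derivable1_diffP dphi <-] dv; have dc := differentiable_comp dv dphi.
split=> // i; rewrite /pd !deriveE// diff_comp//=.
set a := 'd v x _; rewrite (_ : 'd phi _ a = 'd phi (v x) (a *: (1 : R))).
  by rewrite linearZ/= mulrC.
by rewrite /GRing.scale/= mulr1.
Qed.

Lemma smooth_atan v : smooth v -> smooth (fun x => atan (v x)).
Proof.
move=> sv; have dv x := smooth_differentiable x sv.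
have da x := comp_differentiable (is_derive1_atan (v x)) (dv x).
apply: smooth_primitive => [x|i]; first by have [] := da x.
rewrite (_ : pd _ _ = fun x => (1 + v x * v x)^-1 * pd i v x).
  apply: smooth_mul; last exact: smooth_pd.
  apply: smooth_inv => [x|]; first by rewrite gt_eqF// ltr_wpDr// -expr2 sqr_ge0.
  by apply: smooth_add; [exact: smooth_cst|exact: smooth_mul].
apply/funext => x; have [_ /(_ i)] := da x.
by rewrite -expr2.
Qed.

End smooth.

(** * Flat functions and a cutoff *)

Section bump.
Context {R : realType}.

(** The flat function exp(- 1 / t) with a power t^(- m) as index: the derivative of the m-th
    function is a combination of the next two, so that the family is closed under derivation. *)
Definition bump (m : nat) (t : R) : R :=
  if 0 < t then t^-1 ^+ m * expR (- t^-1) else 0.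

Lemma bump_le0 m t : t <= 0 -> bump m t = 0.
Proof. by rewrite /bump ltNge => ->. Qed.

Lemma bump_gt0 m t : 0 < t -> 0 < bump m t.
Proof. by move=> t0; rewrite /bump t0 mulr_gt0 ?expR_gt0// exprn_gt0 ?invr_gt0. Qed.

Lemma bump_ge0 m t : 0 <= bump m t.
Proof. by have [/bump_gt0/ltW//|/bump_le0->] := ltP 0 t. Qed.

(** exp(1 / t) is the N-th power of exp(1 / (N t)) >= 1 / (N t), with N = m + 2. The two powers of t
    in excess of m give the derivative 0 at the origin. *)
Lemma bump_le_sqr m t : bump m t <= (m.+2%:R ^+ m.+2) * t ^+ 2.
Proof.
rewrite /bump; case: ltP => [t0|_]; last by rewrite mulr_ge0 ?sqr_ge0// exprn_ge0.
set N := m.+2; have N0 : 0 < N%:R :> R by rewrite ltr0n.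
have e0 : (N%:R * t)^-1 ^+ N <= expR t^-1.
  have -> : expR t^-1 = expR ((N%:R * t)^-1) ^+ N.
    rewrite -expRM_natl; congr expR; field.
    by rewrite !gt_eqF.
  rewrite lerXn2r ?nnegrE ?expR_ge0 ?invr_ge0 ?mulr_ge0 ?(ltW t0)//.
  by apply: le_trans (expR_ge1Dx _); rewrite lerDr.
rewrite expRN -ler_pdivlMl ?exprn_gt0 ?invr_gt0//.
rewrite -[leLHS]invrK invrK -[leRHS]invrK lef_pV2 ?posrE ?expR_gt0//; last first.
  rewrite invr_gt0 mulr_gt0 ?invr_gt0 ?exprn_gt0 ?invr_gt0//.
  by rewrite mulr_gt0 ?exprn_gt0.
by apply: le_trans e0; rewrite !exprVn invrK exprMn mulrCA -exprD addn2.
Qed.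

Lemma is_derive_bump m (t : R) :
  is_derive t (1 : R) (bump m) (- m%:R * bump m.+1 t + bump m.+2 t).
Proof.
have [t0|t0|->] := ltgtP t 0.
  rewrite !bump_le0 ?(ltW t0)// mulr0 addr0.
  apply: (@near_eq_is_derive _ _ _ (cst 0)).
    by near=> x; rewrite bump_le0// ltW//; near: x; exact: lt_nbhsl.
  pose f x : R := x^-1 ^+ m * expR (- x^-1).
  have tn0 : t != 0 by rewrite gt_eqF.
  apply: (@near_eq_is_derive _ _ _ f).
    by near=> x; rewrite /bump ifT//; near: x; exact: lt_nbhsr.
  have dV : is_derive t (1 : R) (fun x : R => x^-1) (- t ^- 2).
    by have := @is_deriveV R id t 1 1 tn0 (is_derive_id _ _); rewrite /GRing.scale/= mulr1.
  have dX := is_deriveX m dV.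
  have dN := is_deriveN dV.
  have dE := @is_derive1_comp _ expR (- GRing.inv : R -> R) t _ _ (is_derive_expR (- t^-1)) dN.
  have := is_deriveM dX dE; set d1 := (X in is_derive _ _ _ X -> _).
  suff -> : d1 = - m%:R * bump m.+1 t + bump m.+2 t.
    by rewrite (_ : _ ^+ m * _ = f)//; apply/funext => x; rewrite !fctE.
  rewrite /d1 /bump t0 /GRing.scale/= !fctE/=.
  case: m {f dX d1} => [|m] /=; first by rewrite !exprS !expr0; field.
  by rewrite !exprS; field.
  rewrite !bump_le0// mulr0 addr0.
  have h : h^-1 *: (bump m (h *: 1 + 0) - bump m 0) @[h --> (0 : R)^'] --> (0 : R).
    apply/cvgrPdist_le => e e0; pose C : R := m.+2%:R ^+ m.+2.
    have C0 : 0 < C by rewrite exprn_gt0 ?ltr0n.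
    near=> x; rewrite sub0r normrN addr0 [x *: 1]mulr1 (@bump_le0 _ 0)// subr0.
    have x0 : x != 0 by near: x; exact: nbhs_dnbhs_neq.
    rewrite normrM normfV ler_pdivrMl ?normr_gt0//.
    rewrite ger0_norm ?bump_ge0//; apply: le_trans (bump_le_sqr _ _) _.
    rewrite -/C -real_normK ?num_real// expr2 mulrCA ler_wpM2l//.
    rewrite -ler_pdivlMl// mulrC; near: x; apply: dnbhs0_le; exact: divr_gt0.
  by apply: DeriveDef; [apply/cvg_ex; exists 0|exact/cvg_lim].
Unshelve. all: by end_near.
Qed.

Lemma smooth_bump {n} m (v : 'rV[R]_n -> R) : smooth v -> smooth (fun x => bump m (v x)).
Proof.
move=> sv.
apply: (@smooth_generated _ _ (smooth `|` [set (fun x => bump k (v x)) | k in setT])).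
  move=> g [sg|[k _ <-]].
    split=> [x|i]; first exact: smooth_differentiable.
    by apply: generated_gen; left; exact: smooth_pd.
  have db x := comp_differentiable (is_derive_bump k (v x)) (smooth_differentiable x sv).
  split=> [x|i]; first by have [] := db x.
  rewrite (_ : pd _ _ =
    fun x => ((fun=> - k%:R) x * bump k.+1 (v x) + bump k.+2 (v x)) * pd i v x).
    apply: generated_mul; last by apply: generated_gen; left; exact: smooth_pd.
    apply: generated_add; last by apply: generated_gen; right; exists k.+2.
    apply: generated_mul; first exact: (@generated_cst _ _ _ (- k%:R)).
    by apply: generated_gen; right; exists k.+1.
  by apply/funext => x; have [_] := db x; exact.
by apply: generated_gen; right; exists m.
Qed.

Lemma smooth_sqr_enorm {n} (p : 'rV[R]_n) : smooth (fun x => enorm (x - p) ^+ 2).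
Proof.
rewrite (_ : (fun x : 'rV[R]_n => _) = fun x : 'rV[R]_n => \sum_i (x ord0 i - p ord0 i) * (x ord0 i - p ord0 i)).
  apply: smooth_sum => i; apply: smooth_mul;
  by apply: smooth_sub; [exact: smooth_coord|exact: smooth_cst].
by apply/funext => x; rewrite sqr_enorm /dot; apply: eq_bigr => i _; rewrite !mxE.
Qed.

(** Equal to 1 on the unit ball and to 0 outside the ball of radius 2. The terms of the denominator
    are positive for |x| < 2 and for |x| > 1 respectively, so that it never vanishes. *)
Definition cutoff {n} (x : 'rV[R]_n) : R :=
  bump 0 (4 - enorm x ^+ 2) / (bump 0 (4 - enorm x ^+ 2) + bump 0 (enorm x ^+ 2 - 1)).

Lemma cutoff_den_gt0 {n} (x : 'rV[R]_n) :
  0 < bump 0 (4 - enorm x ^+ 2) + bump 0 (enorm x ^+ 2 - 1).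
Proof.
have [h|h] := ltP (enorm x ^+ 2) 2.
  by rewrite ltr_wpDr ?bump_ge0// bump_gt0//; lra.
by rewrite ltr_wpDl ?bump_ge0// bump_gt0//; lra.
Qed.

Lemma smooth_cutoff {n} : smooth (@cutoff n).
Proof.
have s0 : smooth (fun x : 'rV[R]_n => enorm x ^+ 2).
  by have := @smooth_sqr_enorm n 0; under eq_fun do rewrite subr0.
have s1 : smooth (fun x : 'rV[R]_n => bump 0 (4 - enorm x ^+ 2)).
  by apply: smooth_bump; apply: smooth_sub => //; exact: smooth_cst.
have s2 : smooth (fun x : 'rV[R]_n => bump 0 (enorm x ^+ 2 - 1)).
  by apply: smooth_bump; apply: smooth_sub => //; exact: smooth_cst.
apply: smooth_mul => //; apply: smooth_inv; last exact: smooth_add.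
by move=> x; rewrite gt_eqF// cutoff_den_gt0.
Qed.

Lemma cutoff1 {n} (x : 'rV[R]_n) : enorm x <= 1 -> cutoff x = 1.
Proof.
move=> x1; have xx : enorm x ^+ 2 <= 1 by rewrite expr_le1 ?enorm_ge0.
rewrite /cutoff (@bump_le0 _ (_ - 1)) ?subr_le0// addr0 divff// gt_eqF// bump_gt0//; lra.
Qed.

Lemma cutoff0 {n} (x : 'rV[R]_n) : 2 <= enorm x -> cutoff x = 0.
Proof.
move=> x2; rewrite /cutoff (@bump_le0 _ (4 - _)) ?mul0r// subr_le0.
by rewrite (_ : 4 = 2 ^+ 2) ?lerXn2r ?nnegrE ?enorm_ge0//; ring.
Qed.

Lemma cutoff_ge0 {n} (x : 'rV[R]_n) : 0 <= cutoff x.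
Proof. by rewrite divr_ge0 ?addr_ge0 ?bump_ge0. Qed.

Lemma cutoff_le1 {n} (x : 'rV[R]_n) : cutoff x <= 1.
Proof. by rewrite ler_pdivrMr ?cutoff_den_gt0// mul1r lerDl bump_ge0. Qed.

End bump.

(** * Differentiation under the integral sign *)

Section compact_support.
Context {R : realType} {n : nat}.
Notation V := 'rV[R]_n.
Notation mu := (@borel_lebesgue R n).
Implicit Types (f g v : V -> R) (x y h : V).

Lemma continuous_bounded_ball f r : continuous f ->
  exists2 C : R, 0 <= C & forall x, enorm x <= r -> `|f x| <= C.
Proof.
move=> cf; have cK : compact [set x : V | enorm x <= r].
  apply: bounded_closed_compact.
    have [M [Mr hM]] := bounded_eball (0 : V) (r + 1).
    exists M; split=> // k Mk x /= xr; apply: (hM k Mk).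
    by rewrite /eball/= subr0 (le_lt_trans xr)// ltrDl.
  apply: (@closed_comp _ _ (@enorm R n) [set t | t <= r]); last exact: closed_le.
  by move=> x _; exact: enorm_continuous.
have := compact_bounded (continuous_compact (continuous_subspaceT cf) cK).
case=> M [_ /(_ (`|M| + 1))] hM.
exists (`|M| + 1); first by rewrite addr_ge0.
move=> x xr; apply: hM; first by rewrite ltr_pwDr// ler_norm.
by exists x.
Qed.

Definition vanishes_outside (r : R) f := forall x, r <= enorm x -> f x = 0.

(** The radius is enlarged strictly so that f vanishes in a neighbourhood of each point
    concerned. *)
Lemma pd_vanishes_outside r r' i f : r < r' ->
  vanishes_outside r f -> vanishes_outside r' (pd i f).
Proof.
move=> rr' fr x xr; rewrite /pd (@near_eq_derive _ _ _ f (cst 0)) ?derive_cst//.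
have rx : r < enorm x by exact: lt_le_trans xr.
apply/nbhs_eballP; exists (enorm x - r); first by rewrite subr_gt0.
move=> y; rewrite /eball/= => yx; apply: fr.
have := ler_enormD (x - y) y; rewrite subrK enormB; lra.
Qed.

Lemma vanishes_outside_bounded r f : continuous f -> vanishes_outside r f ->
  exists2 C : R, 0 <= C & forall x, `|f x| <= C.
Proof.
move=> cf fr; have [C C0 hC] := continuous_bounded_ball r cf.
exists C => // x; have [/hC//|/ltW/fr ->] := leP (enorm x) r.
by rewrite normr0.
Qed.

Lemma pd_bounded_common r f : smooth f -> vanishes_outside r f ->
  exists2 C : R, 0 <= C & forall i x, `|pd i f x| <= C.
Proof.
move=> sf fr.
have hC i : {C : R | 0 <= C & forall x, `|pd i f x| <= C}.
  apply: cid2; apply: (@vanishes_outside_bounded (r + 1)).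
    exact/smooth_continuous/smooth_pd.
  by apply: pd_vanishes_outside fr; rewrite ltrDl.
exists (\sum_i s2val (hC i)); first by apply: sumr_ge0 => i _; case: (hC i).
move=> i x; rewrite (bigD1 i)//= ler_wpDr//; last by case: (hC i) => /=.
by apply: sumr_ge0 => j _; case: (hC j).
Qed.

Lemma lincomb_le (a : 'I_n -> R) h C : (forall i, `|a i| <= C) ->
  `|lincomb a h| <= n%:R * C * enorm h.
Proof.
move=> aC; apply: le_trans (ler_norm_sum _ _ _) _.
have -> : n%:R * C * enorm h = \sum_(i < n) C * enorm h.
  by rewrite sumr_const card_ord -mulrA -[RHS]mulr_natl.
apply: ler_sum => i _; rewrite normrM mulrC ler_pM// ?normr_coord_enorm//.
Qed.

Lemma pd_bounded_lipschitz f C x h : (forall x, differentiable f x) ->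
  (forall i x, `|pd i f x| <= C) -> `|f (x + h) - f x| <= n%:R * C * enorm h.
Proof.
by move=> df fC; have [t _ ->] := line_mvt x h df; exact: lincomb_le.
Qed.

(** The mean value theorem along the segment, then bounds on the second derivatives. The constant
    does not depend on x, so that the expansion can be integrated. *)
Lemma quadratic_remainder r f : smooth f -> vanishes_outside r f ->
  exists2 C : R, 0 <= C & forall x h,
    `|f (x + h) - f x - lincomb (fun i => pd i f x) h| <= C * enorm h ^+ 2.
Proof.
move=> sf fr.
have hC i : {C : R | 0 <= C & forall j x, `|pd j (pd i f) x| <= C}.
  apply: cid2; apply: (@pd_bounded_common (r + 1)); first exact: smooth_pd.
  by apply: pd_vanishes_outside fr; rewrite ltrDl.
pose C := \sum_i s2val (hC i).
have C0 : 0 <= C by apply: sumr_ge0 => i _; case: (hC i).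
have CC i j x : `|pd j (pd i f) x| <= C.
  rewrite /C (bigD1 i)//= ler_wpDr//; last by case: (hC i) => /=.
  by apply: sumr_ge0 => k _; case: (hC k).
exists (n%:R * (n%:R * C)) => [|x h]; first by rewrite !mulr_ge0.
have [t /andP[t0 t1] ->] := line_mvt x h (fun x => smooth_differentiable x sf).
have -> : \sum_i h ord0 i * pd i f (x + t *: h) - lincomb (fun i => pd i f x) h =
    lincomb (fun i => pd i f (x + t *: h) - pd i f x) h.
  by rewrite /lincomb -sumrB; apply: eq_bigr => i _; rewrite mulrBr.
rewrite (_ : n%:R * (n%:R * C) * enorm h ^+ 2 = n%:R * (n%:R * C * enorm h) * enorm h); last by ring.
apply: lincomb_le => i.
have di y := smooth_differentiable y (smooth_pd i sf).
apply: le_trans (pd_bounded_lipschitz _ _ di (CC i)) _.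
rewrite ler_wpM2l ?mulr_ge0// enormZ gtr0_norm// ler_piMl ?enorm_ge0// ltW//.
Qed.

Lemma bounded_Rintegral (A B : set V) f C : measurable A -> measurable B ->
  (mu B < +oo)%E -> measurable_fun setT f -> 0 <= C ->
  (forall y, `|f y| <= C) -> (forall y, ~ B y -> f y = 0) ->
  mu.-integrable A (EFin \o f) /\ `|\int[mu]_(y in A) f y| <= C * fine (mu B).
Proof.
move=> mA mB Bfin mf C0 fC fB.
have mfA : measurable_fun A f by apply: measurable_funS mf.
have bnd : (\int[mu]_(y in A) `|(f y)%:E| <= (C * fine (mu B))%:E)%E.
  apply: (@le_trans _ _ (\int[mu]_(y in A) (C%:E * (\1_B y)%:E))%E).
    apply: ge0_le_integral => //.
    by apply/measurable_EFinP; apply: measurableT_comp.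
    apply/measurable_EFinP; apply: measurable_funM => //.
    move=> y _; rewrite /= -EFinM lee_fin indicE; case: (boolP (y \in B)) => yB.
      by rewrite mulr1.
    by rewrite fB ?normr0 ?mulr0// => By; rewrite mem_set in yB.
  rewrite ge0_integralZl_EFin//; last by apply/measurable_EFinP; exact: measurable_indic.
  rewrite integral_indic//= EFinM fineK ?ge0_fin_numE//.
  rewrite lee_wpmul2l ?lee_fin//; apply: le_measure; rewrite ?inE//.
  exact: measurableI.
have fi : mu.-integrable A (EFin \o f).
  apply/integrableP; split; first exact/measurable_EFinP.
  by apply: le_lt_trans bnd _; exact: ltry.
split=> //; rewrite -lee_fin EFin_normr_Rintegral//.
by apply: le_trans bnd; apply: le_abse_integral => //; exact/measurable_EFinP.
Qed.

Lemma Rintegral_sum (A : set V) I (s : seq I) (F : I -> V -> R) : measurable A ->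
  (forall i, mu.-integrable A (EFin \o F i)) ->
  mu.-integrable A (EFin \o (fun y => \sum_(i <- s) F i y)) /\
  \int[mu]_(y in A) (\sum_(i <- s) F i y) = \sum_(i <- s) \int[mu]_(y in A) F i y.
Proof.
move=> mA Fi; elim: s => [|i s [ih1 ih2]].
  under eq_fun do rewrite big_nil; rewrite big_nil; split.
    exact: integrable0.
  by rewrite Rintegral_cst// mul0r.
under eq_fun do rewrite big_cons; rewrite big_cons; split.
  have -> : EFin \o (fun y => F i y + \sum_(j <- s) F j y) =
      (EFin \o F i) \+ (EFin \o (fun y => \sum_(j <- s) F j y)) by [].
  exact: integrableD.
by rewrite RintegralD// ih2.
Qed.

(** The mollification with x moved from the set into the kernel, where it can be differentiated;
    each derivative brings a minus sign. *)
Definition conv (A : set V) f x : R := \int[mu]_(y in A) f (y - x).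

Lemma measurable_shift_comp f x : continuous f -> measurable_fun setT (fun y => f (y - x)).
Proof.
move=> cf; apply: (measurableT_comp (continuous_measurable_rV cf)).
exact: (measurable_shift (- x)).
Qed.

Lemma conv_integrable (A : set V) f r x : measurable A -> continuous f ->
  vanishes_outside r f -> mu.-integrable A (EFin \o (fun y => f (y - x))).
Proof.
move=> mA cf fr; have [C C0 fC] := vanishes_outside_bounded cf fr.
have [] // := @bounded_Rintegral A (eball x r) (fun y => f (y - x)) C mA.
exact: measurable_eball.
by apply: bounded_lebesgue_lty; [exact: measurable_eball|exact: bounded_eball].
exact: measurable_shift_comp.
by move=> y yx; apply: fr; rewrite leNgt; exact/negP.
Qed.

(** The quadratic remainder is uniform and, for |h| < 1, vanishes outside the ball of radius r + 1
    about x, so that its integral is O(|h|^2). *)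
Lemma conv_pd (A : set V) f r x : measurable A -> smooth f -> vanishes_outside r f ->
  differentiable (conv A f) x /\ forall i, pd i (conv A f) x = - conv A (pd i f) x.
Proof.
move=> mA sf fr; apply: remainder_differentiable => e e0.
have [C C0 hC] := quadratic_remainder sf fr.
have cf := smooth_continuous sf.
have fr1 i : vanishes_outside (r + 1) (pd i f).
  by apply: pd_vanishes_outside fr; rewrite ltrDl.
have cp i := smooth_continuous (smooth_pd i sf).
pose B := eball x (r + 1).
have Bfin : (mu B < +oo)%E.
  by apply: bounded_lebesgue_lty; [exact: measurable_eball|exact: bounded_eball].
pose K := C * fine (mu B).
have K0 : 0 <= K by rewrite mulr_ge0 ?fine_ge0.
exists (Num.min 1 (e / (K + 1))).
  by rewrite lt_min ltr01/= divr_gt0// ltr_wpDl.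
move=> h; rewrite lt_min => /andP[h1 he].
pose F y := f (y - x + - h) - f (y - x) - lincomb (fun i => pd i f (y - x)) (- h).
have [Fi Fb] : mu.-integrable A (EFin \o F) /\
    `|\int[mu]_(y in A) F y| <= C * enorm h ^+ 2 * fine (mu B).
  apply: bounded_Rintegral => //.
  exact: measurable_eball.
  apply: measurable_funB; first apply: measurable_funB.
    under eq_fun do rewrite -addrA -opprD; exact: measurable_shift_comp.
    exact: measurable_shift_comp.
    apply: measurable_sum => i; apply: measurable_funM => //.
      exact: measurable_shift_comp.
  by rewrite mulr_ge0 ?sqr_ge0.
  by move=> y; have := hC (y - x) (- h); rewrite enormN.
  move=> y yB; have yr : r + 1 <= enorm (y - x) by rewrite leNgt; exact/negP.
  have yhr : r <= enorm (y - x + - h).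
    by have := ler_enormD (y - x - h) h; rewrite subrK; lra.
  rewrite /F !fr//; last by apply: le_trans yr; rewrite lerDl.
  rewrite /lincomb big1 ?subrr// => i _; rewrite fr1 ?mulr0//.
have E : \int[mu]_(y in A) F y =
    conv A f (x + h) - conv A f x - lincomb (fun i => - conv A (pd i f) x) h.
  have i1 : mu.-integrable A (EFin \o (fun y => f (y - x + - h))).
    have := @conv_integrable A f r (x + h) mA cf fr.
    by congr (integrable _ _ (_ \o _)); apply/funext => y; rewrite opprD addrA.
  have i2 := @conv_integrable A f r x mA cf fr.
  have i3 i : mu.-integrable A (EFin \o (fun y => (- h) ord0 i * pd i f (y - x))).
    rewrite (_ : _ \o _ = fun y => (((- h) ord0 i)%:E * (pd i f (y - x))%:E)%E)//.
    by apply: integrableZl => //; exact: conv_integrable (fr1 i).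
  have [i4 s4] := @Rintegral_sum A _ (index_enum 'I_n) _ mA i3.
  have i12 : mu.-integrable A (EFin \o (fun y => f (y - x + - h) - f (y - x))).
    exact: (integrableB mA i1 i2).
  rewrite /F RintegralB//.
  rewrite RintegralB// s4; congr (_ - _ - _).
    by rewrite /conv; apply: eq_Rintegral => y _; rewrite opprD addrA.
  apply: eq_bigr => i _; rewrite RintegralZl//; last exact: conv_integrable (fr1 i).
  by rewrite mxE mulNr mulrN.
rewrite -E; apply: le_trans Fb _.
rewrite mulrAC -/K expr2 mulrA ler_wpM2r ?enorm_ge0//.
move: he; rewrite ltr_pdivlMr ?ltr_wpDl// => /ltW; apply: le_trans.
by rewrite mulrC ler_wpM2l ?enorm_ge0// lerDl.
Qed.

Lemma smooth_conv (A : set V) f r : measurable A -> smooth f -> vanishes_outside r f ->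
  smooth (conv A f).
Proof.
move=> mA sf fr.
exists [set conv A g | g in [set g | smooth g /\ exists r, vanishes_outside r g]].
  by exists f => //; split=> //; exists r.
move=> _ [g [sg [r' gr] <-]]; split=> [x|i].
  by have [] := conv_pd x mA sg gr.
exists (fun x => - pd i g x).
  split; first exact/smooth_opp/smooth_pd.
  exists (r' + 1) => x xr; rewrite (@pd_vanishes_outside r' (r' + 1) i g _ gr) ?oppr0 ?ltrDl//.
apply/funext => x; have [_ ->] := conv_pd x mA sg gr.
have r1 : r' < r' + 1 by rewrite ltrDl.
have := conv_integrable x mA (smooth_continuous (smooth_pd i sg)) (pd_vanishes_outside i r1 gr).
move=> hi; rewrite /conv; under eq_Rintegral do rewrite -mulN1r.
by rewrite RintegralZl// mulN1r.
Qed.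

End compact_support.

(** * Smooth mollifiers *)

Section mollifier.
Context {R : realType} {n : nat}.
Notation V := 'rV[R]_n.
Notation mu := (@borel_lebesgue R n).

Lemma bump_le (t0 t : R) : t0 <= t -> bump 0 t0 <= bump 0 t.
Proof.
move=> tt; have [t00|/bump_le0->] := ltP 0 t0; last exact: bump_ge0.
rewrite /bump t00 (lt_le_trans t00 tt) !expr0 !mul1r ler_expR lerN2 lef_pV2//.
by rewrite posrE (lt_le_trans t00).
Qed.

Lemma exists_mollifier (e : R) : 0 < e -> exists eta : V -> R,
  [/\ smooth eta, vanishes_outside e eta, forall z, 0 <= eta z,
      forall z, enorm z < e -> 0 < eta z & (\int[mu]_z (eta z)%:E = 1)%E].
Proof.
move=> e0; pose f (z : V) : R := bump 0 (e ^+ 2 - enorm (z - 0) ^+ 2).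
have sf : smooth f.
  by apply: smooth_bump; apply: smooth_sub; [exact: smooth_cst|exact: smooth_sqr_enorm].
have f0 z : 0 <= f z by exact: bump_ge0.
have fv : vanishes_outside e f.
  move=> z ez; rewrite /f bump_le0// subr_le0 subr0 lerXn2r ?nnegrE ?enorm_ge0//.
  exact: ltW.
have fp z : enorm z < e -> 0 < f z.
  move=> ze; rewrite /f bump_gt0// subr_gt0 subr0 ltrXn2r// ?nnegrE ?enorm_ge0//.
have mf : measurable_fun setT f by apply: continuous_measurable_rV; exact: smooth_continuous.
pose I := (\int[mu]_z (f z)%:E)%E.
have Ifin : (I < +oo)%E.
  have := @conv_integrable _ _ setT f e 0 measurableT (smooth_continuous sf) fv.
  move=> /integrableP[_]; apply: le_lt_trans; rewrite le_eqVlt; apply/orP; left.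
  by apply/eqP/eq_integral => z _; rewrite /= subr0 ger0_norm.
have I0 : (0 < I)%E.
  have e20 : 0 < e / 2 by rewrite divr_gt0.
  pose c := bump 0 (e ^+ 2 - (e / 2) ^+ 2).
  have c0 : 0 < c by apply: bump_gt0; rewrite exprMn; nra.
  apply: (@lt_le_trans _ _ (c%:E * mu (eball (0 : V) (e / 2)))%E).
    rewrite mule_gt0 ?lte_fin//; apply: open_lebesgue_gt0; first exact: open_eball.
    by exists 0; exact: eball_center.
  rewrite -(setIT (eball _ _)) -integral_indic//; last exact: measurable_eball.
  rewrite -ge0_integralZl_EFin//; [|by apply/measurable_EFinP; apply: measurable_indic; exact: measurable_eball|exact: ltW].
  apply: ge0_le_integralT => [z|||z].
  by rewrite -EFinM lee_fin mulr_ge0// ltW.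
  by apply/measurable_EFinP; apply: measurable_funM => //; apply: measurable_indic; exact: measurable_eball.
  exact/measurable_EFinP.
  rewrite -EFinM lee_fin indicE; case: (boolP (z \in _)) => [|_]; last by rewrite mulr0.
  rewrite inE /eball/= => ze; rewrite mulr1; apply: bump_le.
  by rewrite lerB// lerXn2r// ?nnegrE ?enorm_ge0// ltW.
have If : I \is a fin_num by rewrite ge0_fin_numE// ltW.
have fI : 0 < fine I by rewrite fine_gt0// I0 Ifin.
exists (fun z => (fine I)^-1 * f z); split.
exact: smooth_scale.
by move=> z ez; rewrite fv ?mulr0.
by move=> z; rewrite mulr_ge0 ?invr_ge0// ltW.
by move=> z ze; rewrite mulr_gt0 ?invr_gt0//; exact: fp.
under eq_integral do rewrite EFinM.
rewrite ge0_integralZl_EFin ?invr_ge0 ?(ltW fI)//; last exact/measurable_EFinP.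
  by rewrite -/I -(fineK If) -EFinM mulVf// gt_eqF.
by move=> z _; rewrite lee_fin.
Qed.

Lemma convol_conv (eta : V -> R) (A : set V) : measurable A ->
  measurable_fun setT eta -> (forall z, 0 <= eta z) -> convol eta A = conv A eta.
Proof.
move=> mA meta eta0; apply/funext => x; rewrite /convol /conv Rintegral_mkcond /Rintegral.
congr fine; rewrite -[RHS](ge0_integral_shift x).
apply: eq_integral => z _; rewrite patchE addrK indicE addrC.
  by case: ifP => _; rewrite ?mulr1 ?mulr0.
apply/measurable_EFinP; rewrite -/(measurable_fun _ _).
  apply/(measurable_restrictT _ mA); apply: measurable_funTS.
  apply: (measurableT_comp meta); exact: (measurable_shift (- x)).
by move=> y; rewrite lee_fin patchE; case: ifP.
Qed.

End mollifier.

(** * Regular level sets *)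

Section implicit_function.
Context {R : realType} {n : nat}.
Notation V := 'rV[R]_n.
Implicit Types (f g v F H : V -> R) (x y h k : V).

Notation grad f x := (fun i => pd i f x).

Lemma smooth_affine f (a : R) (b : V) : smooth f ->
  smooth (fun x => f (a *: x + b)) /\
  forall i x, pd i (fun x => f (a *: x + b)) x = a * pd i f (a *: x + b).
Proof.
move=> sf.
have D f' x : smooth f' -> differentiable (fun x => f' (a *: x + b)) x /\
    forall i, pd i (fun x => f' (a *: x + b)) x = a * pd i f' (a *: x + b).
  move=> sf'; apply: remainder_differentiable => e e0.
  have ea : 0 < e / (`|a| + 1) by rewrite divr_gt0// ltr_wpDl.
  have [r r0 hr] := differentiable_remainder (smooth_differentiable (a *: x + b) sf') ea.
  exists (r / (`|a| + 1)); first by rewrite divr_gt0// ltr_wpDl.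
  move=> h; rewrite ltr_pdivlMr ?ltr_wpDl// => hh.
  have ah : enorm (a *: h) <= enorm h * (`|a| + 1).
    by rewrite enormZ mulrC ler_wpM2l ?enorm_ge0// lerDl.
  have := hr (a *: h) (le_lt_trans ah hh).
  rewrite scalerDr (addrAC (a *: x)).
  have -> : \sum_i (a *: h) ord0 i * pd i f' (a *: x + b) =
      lincomb (fun i => a * pd i f' (a *: x + b)) h.
    by apply: eq_bigr => i _; rewrite mxE mulrCA mulrA.
  move=> /le_trans; apply; rewrite mulrAC ler_pdivrMr ?ltr_wpDl//.
  by rewrite -mulrA ler_wpM2l ?(ltW e0).
split=> [|i x]; last by have [_] := D f x sf; exact.
exists [set (fun x => f (a *: x + b)) | f in smooth]; first by exists f.
move=> _ [f' sf' <-]; split=> [x|i]; first by have [] := D f' x sf'.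
exists (fun x => a * pd i f' x); first exact/smooth_scale/smooth_pd.
by apply/funext => x; have [_ ->] := D f' x sf'.
Qed.

Lemma graph_comp_differentiable (w H : V -> R) (nu y : V) : enorm nu = 1 ->
  differentiable w y -> differentiable H (y + w y *: nu) ->
  differentiable (fun y => H (y + w y *: nu)) y /\
  forall j, pd j (fun y => H (y + w y *: nu)) y =
    pd j H (y + w y *: nu) + pd j w y * lincomb (grad H (y + w y *: nu)) nu.
Proof.
move=> nu1 dw dH; apply: remainder_differentiable => e e0.
set x := y + w y *: nu in dH *; set D := lincomb (grad H x) nu.
pose B := \sum_i `|pd i w y|.
have B0 : 0 <= B by exact: sumr_ge0.
have BF i : `|pd i w y| <= B by rewrite /B (bigD1 i)//= lerDl; exact: sumr_ge0.
(* An increment k of y moves the point y + w(y) nu by at most K |k|: |k| for y itself and (1 + n B)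
   |k| for w. *)
pose K := 2 + n%:R * B.
have K0 : 0 < K by rewrite ltr_wpDr// mulr_ge0.
have e1 : 0 < e / 2 / K by rewrite !divr_gt0.
have [r1 r10 hr1] := differentiable_remainder dH e1.
have e2 : 0 < Num.min 1 (e / 2 / (`|D| + 1)).
  by rewrite lt_min ltr01 !divr_gt0// ltr_wpDl.
have [r2 r20 hr2] := differentiable_remainder dw e2.
exists (Num.min r2 (r1 / K)); first by rewrite lt_min r20 divr_gt0.
move=> k; rewrite lt_min => /andP[k2]; rewrite ltr_pdivlMr// => k1.
pose tau := w (y + k) - w y.
have E : x + (k + tau *: nu) = y + k + w (y + k) *: nu.
  rewrite /x /tau scalerBl addrA (addrAC y) -!addrA; congr (_ + (_ + _)).
  by rewrite addrCA subrr addr0.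
have := hr2 k k2; rewrite -/tau -[\sum_i _]/(lincomb (grad w y) k).
set A := lincomb (grad w y) k => htau.
have AB : `|A| <= n%:R * B * enorm k by exact: lincomb_le.
have tauK : `|tau| <= (1 + n%:R * B) * enorm k.
  have := ler_normD (tau - A) A; rewrite subrK mulrDl mul1r => /le_trans; apply.
  rewrite lerD// (le_trans htau)// -[leRHS]mul1r ler_wpM2r ?enorm_ge0//.
  by rewrite ge_min lexx.
have hK : enorm (k + tau *: nu) <= K * enorm k.
  apply: le_trans (ler_enormD _ _) _; rewrite enormZ nu1 mulr1.
  by move: tauK; rewrite /K !mulrDl mul1r; lra.
have h1 : enorm (k + tau *: nu) < r1 by apply: le_lt_trans hK _; rewrite mulrC.
have := hr1 _ h1; rewrite E -[\sum_i _]/(lincomb (grad H x) (k + tau *: nu)).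
rewrite linearD linearZ/= -/D; set L := lincomb (grad H x) k => hH.
have -> : lincomb (fun j => pd j H x + pd j w y * D) k = L + A * D.
  rewrite /L /A /lincomb mulr_suml -big_split/=; apply: eq_bigr => i _.
  by rewrite mulrDr mulrA.
have := ler_normD (H (y + k + w (y + k) *: nu) - H x - (L + tau *: D)) ((tau - A) * D).
rewrite (_ : _ + (tau - A) * D = H (y + k + w (y + k) *: nu) - H x - (L + A * D)); last first.
  by rewrite /GRing.scale/=; ring.
move=> /le_trans; apply.
have q1 : e / 2 / K * enorm (k + tau *: nu) <= e / 2 * enorm k.
  by apply: le_trans (ler_wpM2l (ltW e1) hK) _; rewrite mulrA divfK ?gt_eqF.
have q2 : `|(tau - A) * D| <= e / 2 * enorm k.
  rewrite normrM; apply: (@le_trans _ _ (e / 2 / (`|D| + 1) * enorm k * (`|D| + 1))).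
    rewrite ler_pM// ?lerDl//; apply: (le_trans htau); rewrite ler_wpM2r ?enorm_ge0//.
    by rewrite ge_min lexx orbT.
  by rewrite mulrAC divfK// gt_eqF// ltr_wpDl.
by move: hH q1 q2; lra.
Qed.

Section implicit.
Variables (F : V -> R) (nu : V) (c t : R).
Hypotheses (sF : smooth F) (nu1 : enorm nu = 1) (c0 : 0 < c).
Hypothesis cF : forall x, c <= lincomb (grad F x) nu.

Lemma implicit_slope y (a b : R) : a <= b ->
  c * (b - a) <= F (y + b *: nu) - F (y + a *: nu).
Proof.
move=> ab.
have [s _] := line_mvt (y + a *: nu) ((b - a) *: nu) (fun x => smooth_differentiable x sF).
rewrite -addrA -scalerDl subrKC => ->.
set x := (_ + s *: _).
have -> : \sum_i ((b - a) *: nu) ord0 i * pd i F x = (b - a) * lincomb (grad F x) nu.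
  by rewrite mulr_sumr; apply: eq_bigr => i _; rewrite mxE mulrA.
by rewrite mulrC ler_wpM2l ?subr_ge0.
Qed.

Lemma implicit_slope_abs y (a b : R) :
  c * `|b - a| <= `|F (y + b *: nu) - F (y + a *: nu)|.
Proof.
have [ab|/ltW ab] := leP a b.
  by rewrite [`|b - a|]ger0_norm ?subr_ge0//; apply: le_trans (ler_norm _); exact: implicit_slope.
rewrite distrC [leRHS]distrC [`|a - b|]ger0_norm ?subr_ge0//.
by apply: le_trans (ler_norm _); exact: implicit_slope.
Qed.

Lemma implicit_exists y : exists s : R, F (y + s *: nu) = t.
Proof.
pose phi (s : R) := F (y + s *: nu).
pose M := `|phi 0 - t| / c.
have M0 : 0 <= M by rewrite divr_ge0// ltW.
have cM : c * M = `|phi 0 - t| by rewrite mulrC divfK ?gt_eqF.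
have cphi : continuous phi.
  move=> s; apply: continuous_comp; last exact: smooth_continuous.
  apply: cvgD; first exact: cvg_cst.
  by apply: cvgZl; exact: cvg_id.
have h1 : phi (- M) <= t.
  have := @implicit_slope y (- M) 0; rewrite oppr_le0 M0 sub0r opprK cM => /(_ isT).
  by rewrite -/(phi 0) -/(phi (- M)); have := ler_norm (phi 0 - t); lra.
have h2 : t <= phi M.
  have := @implicit_slope y 0 M M0; rewrite subr0 cM.
  by rewrite -/(phi 0) -/(phi M); have := ler_norm (- (phi 0 - t)); rewrite normrN; lra.
have [|||s _ st] := @IVT R phi (- M) M t.
by rewrite ge0_cp.
exact: continuous_subspaceT.
by rewrite ge_min le_max h1 h2 orbT.
by exists s.
Qed.

(** The slope along nu is at least c > 0 on the whole space, so that every line in that direction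
    meets the level t exactly once. The function is therefore global, as [boundary_of_class] expects
    of g. *)
Definition implicit y : R := projT1 (cid (implicit_exists y)).

Lemma implicitE y : F (y + implicit y *: nu) = t.
Proof. by rewrite /implicit; case: cid. Qed.

Lemma implicit_lt y (s : R) : t < F (y + s *: nu) <-> implicit y < s.
Proof.
split=> [|ws]; last first.
  have := implicit_slope y (ltW ws); rewrite implicitE -subr_gt0; apply: lt_le_trans.
  by rewrite mulr_gt0// subr_gt0.
rewrite ltNge => ts; rewrite ltNge; apply: contra ts => sw.
have := implicit_slope y sw; rewrite implicitE -subr_ge0.
by rewrite subr_ge0 => /(le_trans _) h; rewrite -subr_ge0; apply: h; rewrite mulr_ge0 ?subr_ge0// ltW.
Qed.

Let Gam y := y + implicit y *: nu.

(** The slope bound controls the increment tau of the height by (M / c) |k|; the first order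
    expansion of F between two points of the level set then determines tau up to o(|k|). *)
Lemma implicit_differentiable y : differentiable implicit y /\
  forall j, pd j implicit y = - pd j F (Gam y) / lincomb (grad F (Gam y)) nu.
Proof.
apply: remainder_differentiable => e e0.
set x := Gam y; pose D := lincomb (grad F x) nu.
have D0 : 0 < D by exact: lt_le_trans (cF x).
have dF := smooth_differentiable x sF.
have [r1 r10 hr1] := differentiable_remainder dF ltr01.
pose B := \sum_i `|pd i F x|.
have B0 : 0 <= B by exact: sumr_ge0.
have BF i : `|pd i F x| <= B by rewrite /B (bigD1 i)//= lerDl; exact: sumr_ge0.
pose M := n%:R * B + 1.
have M0 : 0 < M by rewrite ltr_wpDl// mulr_ge0.
pose K := 1 + M / c.
have K0 : 0 < K by rewrite addr_gt0// divr_gt0.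
have e1 : 0 < e * D / K by rewrite divr_gt0// mulr_gt0.
have [r2 r20 hr2] := differentiable_remainder dF e1.
exists (Num.min r1 (r2 / K)); first by rewrite lt_min r10 divr_gt0.
move=> k; rewrite lt_min => /andP[k1 k2].
pose tau := implicit (y + k) - implicit y.
have E : x + (k + tau *: nu) = y + k + implicit (y + k) *: nu.
  rewrite /x /Gam /tau scalerBl addrA (addrAC y) -!addrA; congr (_ + (_ + _)).
  by rewrite addrCA subrr addr0.
have tauM : `|tau| <= M / c * enorm k.
  rewrite mulrAC ler_pdivlMr// mulrC.
  have := implicit_slope_abs (x + k) 0 tau; rewrite subr0 scale0r addr0 -addrA E implicitE.
  move=> /le_trans; apply.
  have := hr1 k k1; rewrite mul1r => hk.
  have := @lincomb_le _ _ _ k _ BF; rewrite -[lincomb _ _]/(\sum_i _) => hl.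
  have tx : F x = t by exact: implicitE.
  rewrite -tx distrC.
  have := ler_normD (F (x + k) - F x - \sum_i k ord0 i * pd i F x) (\sum_i k ord0 i * pd i F x).
  by rewrite subrK /M mulrDl mul1r; lra.
have hK : enorm (k + tau *: nu) <= K * enorm k.
  apply: le_trans (ler_enormD _ _) _; rewrite enormZ nu1 mulr1 /K mulrDl mul1r.
  by rewrite lerD2l.
have := hr2 (k + tau *: nu).
rewrite E implicitE (_ : F x = t); last exact: implicitE.
rewrite subrr sub0r normrN -[\sum_i _]/(lincomb (grad F x) (k + tau *: nu)).
rewrite linearD linearZ/= -/D => /(_ _) hh.
have {hh} : `|lincomb (grad F x) k + tau * D| <= e * D / K * enorm (k + tau *: nu).
  by apply: hh; apply: le_lt_trans hK _; rewrite mulrC -ltr_pdivlMr.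
move=> hh; rewrite -/tau.
have -> : lincomb (fun i => - pd i F x / D) k = - (lincomb (grad F x) k / D).
  by rewrite /lincomb mulr_suml -sumrN; apply: eq_bigr => i _; rewrite mulNr mulrN mulrA.
rewrite opprK.
have -> : tau + lincomb (grad F x) k / D = (lincomb (grad F x) k + tau * D) / D.
  by rewrite mulrDl mulfK ?gt_eqF// addrC.
rewrite normrM normfV (gtr0_norm D0) ler_pdivrMr//; apply: le_trans hh _.
rewrite (mulrAC _ _ D) -mulrA ler_wpM2l ?mulr_ge0 ?(ltW e0) ?(ltW D0)//.
by rewrite mulrC ler_pdivrMr// mulrC.
Qed.

Lemma Gam_comp H y : smooth H -> differentiable (H \o Gam) y /\
  forall j, pd j (H \o Gam) y =
    pd j H (Gam y) - pd j F (Gam y) / lincomb (grad F (Gam y)) nu * lincomb (grad H (Gam y)) nu.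
Proof.
move=> sH; have [dw pw] := implicit_differentiable y.
have [dc pc] := graph_comp_differentiable nu1 dw (smooth_differentiable (Gam y) sH).
split=> // j; rewrite -[H \o Gam]/(fun y => H (y + implicit y *: nu)) pc pw.
by rewrite !mulNr.
Qed.

(** The functions H o [Gam], with H smooth, form a family closed under partial derivatives, and it
    contains the partial derivatives of the implicit function. *)
Lemma smooth_implicit : smooth implicit.
Proof.
have D0 x : lincomb (grad F x) nu != 0 by rewrite gt_eqF// (lt_le_trans c0).
have slin H : smooth H -> smooth (fun x => lincomb (grad H x) nu).
  by move=> sH; apply: smooth_sum => i; apply/smooth_scale/smooth_pd.
pose K H j x := pd j H x - pd j F x / lincomb (grad F x) nu * lincomb (grad H x) nu.
have sK H j : smooth H -> smooth (K H j).
  move=> sH; apply: smooth_sub; first exact: smooth_pd.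
  apply: smooth_mul; last exact: slin.
  apply: smooth_mul; first exact: smooth_pd.
  by apply: smooth_inv => //; exact: slin.
apply: smooth_primitive => [y|j]; first by have [] := implicit_differentiable y.
exists [set H \o Gam | H in smooth].
  exists (fun x => - pd j F x / lincomb (grad F x) nu).
    apply: smooth_mul; first exact/smooth_opp/smooth_pd.
    by apply: smooth_inv => //; exact: slin.
  by apply/funext => y; have [_ ->] := implicit_differentiable y.
move=> _ [H sH <-]; split=> [y|i]; first by have [] := Gam_comp y sH.
exists (K H i); first exact: sK.
by apply/funext => y; have [_ ->] := Gam_comp y sH.
Qed.

End implicit.

Lemma grad_norm_lincomb (a : 'I_n -> R) : (exists i, a i != 0) ->
  exists nu : V, enorm nu = 1 /\ 0 < lincomb a nu.
Proof.
move=> [i ai]; pose A : V := \row_j a j.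
have A0 : enorm A != 0.
  rewrite enorm_eq0; apply: contra ai => /eqP/rowP/(_ i).
  by rewrite !mxE => ->.
have Ap : 0 < enorm A by rewrite lt_neqAle eq_sym A0 enorm_ge0.
exists ((enorm A)^-1 *: A); split.
  by rewrite enormZ ger0_norm ?invr_ge0 ?enorm_ge0// mulVf.
rewrite linearZ/= /GRing.scale/= mulr_gt0 ?invr_gt0//.
have -> : lincomb a A = enorm A ^+ 2.
  by rewrite sqr_enorm; apply: eq_bigr => j _; rewrite !mxE.
by rewrite exprn_gt0.
Qed.

(* The error term of the first order expansion at p, cut off outside a small
   ball, is small in C^1, so that the modified function keeps a positive
   derivative in the direction nu. *)
Lemma local_modification v (p nu : V) : smooth v -> enorm nu = 1 ->
  0 < lincomb (grad v p) nu ->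
  exists F (r c : R), [/\ smooth F, 0 < r, 0 < c,
    forall x, c <= lincomb (grad F x) nu & forall x, enorm (x - p) <= r -> F x = v x].
Proof.
move=> sv nu1; set c := lincomb _ _ => c0.
(* The modified function is L + chi (v - L): equal to v near p, and affine with slope c along nu far
   from p. *)
pose L x := v p + lincomb (grad v p) (x - p).
have sL : smooth L.
  apply: smooth_add; first exact: smooth_cst.
  apply: smooth_sum => i; apply: smooth_mul; last exact: smooth_cst.
  rewrite (_ : (fun x => _) = (fun x : V => x ord0 i - p ord0 i)).
    by apply: smooth_sub; [exact: smooth_coord|exact: smooth_cst].
  by apply/funext => x; rewrite !mxE.
have pL i x : pd i L x = pd i v p.
  have [|_ ->//] := @remainder_differentiable _ _ L x (grad v p).
  move=> e e0; exists 1 => // h _.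
  have -> : L (x + h) = L x + lincomb (grad v p) h.
    by rewrite /L (addrAC x h) linearD/= addrA.
  by rewrite (addrC (L x)) addrK subrr normr0 mulr_ge0 ?enorm_ge0 ?ltW.
pose Rm x := v x - L x.
have sRm : smooth Rm by exact: smooth_sub.
have pRm i x : pd i Rm x = pd i v x - pd i v p.
  rewrite /Rm /pd; have -> : (fun x => v x - L x) = v - L by [].
  rewrite deriveB; first by rewrite -/(pd i L x) pL.
    exact/diff_derivable/smooth_differentiable.
  exact/diff_derivable/smooth_differentiable.
have [C C0 hC] := pd_bounded_common (@smooth_cutoff R n) (r := 2) (fun x => @cutoff0 R n x).
(* On the ball of radius 2 r, v - L is at most 2 r d, its partial derivatives at most d, and those
   of chi at most C / r. Hence the partial derivatives of chi (v - L) are at most d (2 C + 1), and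
   the choice of d limits the loss of slope to c / 2. *)
pose d := c / 2 / (n%:R * (2 * C + 1) + 1).
have dn0 : 0 < n%:R * (2 * C + 1) + 1 by rewrite ltr_wpDl// mulr_ge0// addr_ge0// mulr_ge0.
have d0 : 0 < d by rewrite !divr_gt0.
have [r1 r10 hr1] := differentiable_remainder (smooth_differentiable p sv) d0.
have [r2 r20 hr2] : exists2 r, 0 < r & forall x, enorm (x - p) < r ->
    forall i, `|pd i v x - pd i v p| <= d.
  have : \forall x \near p, forall i, `|pd i v x - pd i v p| <= d.
    apply: (@filter_forall V 'I_n (fun i x => `|pd i v x - pd i v p| <= d) (nbhs p)) => i.
    have : pd i v x @[x --> p] --> pd i v p by exact: smooth_continuous (smooth_pd i sv) p.
    by move=> /cvgrPdist_le/(_ _ d0); apply: filterS => x; rewrite distrC.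
  move=> /nbhs_eballP[r r0 hr]; exists r => // x xr; exact: hr.
pose r := Num.min r1 r2 / 4.
have r0 : 0 < r by rewrite divr_gt0// lt_min r10.
have rr1 : 2 * r < r1.
  by have : r * 4 <= r1; [rewrite /r divfK// ge_min lexx|move: r0; lra].
have rr2 : 2 * r < r2.
  by have : r * 4 <= r2; [rewrite /r divfK// ge_min lexx orbT|move: r0; lra].
pose chi x := cutoff (r^-1 *: x + - (r^-1 *: p)).
have chiE x : chi x = cutoff (r^-1 *: (x - p)) by rewrite /chi scalerBr.
have [schi pchi] : smooth chi /\ forall i x, pd i chi x = r^-1 * pd i cutoff (r^-1 *: (x - p)).
  have [h1 h2] := smooth_affine r^-1 (- (r^-1 *: p)) (@smooth_cutoff R n).
  split=> [|i x]; first exact: h1.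
  by rewrite scalerBr; exact: h2.
have nr x : enorm (r^-1 *: (x - p)) = enorm (x - p) / r.
  by rewrite enormZ ger0_norm ?invr_ge0 ?(ltW r0)// mulrC.
exists (fun x => L x + chi x * Rm x), r, (c / 2); split => //.
by apply: smooth_add => //; exact: smooth_mul.
by rewrite divr_gt0.
move=> x.
  have pF i : pd i (fun x => L x + chi x * Rm x) x =
      pd i v p + (chi x * (pd i v x - pd i v p) + Rm x * (r^-1 * pd i cutoff (r^-1 *: (x - p)))).
    rewrite pd_add; [|exact: smooth_differentiable|by apply: smooth_differentiable; exact: smooth_mul].
    rewrite pL pd_mul; [|exact: smooth_differentiable|exact: smooth_differentiable].
    by rewrite pRm pchi.
  set b := (fun i => chi x * (pd i v x - pd i v p) + Rm x * (r^-1 * pd i cutoff (r^-1 *: (x - p)))) in pF *.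
  have bd i : `|b i| <= d * (2 * C + 1).
    have [xr|xr] := leP (enorm (x - p)) (2 * r); last first.
      have x2 : 2 < enorm (r^-1 *: (x - p)) by rewrite nr ltr_pdivlMr.
      rewrite /b chiE cutoff0 ?(ltW x2)// mul0r add0r.
      rewrite (pd_vanishes_outside i x2 (fun x => @cutoff0 R n x))// !mulr0 normr0.
      by rewrite mulr_ge0 ?(ltW d0)// addr_ge0// mulr_ge0.
    have R1 : `|Rm x| <= d * (2 * r).
      have := hr1 (x - p) (le_lt_trans xr rr1); rewrite subrKC => h.
      rewrite /Rm /L opprD addrA; apply: (le_trans h).
      by rewrite ler_wpM2l// ltW.
    apply: (le_trans (ler_normD _ _)); rewrite (normrM (chi x)) (normrM (Rm x)) (normrM r^-1).
    rewrite [leRHS]mulrDr mulr1 [leRHS]addrC lerD//.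
      rewrite -[leRHS]mul1r ler_pM//; last exact: hr2 (le_lt_trans xr rr2) i.
      by rewrite ger0_norm ?cutoff_ge0// cutoff_le1.
    rewrite (ger0_norm (ltW (_ : 0 < r^-1))) ?invr_gt0//.
    apply: (@le_trans _ _ (d * (2 * r) * (r^-1 * C))).
      rewrite ler_pM// ?mulr_ge0 ?invr_ge0 ?(ltW r0)//.
      by rewrite ler_wpM2l ?invr_ge0 ?(ltW r0).
    by rewrite le_eqVlt; apply/orP; left; apply/eqP; field; rewrite gt_eqF.
  rewrite (_ : (fun i => _) = (fun i => pd i v p + b i)); last exact/funext.
  have -> : lincomb (fun i => pd i v p + b i) nu = c + lincomb b nu.
    by rewrite /c /lincomb -big_split; apply: eq_bigr => i _ /=; rewrite mulrDr.
  have := lincomb_le nu bd; rewrite nu1 mulr1.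
  have : n%:R * (d * (2 * C + 1)) <= c / 2.
    apply: (@le_trans _ _ (d * (n%:R * (2 * C + 1) + 1))).
      by rewrite mulrCA ler_wpM2l ?(ltW d0)// lerDl.
    by rewrite /d divfK// gt_eqF.
  have := ler_norm (- lincomb b nu); rewrite normrN; lra.
move=> x xr; rewrite chiE cutoff1 ?mul1r ?subrKC//.
by rewrite nr ler_pdivrMr// mul1r.
Qed.

Lemma topo_boundary_superlevel v (t : R) x : continuous v ->
  topo_boundary [set x | t < v x] x -> v x = t.
Proof.
move=> cv [clx nox]; apply/eqP; rewrite eq_le; apply/andP; split.
  rewrite leNgt; apply/negP => tv; apply: nox; apply: open_nbhs_nbhs; split=> //.
  by apply: (@open_comp _ _ v [set s | t < s]) => [y _|]; [exact: cv|exact: open_gt].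
have cB : closed [set x | t <= v x].
  by apply: (@closed_comp _ _ v [set s | t <= s]) => [y _|]; [exact: cv|exact: closed_ge].
by apply: (cB x); apply: (closureS _ clx) => y /= /ltW.
Qed.

(** nu points along the gradient, hence into {v > t}, which thus lies above the graph; near p this
    set coincides with {F > t}, to which the global implicit function applies. *)
Lemma regular_level_smooth_boundary v (t : R) : smooth v ->
  (forall x, v x = t -> exists i, pd i v x != 0) ->
  smooth_boundary [set x | t < v x].
Proof.
move=> sv reg p bp; have vp := topo_boundary_superlevel (smooth_continuous sv) bp.
have [nu [nu1 c0]] := grad_norm_lincomb (reg p vp).
have [F [r [c [sF r0 cp cF Fv]]]] := local_modification sv nu1 c0.
exists r, nu, (implicit t sF cp cF); split => //.
  exact/smooth_smooth_fun/smooth_implicit.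
move=> x px; rewrite /= -Fv; last exact: ltW px.
by have := implicit_lt t sF cp cF (x - dot x nu *: nu) (dot x nu); rewrite subrK.
Qed.

End implicit_function.

(** * Critical values *)

Section critical_values.
Context {R : realType} {n : nat}.
Notation V := 'rV[R]_n.
Notation mu := (@borel_lebesgue R n).
Notation mu' := (@borel_lebesgue R n.+1).

Lemma smooth_lipschitz_ball (f : V -> R) r : smooth f ->
  exists2 C : R, 0 <= C & forall x y, enorm x <= r -> enorm y <= r ->
    `|f y - f x| <= C * enorm (y - x).
Proof.
move=> sf.
have hC i : {C : R | 0 <= C & forall x, enorm x <= r -> `|pd i f x| <= C}.
  by apply: cid2; apply: continuous_bounded_ball; exact/smooth_continuous/smooth_pd.
pose C := \sum_i s2val (hC i).
have C0 : 0 <= C by apply: sumr_ge0 => i _; case: (hC i).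
have CC i x : enorm x <= r -> `|pd i f x| <= C.
  move=> xr; rewrite /C (bigD1 i)//= ler_wpDr//; last by case: (hC i) => /= c _; exact.
  by apply: sumr_ge0 => j _; case: (hC j).
exists (n%:R * C) => [|x y xr yr]; first by rewrite mulr_ge0.
have [t /andP[t0 t1]] := line_mvt x (y - x) (fun x => smooth_differentiable x sf).
rewrite subrKC => ->; apply: lincomb_le => i; apply: CC.
have -> : x + t *: (y - x) = (1 - t) *: x + t *: y.
  by rewrite scalerBr scalerBl scale1r addrA addrAC.
apply: le_trans (ler_enormD _ _) _; rewrite !enormZ !ger0_norm ?subr_ge0 ?(ltW t0) ?(ltW t1)//.
by nra.
Qed.

Variables (T : V -> R) (al : 'I_n -> V -> R).
Hypotheses (sT : smooth T) (sal : forall i, smooth (al i)).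

Let Phi (x : V) : 'rV[R]_n.+1 := rV_cons (T x, \row_i al i x).

Let measurable_Phi : measurable_fun setT Phi.
Proof.
apply: (measurableT_comp (@measurable_rV_cons R n)).
apply/measurable_fun_pair; first by apply: continuous_measurable_rV; exact: smooth_continuous.
apply: measurable_fun_rV => i; rewrite (_ : _ \o _ = al i).
  by apply: continuous_measurable_rV; exact: smooth_continuous.
by apply/funext => x; rewrite /= /Defs.coord mxE.
Qed.

Let Phi_lipschitz (r : R) : exists2 L : R, 0 < L & forall x y,
  enorm x <= r -> enorm y <= r -> forall i, `|(Phi y - Phi x) ord0 i| <= L * enorm (y - x).
Proof.
have [C C0 hC] := smooth_lipschitz_ball r sT.
have hD i : {D : R | 0 <= D & forall x y, enorm x <= r -> enorm y <= r ->
    `|al i y - al i x| <= D * enorm (y - x)}.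
  by apply: cid2; exact: smooth_lipschitz_ball.
pose D := \sum_i s2val (hD i).
have D0 : 0 <= D by apply: sumr_ge0 => i _; case: (hD i).
exists (C + D + 1) => [|x y xr yr i]; first by rewrite ltr_wpDl// addr_ge0.
rewrite !mxE; case: unliftP => [j _|_] /=.
  rewrite !mxE; apply: (@le_trans _ _ (s2val (hD j) * enorm (y - x))).
    by case: (hD j) => /= c _; exact.
  rewrite ler_wpM2r ?enorm_ge0// /D (bigD1 j)//=.
  have : 0 <= \sum_(i | i != j) s2val (hD i) by apply: sumr_ge0 => k _; case: (hD k).
  by lra.
by apply: le_trans (hC _ _ xr yr) _; rewrite ler_wpM2r ?enorm_ge0//; lra.
Qed.

(* Each point of the image of Phi is L d-close to the images of all points of
   a ball of radius d; by Fubini the (n+1)-dimensional measure of the set of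
   such points is O(d^(n+1) / d^n). *)
Let image_cover (N : nat) : exists2 C : R, 0 <= C & forall d, 0 < d <= 1 ->
  exists2 U, measurable U & Phi @` cube n N%:R `<=` U /\ (mu' U <= (C * d)%:E)%E.
Proof.
pose r : R := n%:R * (N%:R + 1).
have cr x : cube n (N%:R + 1) x -> enorm x <= r.
  move=> hx; apply: le_trans (enorm_le_norm _) _; rewrite ler_wpM2l//.
  by apply: mx_norm_le => [|i]; rewrite ?addr_ge0// ltW// hx.
have [L L0 hL] := Phi_lipschitz r.
(* A point y of the sup-norm ball of radius d about x has |x - y| <= n d; the factor n + 1 makes the
   bound on the coordinates of the images strict. *)
pose L1 := L * n.+1%:R.
have L10 : 0 < L1 by rewrite mulr_gt0.
exists (((N%:R + 1) *+ 2) ^+ n * L1 ^+ n.+1 * 2).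
  by rewrite !mulr_ge0 ?exprn_ge0 ?mulrn_wge0 ?addr_ge0 ?(ltW L10).
move=> d /andP[d0 d1].
pose S := [set p : V * 'rV[R]_n.+1 | cube n (N%:R + 1) p.1 /\
  cube n.+1 (L1 * d) (p.2 - Phi p.1)].
have mS : measurable S.
  apply: measurableI.
    by apply: (measurable_set_preimage measurable_fst); exact: measurable_cube.
  apply: (@measurable_set_preimage _ _ _ _ (fun p : V * 'rV[R]_n.+1 => p.2 - Phi p.1)).
    by apply: measurable_subV => //; exact: measurableT_comp.
  exact: measurable_cube.
pose f b := mu (ysection S b).
have mf : measurable_fun setT f by exact: measurable_fun_ysection.
have dn0 : 0 < (d *+ 2) ^+ n by rewrite exprn_gt0// pmulrn_lgt0.
have If : (\int[mu']_b f b = (((N%:R + 1) *+ 2) ^+ n * (L1 * d *+ 2) ^+ n.+1)%:E)%E.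
  have := @indic_fubini_tonelli _ _ _ _ _ mu mu' S mS.
  rewrite indic_fubini_tonelli_GE// indic_fubini_tonelli_FE// => <-.
  rewrite (eq_integral (fun x => (\1_(cube n (N%:R + 1)) x)%:E * ((L1 * d *+ 2) ^+ n.+1)%:E)%E); last first.
    move=> x _ /=; rewrite indicE; case: (boolP (x \in _)) => xN.
      rewrite mul1e (_ : xsection S x = shift (- Phi x) @^-1` cube n.+1 (L1 * d)).
        rewrite borel_lebesgue_shift; last exact: measurable_cube.
        by rewrite borel_lebesgue_cube// mulr_ge0 ?ltW.
      apply/seteqP; split => b; rewrite /xsection/= inE => //=; first by case.
      by move=> hb; split => //; rewrite inE in xN.
    rewrite mul0e (_ : xsection S x = set0) ?measure0//.
    rewrite -subset0 => b; rewrite /xsection/= inE => -[/= xN' _].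
    by rewrite mem_set in xN.
  rewrite ge0_integralZr//; last 2 first.
  by apply/measurable_EFinP; apply: measurable_indic; exact: measurable_cube.
  by rewrite lee_fin exprn_ge0// mulrn_wge0// mulr_ge0 ?ltW.
  rewrite integral_indic//=; last exact: measurable_cube.
  by rewrite setIT borel_lebesgue_cube ?addr_ge0// EFinM.
(* If b is the image of x, its section contains the cube of half-side d about x, whose volume is the
   threshold; d <= 1 keeps this cube inside the enlarged one. Chebyshev's inequality bounds the
   measure of U. *)
pose U := [set b | (((d *+ 2) ^+ n)%:E <= f b)%E].
have mU : measurable U.
  by rewrite -[U]setTI; apply: emeasurable_fun_c_infty.
exists U => //; split.
  move=> _ [x xN <-]; rewrite /U/= /f.
  rewrite -(borel_lebesgue_cube n (ltW d0)) -(borel_lebesgue_shift (- x)); last exact: measurable_cube.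
  apply: le_measure; rewrite ?inE.
  by apply: measurable_shift_preimage; exact: measurable_cube.
  exact: measurable_ysection.
  move=> y; rewrite /shift/= => hy; rewrite /ysection/= inE; split => /=.
    move=> i; have := hy i; rewrite !mxE => h1; have := xN i => h2.
    have := ler_normD (y ord0 i - x ord0 i) (x ord0 i); rewrite subrK.
    by move: h1 h2; lra.
  have xyd : enorm (x - y) <= n%:R * d.
    rewrite enormB; apply: le_trans (enorm_le_norm _) _; rewrite ler_wpM2l//.
    by apply: mx_norm_le => [|i]; rewrite ltW// hy.
  move=> i; apply: le_lt_trans (hL y x _ _ i) _.
  apply: cr => j; have := hy j; rewrite !mxE => h1; have := xN j => h2.
    have := ler_normD (y ord0 j - x ord0 j) (x ord0 j); rewrite subrK.
    by move: h1 h2; lra.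
  by apply: cr => j; apply: lt_trans (xN j) _; rewrite ltrDl.
  apply: (@le_lt_trans _ _ (L * (n%:R * d))); first by rewrite ler_wpM2l// ltW.
  by rewrite /L1 -mulrA ltr_pM2l// ltr_pM2r// ltr_nat.
have : (((d *+ 2) ^+ n)%:E * mu' U <= \int[mu']_b f b)%E.
  rewrite -(setIT U) -integral_indic// -ge0_integralZl_EFin//; [|exact/measurable_EFinP/measurable_indic|exact: ltW].
  apply: ge0_le_integralT => [b||//|b].
  by rewrite -EFinM lee_fin mulr_ge0// ltW.
  by apply/measurable_EFinP; apply: measurable_funM => //; exact: measurable_indic.
  rewrite indicE; case: (boolP (b \in U)) => [|_]; last by rewrite mule0.
  by rewrite inE mule1.
rewrite If -lee_pdivlMl// => /le_trans; apply; rewrite -EFinM lee_fin.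
rewrite le_eqVlt; apply/orP; left; apply/eqP.
rewrite -mulrnAr exprMn [(d *+ 2) ^+ n.+1]exprS.
move: dn0; set P := (d *+ 2) ^+ n => dn0; set A := _ ^+ n; set B := L1 ^+ n.+1.
by rewrite -mulr_natr; field; rewrite gt_eqF.
Qed.

Lemma image_null : exists2 Z : set 'rV[R]_n.+1, measurable Z /\ mu' Z = 0 & Phi @` setT `<=` Z.
Proof.
have h (N : nat) : exists2 Z, measurable Z /\ mu' Z = 0 & Phi @` cube n N%:R `<=` Z.
  have [C C0 hC] := image_cover N.
  have k0 (k : nat) : 0 < (k.+1%:R^-1 : R) <= 1.
    by rewrite invr_gt0 ltr0n/= invf_le1 ?ltr0n// ler1n.
  have hU (k : nat) : {U : set 'rV[R]_n.+1 | measurable U &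
      Phi @` cube n N%:R `<=` U /\ (mu' U <= (C * k.+1%:R^-1)%:E)%E}.
    by apply: cid2; exact: hC.
  have mI : measurable (\bigcap_k (s2val (hU k))).
    by apply: bigcapT_measurable => k; case: (hU k).
  exists (\bigcap_k (s2val (hU k))).
    split=> //; apply/eqP; rewrite eq_le measure_ge0 andbT; apply/lee_addgt0Pr => e e0.
    rewrite add0e; pose k := Num.truncn (C / e).
    apply: (@le_trans _ _ (mu' (s2val (hU k)))).
      apply: le_measure; rewrite ?inE//; first by case: (hU k).
      by move=> x; exact.
    case: (hU k) => /= U mU [_ mUk]; apply: (le_trans mUk); rewrite lee_fin.
    rewrite ler_pdivrMr ?ltr0n// mulrC -ler_pdivrMr//.
    by apply/ltW; exact: truncnS_gt.
  by move=> y hy k _; case: (hU k) => /= U mU [hs _]; exact: hs.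
pose Z N := s2val (cid2 (h N)).
have ZP N : [/\ measurable (Z N), mu' (Z N) = 0 & Phi @` cube n N%:R `<=` Z N].
  by rewrite /Z; case: (cid2 (h N)) => /= A [].
have mZ : measurable (\bigcup_N Z N) by apply: bigcup_measurable => N _; have [] := ZP N.
exists (\bigcup_N Z N).
  split=> //; apply/eqP; rewrite eq_le measure_ge0 andbT.
  have := @measure_sigma_subadditive _ _ _ mu' _ Z.
  move=> /(_ _ (fun N => let: And3 a _ _ := ZP N in a) mZ (@subset_refl _ _)) /le_trans; apply.
  by rewrite eseries0// => N _ _; have [] := ZP N.
move=> _ [x _ <-]; pose N := (Num.truncn (enorm x)).+1.
exists N => //; have [_ _] := ZP N; apply; exists x => // i.
by apply: le_lt_trans (normr_coord_enorm x i) _; exact: truncnS_gt.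
Qed.

Lemma ae_regular_section (e : R) : 0 < e -> exists2 a : V, enorm a < e &
  exists2 Z : set (measurableTypeR R), measurable Z /\ lebesgue_measure Z = 0 &
    forall x, (forall i, al i x = a ord0 i) -> Z (T x).
Proof.
move=> e0; have [Z [mZ Z0] hZ] := image_null.
have mW : measurable (@rV_cons R n @^-1` Z).
  by apply: (measurable_set_preimage (@measurable_rV_cons R n)).
set W := _ @^-1` Z in mW.
have IW : (\int[mu]_a lebesgue_measure (ysection W a) = 0)%E.
  have := @indic_fubini_tonelli _ _ _ _ _ (@lebesgue_measure R) mu W mW.
  by rewrite indic_fubini_tonelli_GE// indic_fubini_tonelli_FE// => <-.
have mf : measurable_fun setT (fun a => lebesgue_measure (ysection W a)).
  exact: measurable_fun_ysection.
have [N [mN N0 hN]] : {ae mu, forall a, lebesgue_measure (ysection W a) = 0%E}.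
  have := (ae_eq_integral_abs mu measurableT mf).1.
  rewrite (eq_integral (fun a => lebesgue_measure (ysection W a))) => [/(_ IW)|a _].
    by apply: filterS => a; exact.
  by rewrite gee0_abs.
have [a ae aN] : exists2 a, enorm a < e & ~ N a.
  apply: contrapT => /forall2NP hN'.
  have : (0 < mu (eball (0 : V) e))%E.
    by apply: open_lebesgue_gt0; [exact: open_eball|exists 0; exact: eball_center].
  apply/negP; rewrite -leNgt -N0; apply: le_measure; rewrite ?inE//.
    exact: measurable_eball.
  by move=> a; rewrite /eball/= subr0 => ae; case: (hN' a) => [//|/contrapT].
exists a => //; exists (ysection W a).
  split; first exact: measurable_ysection.
  by apply: contrapT => h; apply: aN; exact: hN.
move=> x hx; rewrite /ysection/= inE /W/=; apply: hZ; exists x => //.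
by rewrite /Phi; congr (rV_cons (_, _)); apply/rowP => i; rewrite mxE hx.
Qed.

End critical_values.

(** * Generic perturbations *)

Section sard.
Context {R : realType} {n : nat}.
Notation V := 'rV[R]_n.

Definition atan_perturb (u : V -> R) (a : V) : V -> R :=
  fun x => u x + \sum_i a ord0 i * atan (x ord0 i).

Lemma smooth_atan_perturb u a : smooth u -> smooth (atan_perturb u a).
Proof.
move=> su; apply: smooth_add => //; apply: smooth_sum => i.
by apply: smooth_scale; apply: smooth_atan; exact: smooth_coord.
Qed.

Lemma pd_atan_perturb u a i x : smooth u ->
  pd i (atan_perturb u a) x = pd i u x + a ord0 i * (1 + x ord0 i ^+ 2)^-1.
Proof.
move=> su; pose g j (x : V) := a ord0 j * atan (x ord0 j).
have sg j : smooth (g j).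
  by apply: smooth_scale; apply: smooth_atan; exact: smooth_coord.
rewrite /atan_perturb pd_add; [|exact: smooth_differentiable|]; last first.
  by apply: smooth_differentiable; exact: smooth_sum.
congr (_ + _); rewrite /pd (_ : (fun x => _) = \sum_j g j); last first.
  by apply/funext => y; rewrite fct_sumE.
rewrite derive_sum; last by move=> j; exact/diff_derivable/smooth_differentiable.
have E j : pd i (g j) x = (j == i)%:R * (a ord0 j * (1 + x ord0 j ^+ 2)^-1).
  rewrite /g pd_mul; [|exact: differentiable_cst|]; last first.
    by apply: smooth_differentiable; apply: smooth_atan; exact: smooth_coord.
  rewrite pd_cst mulr0 addr0.
  have [_ /(_ i)] := comp_differentiable (is_derive1_atan (x ord0 j)) (smooth_differentiable x (smooth_coord j)).
  by rewrite pd_coord => ->; ring.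
rewrite (bigD1 i)//= -/(pd i (g i) x) E eqxx mul1r big1 ?addr0// => j ji.
by rewrite -/(pd i (g j) x) E (negbTE ji) mul0r.
Qed.

Lemma atan_perturb_regular u (e : R) : smooth u -> 0 < e -> exists2 a : V, enorm a < e &
  exists2 Z : set (measurableTypeR R), measurable Z /\ lebesgue_measure Z = 0 &
    forall t x, ~ Z t -> atan_perturb u a x = t -> exists i, pd i (atan_perturb u a) x != 0.
Proof.
move=> su e0.
(* [al i x] is the only coefficient a_i for which the i-th partial derivative of the perturbed
   function vanishes at x, and [T x] is the value at x of the function perturbed with these
   coefficients. *)
pose al i (x : V) := - pd i u x * (1 + x ord0 i * x ord0 i).
have sal i : smooth (al i).
  apply: smooth_mul; first exact/smooth_opp/smooth_pd.
  by apply: smooth_add; [exact: smooth_cst|apply: smooth_mul; exact: smooth_coord].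
pose T x := u x + \sum_i al i x * atan (x ord0 i).
have sT : smooth T.
  apply: smooth_add => //; apply: smooth_sum => i; apply: smooth_mul => //.
  by apply: smooth_atan; exact: smooth_coord.
have [a ae [Z mZ hZ]] := ae_regular_section sT sal e0.
exists a => //; exists Z => // t x Zt tx; apply: contrapT => /forallNP crit; apply: Zt.
have ax i : al i x = a ord0 i.
  have := crit i; move/negP; rewrite negbK pd_atan_perturb// /al => /eqP.
  have p0 : 1 + x ord0 i ^+ 2 != 0 by rewrite gt_eqF// ltr_wpDr// sqr_ge0.
  by move=> /eqP; rewrite addr_eq0 => /eqP ->; rewrite opprK -expr2 divfK.
have := hZ x ax; rewrite (_ : T x = t)// -tx /T /atan_perturb; congr (_ + _).
by apply: eq_bigr => i _; rewrite ax.
Qed.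

End sard.

(** * Energy estimates *)

Lemma indic_in (R : pzRingType) (T : Type) (A : set T) x : A x -> \1_A x = 1 :> R.
Proof. by move=> Ax; rewrite indicE mem_set. Qed.

Lemma indic_notin (R : pzRingType) (T : Type) (A : set T) x : ~ A x -> \1_A x = 0 :> R.
Proof. by move=> Ax; rewrite indicE memNset. Qed.

Section estimates.
Context {R : realType} {n : nat}.
Notation V := 'rV[R]_n.
Local Notation mu := (@borel_lebesgue R n).
Local Notation mu2 := (mu \x mu)%E.
Implicit Types (s : R) (A B E Omega : set V) (u w : V -> R).

(** A pair that starts to count has its second point in both A and T, hence outside Omega; as the
    pair touches Omega, its first point lies in Omega. *)
Lemma gagliardo_setD s Omega A T : measurable Omega -> measurable A -> measurable T ->
  (forall x, T x -> ~ Omega x) ->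
  (gagliardo s Omega (\1_(A `\` T) : V -> R) <=
   gagliardo s Omega (\1_A : V -> R) + linteraction s Omega T)%E.
Proof.
move=> mO mA mT TO.
have mAT : measurable (A `\` T) by exact: measurableD.
have m1 B : measurable B -> measurable_fun setT (\1_B : V -> R) by move=> mB; exact: measurable_indic.
rewrite /gagliardo /linteraction -ge0_integralTD; last 4 first.
exact: gagliardo_integrand_ge0.
by apply: measurable_gagliardo => //; exact: m1.
exact: linteraction_integrand_ge0.
exact: measurable_linteraction.
apply: ge0_le_integralT.
exact: gagliardo_integrand_ge0.
by apply: measurable_gagliardo => //; exact: m1.
apply: emeasurable_funD; last exact: measurable_linteraction.
  by apply: measurable_gagliardo => //; exact: m1.
move=> p; rewrite -EFinD lee_fin !posdiff_indic !mulrA -mulrDl.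
rewrite ler_wpM2r ?kernd_ge0//.
have i0 B (x : V) : 0 <= \1_B x :> R by rewrite indicE.
have [|nx] := pselect ((A `\` T) p.1 /\ ~ (A `\` T) p.2 /\ touching Omega p); last first.
  suff -> : \1_(A `\` T) p.1 * \1_(~` (A `\` T)) p.2 * \1_(touching Omega) p = 0 :> R.
    by rewrite addr_ge0 ?mulr_ge0// indicE.
  have [x1|x1] := pselect ((A `\` T) p.1); last by rewrite (indic_notin _ x1) !mul0r.
  have [x2|x2] := pselect ((A `\` T) p.2).
    by rewrite [X in _ * X * _]indic_notin ?mulr0 ?mul0r// => /(_ x2).
  by rewrite [X in _ * X]indic_notin ?mulr0// => tp; exact: nx.
move=> [[x1 Tx1] [x2 tp]].
have le1 (a b c : bool) : a%:R * b%:R * c%:R <= 1 :> R.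
  by case: a; case: b; case: c; rewrite ?mulr0 ?mul0r ?mulr1.
apply: (@le_trans _ _ 1); first by rewrite !indicE le1.
have [y2|y2] := pselect (A p.2); last first.
  rewrite ler_wpDr ?mulr_ge0//.
  by rewrite !indic_in ?mulr1.
have Ty2 : T p.2 by apply: contrapT => Ty2; exact: x2.
have Ox1 : Omega p.1 by case: tp => // /(TO _ Ty2).
rewrite ler_wpDl ?mulr_ge0// ?indicE//.
by rewrite !mem_set ?mulr1.
Qed.

(** The energy of A - z in Omega is that of A in Omega + z. A new pair (x, y) touches Omega + z and
    not Omega. Since x is in A, its distance to Omega is at least d; so it is y that lies in the
    layer of width e, and |x - y| >= d - e >= d / 2. *)
Lemma gagliardo_shift s Omega A (d e : R) (z : V) : measurable Omega -> measurable A ->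
  (forall x, A x -> ~ outer_layer d Omega x) -> e <= d / 2 -> enorm z < e ->
  (gagliardo s Omega (\1_(shift z @^-1` A) : V -> R) <=
   gagliardo s Omega (\1_A : V -> R) + mu (outer_layer e Omega) *
   \int[mu]_w (\1_[set w : V | (d / 2 <= enorm w)%R] w * kern s w)%:E)%E.
Proof.
move=> mO mA AT ed ze.
have mI B : measurable B -> measurable_fun setT (\1_B : V -> R) by move=> mB; exact: measurable_indic.
pose Oz := shift (- z) @^-1` Omega.
have mOz : measurable Oz by exact: measurable_shift_preimage.
have shE B (x y : V) : \1_(shift y @^-1` B) x = \1_B (x + y) :> R.
  by rewrite !indicE; congr ((nat_of_bool _)%:R); apply/idP/idP; rewrite !inE.
have -> : gagliardo s Omega (\1_(shift z @^-1` A) : V -> R) = gagliardo s Oz (\1_A : V -> R).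
  rewrite /gagliardo -[RHS](ge0_integral_pair_shift z); last 2 first.
  by apply: measurable_gagliardo => //; exact: mI.
  exact: gagliardo_integrand_ge0.
  apply: eq_integral => p _.
  have E1 : posdiff (\1_A : V -> R) (p.1 + z, p.2 + z) = posdiff (\1_(shift z @^-1` A) : V -> R) p.
    by rewrite /posdiff !shE.
  have E2 : \1_(touching Oz) (p.1 + z, p.2 + z) = \1_(touching Omega) p :> R.
    rewrite !indicE; congr ((nat_of_bool _)%:R); apply/idP/idP; rewrite !inE /touching/= /Oz/= /shift !addrK//.
  have E3 : kernd s (p.1 + z, p.2 + z) = kernd s p.
    by rewrite /kernd/= opprD addrACA subrr addr0.
  by rewrite E1 E2 E3.
set h := fun w : V => \1_[set w : V | d / 2 <= enorm w] w * kern s w.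
have mh : measurable_fun setT h.
  apply: measurable_funM; last exact: measurable_kern.
  apply: measurable_indic.
  rewrite (_ : [set _ | _] = @enorm R n @^-1` [set` `[d / 2, +oo[]); last first.
    by apply/seteqP; split => w /=; rewrite in_itv/= andbT.
  apply: (measurable_set_preimage (@measurable_enorm R n)); exact: measurable_itv.
have h0 (w : V) : 0 <= h w by rewrite mulr_ge0 ?kern_ge0.
have mT : measurable (outer_layer e Omega) by exact: measurable_outer_layer.
rewrite -(ge0_integral_pair_diffl mT mh h0).
have mF : measurable_fun setT (fun p : V * V => (\1_(outer_layer e Omega) p.1 * h (p.2 - p.1))%:E).
  apply/measurable_EFinP; apply: measurable_funM.
    by apply: measurableT_comp => //; exact: mI.
  by apply: (measurableT_comp mh); exact: measurable_diff.
have F0 (p : V * V) : (0 <= (\1_(outer_layer e Omega) p.1 * h (p.2 - p.1))%:E :> \bar R)%E.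
  by rewrite lee_fin mulr_ge0.
rewrite -(ge0_integral_pair_swap mF F0).
rewrite /gagliardo -ge0_integralTD; last 4 first.
exact: gagliardo_integrand_ge0.
by apply: measurable_gagliardo => //; exact: mI.
by move=> p; exact: (F0 (p.2, p.1)).
apply/measurable_EFinP; apply: measurable_funM.
    exact: (measurableT_comp (mI _ mT) measurable_snd).
  apply: (measurableT_comp mh) => /=.
  exact: (measurable_subV measurable_fst measurable_snd).
apply: ge0_le_integralT.
exact: gagliardo_integrand_ge0.
by apply: measurable_gagliardo => //; exact: mI.
apply: emeasurable_funD; first by apply: measurable_gagliardo => //; exact: mI.
  apply/measurable_EFinP; apply: measurable_funM.
    exact: (measurableT_comp (mI _ mT) measurable_snd).
  apply: (measurableT_comp mh) => /=.
  exact: (measurable_subV measurable_fst measurable_snd).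
move=> p /=; rewrite -EFinD lee_fin.
rewrite (_ : h (p.1 - p.2) = \1_[set w : V | d / 2 <= enorm w] (p.1 - p.2) * kernd s p); last first.
  by rewrite /h /kernd -(kernN s (p.2 - p.1)) opprB.
rewrite !mulrA -mulrDl ler_wpM2r ?kernd_ge0// posdiff_indic.
have i0 B (x : V) : 0 <= \1_B x :> R by rewrite indicE.
have j0 (B : set (V * V)) x : 0 <= \1_B x :> R by rewrite indicE.
have [x1|x1] := pselect (A p.1); last first.
  by rewrite [X in X * _ * _]indic_notin// !mul0r addr_ge0 ?mulr_ge0.
have [x2|x2] := pselect (A p.2).
  by rewrite [X in _ * X * _]indic_notin ?mulr0 ?mul0r ?addr_ge0 ?mulr_ge0//; exact.
have -> : \1_A p.1 * \1_(~` A) p.2 = 1 :> R by rewrite !indic_in ?mulr1.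
rewrite !mul1r.
have [tz|tz] := pselect (touching Oz p); last first.
  by rewrite [leLHS]indic_notin// addr_ge0 ?mulr_ge0.
rewrite [leLHS]indic_in//.
have [t|t] := pselect (touching Omega p).
  by rewrite [X in _ <= X + _]indic_in// lerDl mulr_ge0.
rewrite ler_wpDl//.
have [t1 t2] : ~ Omega p.1 /\ ~ Omega p.2 by split => h1; apply: t; [left|right].
have layer x : Oz x -> ~ Omega x -> outer_layer e Omega x.
  move=> Ox nx; split => //; apply/tubular_nbhdP; exists (x - z) => //.
  by rewrite opprB addrC subrK.
have nT : ~ tubular_nbhd d Omega p.1 by move=> h1; apply: (AT _ x1).
have le_ed : e <= d by have := enorm_ge0 z; move: ze ed; lra.
have Oz2 : Oz p.2.
  case: tz => // Oz1; exfalso; apply: nT.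
  have [/tubular_nbhdP[y Oy yx] _] := layer _ Oz1 t1.
  by apply/tubular_nbhdP; exists y => //; exact: lt_le_trans le_ed.
rewrite (@indic_in _ _ (outer_layer e Omega)); last exact: layer.
rewrite mul1r indic_in//= leNgt; apply/negP => h1; apply: nT; apply/tubular_nbhdP.
exists (p.2 - z) => //.
have := ler_enorm_triangle p.2 p.1 (p.2 - z); rewrite subKr.
by move: ze ed h1; lra.
Qed.

Lemma far_kern_integrable s (d : R) : (0 < n)%N -> 0 < s < 1 -> 0 < d ->
  (\int[mu]_w (\1_[set w : V | (d <= enorm w)%R] w * kern s w)%:E < +oo)%E.
Proof.
(* Where |w| >= d one has m <= min(1, |w|), so that the integrand is at most m^-1 min(1, |w|) times
   the kernel. *)
move=> n0 hs d0; pose m := Num.min 1 d.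
have m0 : 0 < m by rewrite lt_min ltr01.
apply: le_lt_trans (kern_min_integrable n0 hs (_ : 0 <= m^-1)); last by rewrite invr_ge0 ltW.
apply: ge0_le_integralT => [w|||w].
by rewrite lee_fin mulr_ge0 ?kern_ge0.
apply/measurable_EFinP; apply: measurable_funM; last exact: measurable_kern.
  apply: measurable_indic.
  rewrite (_ : [set _ | _] = @enorm R n @^-1` [set` `[d, +oo[]); last first.
    by apply/seteqP; split => w /=; rewrite in_itv/= andbT.
  apply: (measurable_set_preimage (@measurable_enorm R n)); exact: measurable_itv.
apply/measurable_EFinP; apply: measurable_funM => //.
  apply: measurable_funM; last exact: measurable_kern.
  by apply: measurable_minr => //; exact: measurable_enorm.
rewrite lee_fin mulrA ler_wpM2r ?kern_ge0//.
have q0 : 0 <= m^-1 * Num.min 1 (enorm w).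
  by rewrite mulr_ge0 ?invr_ge0 ?(ltW m0)// le_min ler01 enorm_ge0.
have [dw|dw] := pselect ([set w : V | d <= enorm w] w); last by rewrite indic_notin.
rewrite indic_in// mulrC ler_pdivlMr// mul1r /m le_min ge_min lexx/= ge_min.
by rewrite (_ : d <= enorm w)// orbT.
Qed.

Lemma posdiffD u w p : posdiff (fun x => u x + w x) p <= posdiff u p + posdiff w p.
Proof.
rewrite /posdiff ge_max addr_ge0 ?le_max ?lexx//= opprD addrACA.
by rewrite lerD// le_max lexx orbT.
Qed.

Lemma gagliardoD s Omega u w : measurable Omega -> measurable_fun setT u ->
  measurable_fun setT w ->
  (gagliardo s Omega (fun x => u x + w x)%R <= gagliardo s Omega u + gagliardo s Omega w)%E.
Proof.
move=> mO mU mW; rewrite /gagliardo -ge0_integralTD; last 4 first.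
exact: gagliardo_integrand_ge0.
exact: measurable_gagliardo.
exact: gagliardo_integrand_ge0.
exact: measurable_gagliardo.
apply: ge0_le_integralT => [p|||p].
exact: gagliardo_integrand_ge0.
by apply: measurable_gagliardo => //; exact: measurable_funD.
by apply: emeasurable_funD; exact: measurable_gagliardo.
by rewrite -EFinD lee_fin -mulrDl ler_wpM2r ?posdiffD// mulr_ge0 ?kernd_ge0.
Qed.

(** The indicator of the pairs touching Omega is at most the sum of those of x in Omega and of y in
    Omega, which contribute equally: hence the factor 2. *)
Lemma gagliardo_lipschitz s Omega w (c : R) : measurable Omega -> measurable_fun setT w ->
  0 <= c -> (forall x y, `|w x - w y| <= c * Num.min 1 (enorm (y - x))) ->
  (gagliardo s Omega w <= c%:E * (2%:E * (mu Omega *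
    \int[mu]_z (Num.min 1 (enorm z) * kern s z)%:E)))%E.
Proof.
move=> mO mW c0 hw.
set h := fun z : V => Num.min 1 (enorm z) * kern s z.
have mh : measurable_fun setT h.
  apply: measurable_funM; last exact: measurable_kern.
  by apply: measurable_minr => //; exact: measurable_enorm.
have h0 (z : V) : 0 <= h z by rewrite mulr_ge0 ?kern_ge0// le_min ler01 enorm_ge0.
have hN (z : V) : h (- z) = h z by rewrite /h enormN kernN.
pose F (p : V * V) : \bar R := (\1_Omega p.1 * h (p.2 - p.1))%:E.
have mF : measurable_fun setT F.
  apply/measurable_EFinP; apply: measurable_funM.
    by apply: measurableT_comp => //; exact: measurable_indic.
  by apply: (measurableT_comp mh); exact: measurable_diff.
have F0 p : (0 <= F p)%E by rewrite lee_fin mulr_ge0.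
have mF' : measurable_fun setT (fun p : V * V => F (p.2, p.1)).
  apply/measurable_EFinP; apply: measurable_funM => /=.
    by apply: measurableT_comp => //; exact: measurable_indic.
  by apply: (measurableT_comp mh); apply: measurable_subV.
have mFF := emeasurable_funD mF mF'.
have -> : (2%:E * (mu Omega * \int[mu]_z (h z)%:E) = \int[mu2]_p (F p + F (p.2, p.1)))%E.
  rewrite (ge0_integralTD _ F0 mF (fun p => F0 (p.2, p.1)) mF').
  have I1 := ge0_integral_pair_diffl mO mh h0.
  have I2 := ge0_integral_pair_swap mF F0.
  rewrite mule_natl mule2n; congr (_ + _)%E; first exact: (esym I1).
  exact: (etrans (esym I1) (esym I2)).
rewrite -ge0_integralTZl//; last by move=> p; rewrite adde_ge0.
apply: ge0_le_integralT => [p|||p].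
exact: gagliardo_integrand_ge0.
exact: measurable_gagliardo.
by apply: emeasurable_funM.
rewrite -EFinD -EFinM lee_fin /=.
rewrite (_ : h (p.1 - p.2) = h (p.2 - p.1)); last by rewrite -hN opprB.
have pd : posdiff w p <= c * Num.min 1 (enorm (p.2 - p.1)).
  rewrite /posdiff ge_max mulr_ge0 ?le_min ?ler01 ?enorm_ge0//=.
  by apply: le_trans (ler_norm _) (hw _ _).
have tq : \1_(touching Omega) p <= \1_Omega p.1 + \1_Omega p.2 :> R.
  have [tp|tp] := pselect (touching Omega p); last by rewrite indic_notin// addr_ge0// indicE.
  rewrite indic_in//; case: tp => tp; rewrite (indic_in _ tp).
    by rewrite lerDl indicE.
  by rewrite lerDr indicE.
rewrite [leRHS](_ : _ = c * Num.min 1 (enorm (p.2 - p.1)) *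
    ((\1_Omega p.1 + \1_Omega p.2) * kernd s p)); last by rewrite /h /kernd; ring.
by rewrite ler_pM ?posdiff_ge0 ?mulr_ge0 ?kernd_ge0// ler_wpM2r ?kernd_ge0.
Qed.

(** The derivative is at most 1 and the oscillation is pi < 4; the constant 4 covers both cases. *)
Lemma atan_lipschitz (x y : R) : `|atan x - atan y| <= 4 * Num.min 1 `|y - x|.
Proof.
have h (a b : R) : a < b -> `|atan b - atan a| <= `|b - a|.
  move=> ab; have [|c _ ->] := MVT ab (fun x _ => is_derive1_atan x).
    apply: continuous_subspaceT => z; apply: differentiable_continuous.
    by apply/derivable1_diffP; have [] := is_derive1_atan z.
  rewrite normrM ler_piMl// ger0_norm ?invr_ge0 ?addr_ge0 ?sqr_ge0//.
  by rewrite invf_le1 ?lerDl ?sqr_ge0// ltr_wpDr ?sqr_ge0.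
have h1 : `|atan x - atan y| <= `|y - x|.
  have [xy|yx|->] := ltgtP x y; last by rewrite !subrr.
    by rewrite distrC; exact: h.
  by rewrite (distrC y); exact: h.
have h2 : `|atan x - atan y| <= 4.
  have := @pihalf_02 R; have := atan_gtNpi2 x; have := atan_ltpi2 x.
  have := atan_gtNpi2 y; have := atan_ltpi2 y; rewrite ler_norml.
  by move=> *; apply/andP; split; lra.
rewrite /Num.min; case: ifP => _; first by rewrite mulr1.
by apply: le_trans h1 _; rewrite ler_peMl// ler1n.
Qed.

End estimates.

(** * Choice of a level and detection of boundary points *)

Section approximation.
Context {R : realType} {n : nat}.
Notation V := 'rV[R]_n.
Local Notation mu := (@borel_lebesgue R n).
Local Notation mu2 := (mu \x mu)%E.
Implicit Types (s : R) (A B E Omega : set V) (u v w : V -> R).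

(** Otherwise all levels of ]tau, 1 - tau[ outside the null set Z would have energy above M, and
    coarea would give v an energy of at least (1 - 2 tau) M > P. *)
Lemma exists_level s Omega v (tau P M : R) (Z : set (measurableTypeR R)) :
  measurable Omega -> measurable_fun setT v -> 0 < tau < 2^-1 -> 0 <= M ->
  measurable Z -> lebesgue_measure Z = 0%E ->
  (gagliardo s Omega v <= P%:E)%E -> P < (1 - 2 * tau) * M ->
  exists t, [/\ tau < t < 1 - tau, ~ Z t &
    (gagliardo s Omega (\1_[set x | (t < v x)%R] : V -> R) <= M%:E)%E].
Proof.
move=> mO mv /andP[tau0 tau1] M0 mZ Z0 vP PM; apply: contrapT => /forallNP H.
pose I : set (measurableTypeR R) := `]tau, (1 - tau)[%classic.
have mI : measurable I by exact: measurable_itv.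
have lI0 : lebesgue_measure I = (1 - 2 * tau)%:E.
  rewrite /I lebesgue_measure_itv/= lte_fin ifT; last by lra.
  by rewrite -EFinB; congr (_%:E); ring.
have lI : (lebesgue_measure (I `\` Z) = (1 - 2 * tau)%:E)%E.
  have IZ : lebesgue_measure (I `&` Z) = 0%E.
    apply/eqP; rewrite eq_le measure_ge0 andbT -Z0; apply: le_measure; rewrite ?inE//.
    exact: measurableI.
  rewrite measureD//; last by rewrite [X in (X < _)%E]lI0 ltry.
  by rewrite [X in (_ - X)%E]IZ sube0; exact: lI0.
have : (((1 - 2 * tau) * M)%:E <= gagliardo s Omega v)%E.
  rewrite coarea// mulrC EFinM -lI.
  rewrite -(setIT (I `\` Z)) -integral_indic//; last exact: measurableD.
  rewrite -ge0_integralZl_EFin//; last first.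
    by apply/measurable_EFinP; apply: measurable_indic; exact: measurableD.
  apply: ge0_le_integralT => [t|||t].
  by rewrite -EFinM lee_fin mulr_ge0.
  by apply/measurable_EFinP; apply: measurable_funM => //; apply: measurable_indic; exact: measurableD.
  exact: measurable_gagliardo_level.
  rewrite indicE; case: (boolP (t \in _)) => [|_]; last first.
    by rewrite mule0; apply: integral_ge0 => p _; exact: gagliardo_integrand_ge0.
  rewrite inE /I /= in_itv/= => -[tI tZ]; rewrite mule1.
  rewrite leNgt; apply/negP => /ltW h; exact: (H t).
by move=> /le_trans/(_ vP); rewrite lee_fin leNgt PM.
Qed.

(** Otherwise each point of the ball has a neighbourhood in which E0 or its complement is null.
    These two kinds of points form disjoint open sets, and both occur in the ball since neither E0
    nor its complement is null there. A segment joining the two kinds stays in the ball, which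
    contradicts its connectedness. *)
Lemma ball_measure_boundary E E0 (x : V) (e : R) : lebesgue_equiv E E0 -> 0 < e ->
  (0 < mu (E0 `&` eball x e))%E -> (0 < mu (eball x e `\` E0))%E ->
  exists2 y, enorm (y - x) < e & measure_boundary E y.
Proof.
move=> EE0 e0 h1 h2; apply: contrapT => /forall2NP H.
have [_ mE0 _] := EE0.
have mb y r : measurable (eball y r : set V) by exact: measurable_eball.
have lE y r : lebesgue (E `&` eball y r) = mu (E0 `&` eball y r).
  by apply: lebesgue_equivE; exact: lebesgue_equivI.
pose Null A := [set y : V | exists2 r, 0 < r & mu (A `&` eball y r) = 0%E].
have oN A : measurable A -> open (Null A).
  move=> mA; rewrite openE => y [r r0 hr]; apply/nbhs_eballP; exists (r / 2).
    by rewrite divr_gt0.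
  move=> z zy; exists (r / 2); first by rewrite divr_gt0.
  apply/eqP; rewrite eq_le measure_ge0 andbT -hr; apply: le_measure.
  by rewrite inE; exact: measurableI.
  by rewrite inE; exact: measurableI.
  move=> k [Ak kz]; split=> //; rewrite /eball/=.
  by have := ler_enorm_triangle z k y; move: kz zy; rewrite /eball/=; lra.
have mC : measurable (~` E0) by exact: measurableC.
have cover y : enorm (y - x) < e -> Null E0 y \/ Null (~` E0) y.
  move=> yx; have [//|yb] := H y; apply: contrapT => /not_orP[n1 n2]; apply: yb.
  move=> r r0; rewrite lE lebesgueE//; apply/andP; split.
    rewrite lt_neqAle measure_ge0 andbT eq_sym; apply/eqP => h.
    by apply: n1; exists r.
  have -> : mu (eball y r) = (mu (E0 `&` eball y r) + mu (~` E0 `&` eball y r))%E.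
    rewrite -measureU//; [|exact: measurableI|exact: measurableI|].
      by rewrite -setIUl setUv setTI.
    by rewrite setIACA setICr set0I.
  rewrite lteDl; first last.
    rewrite ge0_fin_numE//; apply: (@le_lt_trans _ _ (mu (eball y r))).
      by apply: le_measure; rewrite ?inE//; exact: measurableI.
    by apply: bounded_lebesgue_lty => //; exact: bounded_eball.
  rewrite lt_neqAle measure_ge0 andbT eq_sym; apply/eqP => h.
  by apply: n2; exists r.
have disj y : Null E0 y -> Null (~` E0) y -> False.
  move=> [r r0 hr] [r' r'0 hr'].
  have : (0 < mu (eball y (Num.min r r')))%E.
    apply: open_lebesgue_gt0; first exact: open_eball.
    by exists y; apply: eball_center; rewrite lt_min r0.
  rewrite lt_neqAle eq_sym => /andP[/eqP + _]; apply; apply/eqP.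
  rewrite eq_le measure_ge0 andbT -[leRHS]adde0 -[X in (_ <= X + _)%E]hr -[X in (_ <= _ + X)%E]hr'.
  apply: (@le_trans _ _ (mu ((E0 `&` eball y r) `|` (~` E0 `&` eball y r')))).
    apply: le_measure; rewrite ?inE//.
      by apply: measurableU; exact: measurableI.
    move=> k; rewrite /eball/= lt_min => /andP[k1 k2].
    by have [kE|kE] := pselect (E0 k); [left|right].
  by apply: measureU2; exact: measurableI.
have mb2 A : measurable A -> measurable (A `&` eball x e) by move=> mA; exact: measurableI.
(* If no point of the ball were of the second kind, A would be locally null in the ball, hence null
   there. *)
have ex A B : measurable A -> (0 < mu (A `&` eball x e))%E ->
    (forall y, enorm (y - x) < e -> Null A y \/ Null B y) ->
    exists2 b, enorm (b - x) < e & Null B b.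
  move=> mA A0 cov; apply: contrapT => /forall2NP hB.
  move: A0; rewrite (lindelof_null (mb2 _ mA)) ?ltxx// => y [Ay yx].
  have [[r r0 hr]|By] := cov y yx; last by have [] := hB y.
  exists (eball y r); split; [exact: open_eball|exact: eball_center|].
  apply/eqP; rewrite eq_le measure_ge0 andbT -hr; apply: le_measure; rewrite ?inE.
  by apply: measurableI => //; exact: mb2.
  exact: measurableI.
  by move=> k [[Ak _] ky].
have [b bx Nb] := ex _ (~` E0) mE0 h1 cover.
have [a ax Na] : exists2 a, enorm (a - x) < e & Null E0 a.
  apply: (ex (~` E0)) => //; first by rewrite setIC -setDE.
  by move=> y /cover[]; [right|left].
have nb : ~ Null E0 b by move=> h; exact: disj h Nb.
have [t /andP[t0 t1]] := segment_meets_topo_boundary (oN _ mE0) Na nb.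
set p := a + _ => /(topo_boundary_open _ (oN _ mE0))[clp np].
have px : enorm (p - x) < e.
  have -> : p - x = (1 - t) *: (a - x) + t *: (b - x).
    rewrite /p !scalerBr !scalerBl !scale1r; apply/rowP => i; rewrite !mxE; ring.
  apply: (le_lt_trans (ler_enormD _ _)); rewrite !enormZ !ger0_norm ?subr_ge0//.
  pose m := Num.max (enorm (a - x)) (enorm (b - x)).
  have am : enorm (a - x) <= m by rewrite le_max lexx.
  have bm : enorm (b - x) <= m by rewrite le_max lexx orbT.
  by apply: (@le_lt_trans _ _ m); [nra|rewrite gt_max ax].
have [//|Np] := cover p px.
have /nbhs_eballP[r r0 hr] : nbhs p (Null (~` E0)).
  by apply: open_nbhs_nbhs; split => //; exact: oN.
move: clp => /closure_enormP/(_ r r0)[q Nq qp].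
exact: (disj q Nq (hr q qp)).
Qed.

End approximation.

Section mollification_bounds.
Context {R : realType} {n : nat}.
Notation V := 'rV[R]_n.
Local Notation mu := (@borel_lebesgue R n).
Variables (eta : V -> R) (A : set V) (e C : R).
Hypotheses (mA : measurable A) (meta : measurable_fun setT eta).
Hypotheses (eta0 : forall z, 0 <= eta z) (eta1 : (\int[mu]_z (eta z)%:E = 1)%E).
Hypotheses (etae : vanishes_outside e eta) (etaC : forall z, eta z <= C).

Lemma convol_eq0 (B : set V) x : measurable B ->
  mu (B `&` eball x e) = 0%E -> convol eta B x = 0.
Proof.
move=> mB B0; have C0 : 0 <= C by apply: le_trans (etaC 0).
have mBe : measurable (B `&` eball x e) by apply: measurableI => //; exact: measurable_eball.
have mI : measurable_fun setT (fun z => (\1_(shift x @^-1` (B `&` eball x e)) z)%:E : \bar R).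
  by apply/measurable_EFinP; apply: measurable_indic; exact: measurable_shift_preimage.
apply: EFin_inj; rewrite -convolE//; apply/eqP; rewrite eq_le; apply/andP; split; last first.
  by apply: integral_ge0 => z _; rewrite lee_fin mulr_ge0.
apply: (@le_trans _ _ (\int[mu]_z (C%:E * (\1_(shift x @^-1` (B `&` eball x e)) z)%:E))%E).
  apply: ge0_le_integralT => [z|||z].
  by rewrite lee_fin mulr_ge0.
  apply/measurable_EFinP; apply: measurable_funM => //.
    apply: measurableT_comp; first exact: measurable_indic.
    by apply: measurable_addV.
  by apply: emeasurable_funM.
  rewrite -EFinM lee_fin; have [ze|ze] := ltP (enorm z) e; last first.
    by rewrite etae// mul0r mulr_ge0// indicE.
  rewrite [X in _ <= _ * X](_ : _ = \1_B (x + z)); first by rewrite ler_wpM2r.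
  rewrite !indicE; congr ((nat_of_bool _)%:R); apply/idP/idP; rewrite !inE /shift/= addrC; first by case.
  by move=> Bz; split => //; rewrite /eball/= addrK.
rewrite ge0_integralZl_EFin// integral_indic//; last exact: measurable_shift_preimage.
by rewrite setIT /= borel_lebesgue_shift// B0 mule0.
Qed.

Lemma convolC x : convol eta (~` A) x = 1 - convol eta A x.
Proof.
have mAc : measurable (~` A) by exact: measurableC.
have m1 (B : set V) : measurable B -> measurable_fun setT (fun z => (eta z * \1_B (x + z))%:E).
  move=> mB; apply/measurable_EFinP; apply: measurable_funM => //.
  by apply: measurableT_comp; [exact: measurable_indic|apply: measurable_addV].
apply/eqP; rewrite eq_sym subr_eq; apply/eqP; apply: EFin_inj.
rewrite EFinD -!convolE// -ge0_integralTD//; last 4 first.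
by move=> z; rewrite lee_fin mulr_ge0.
exact: m1.
by move=> z; rewrite lee_fin mulr_ge0.
exact: m1.
rewrite -eta1; apply: eq_integral => z _; rewrite -EFinD -mulrDr !indicE in_setC.
by case: (_ \in _); rewrite ?add0r ?addr0 mulr1.
Qed.

(** If A or its complement were null in the ball, the average would be 0 or 1. *)
Lemma convol_ball x : 0 < convol eta A x < 1 ->
  (0 < mu (A `&` eball x e))%E /\ (0 < mu (eball x e `\` A))%E.
Proof.
move=> /andP[u0 u1]; split; rewrite lt_neqAle measure_ge0 andbT eq_sym; apply/eqP => h.
  by move: u0; rewrite convol_eq0// ltxx.
move: u1; rewrite -subr_gt0 -convolC convol_eq0 ?ltxx//; first exact: measurableC.
by rewrite setIC -setDE.
Qed.

End mollification_bounds.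

Section perturbation.
Context {R : realType} {n : nat}.
Notation V := 'rV[R]_n.

Lemma atan_sum_lipschitz (a : V) (al : R) (x y : V) : enorm a <= al ->
  `|\sum_i a ord0 i * atan (x ord0 i) - \sum_i a ord0 i * atan (y ord0 i)| <=
    4 * n%:R * al * Num.min 1 (enorm (y - x)).
Proof.
move=> aal; rewrite -sumrB.
under eq_bigr do rewrite -mulrBr.
apply: le_trans (ler_norm_sum _ _ _) _.
have -> : 4 * n%:R * al * Num.min 1 (enorm (y - x)) = \sum_(i < n) al * (4 * Num.min 1 (enorm (y - x))).
  by rewrite sumr_const card_ord -mulr_natl; ring.
apply: ler_sum => i _; rewrite normrM ler_pM//.
  by apply: le_trans (normr_coord_enorm _ _) aal.
apply: le_trans (atan_lipschitz _ _) _; rewrite ler_wpM2l// le_min ge_min lexx/=.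
by rewrite ge_min -[y ord0 i - _](_ : (y - x) ord0 i = _) ?normr_coord_enorm ?orbT// !mxE.
Qed.

Lemma atan_sum_bound (a : V) (al : R) (x : V) : enorm a <= al ->
  `|\sum_i a ord0 i * atan (x ord0 i)| <= 4 * n%:R * al.
Proof.
move=> aal; have := atan_sum_lipschitz x 0 aal.
rewrite [X in _ - X]big1 => [|i _]; last by rewrite mxE atan0 mulr0.
rewrite subr0 => /le_trans; apply; rewrite ler_piMr ?ge_min ?lexx//.
by rewrite !mulr_ge0// (le_trans (enorm_ge0 a)).
Qed.

End perturbation.

(** * Smooth approximation *)

Section smooth_approximation.
Context {R : realType} {n : nat}.
Notation V := 'rV[R]_n.
Local Notation mu := (@borel_lebesgue R n).
Local Notation mu2 := (mu \x mu)%E.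

Lemma measurable_norm_ge (f : V -> R) (c : R) : measurable_fun setT f ->
  measurable [set x | c <= `|f x|].
Proof.
move=> mf; have mg : measurable_fun setT (fun x => `|f x|) by exact: measurableT_comp.
rewrite -[X in measurable X]setTI; apply: (mg measurableT [set r | c <= r]).
by rewrite (_ : [set r | c <= r] = `[c, +oo[%classic)// set_itvcy.
Qed.

Lemma markov_cube (f : V -> R) (c K rho : R) : measurable_fun setT f -> 0 < c ->
  (\int[mu]_x (\1_(cube n rho) x * `|f x|)%:E <= (c * K)%:E)%E ->
  (mu ([set x | (c <= `|f x|)%R] `&` cube n rho) <= K%:E)%E.
Proof.
move=> mf c0 hK; set S := _ `&` _.
have mS : measurable S.
  by apply: measurableI; [exact: measurable_norm_ge|exact: measurable_cube].
have : (c%:E * mu S <= (c * K)%:E)%E.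
  apply: le_trans hK.
  rewrite -(setIT S) -integral_indic// -ge0_integralZl_EFin//; [|by apply/measurable_EFinP; exact: measurable_indic|exact: ltW].
  apply: ge0_le_integralT => [x|||x].
  by rewrite -EFinM lee_fin mulr_ge0// ltW.
  by apply: emeasurable_funM => //; apply/measurable_EFinP; exact: measurable_indic.
  apply/measurable_EFinP; apply: measurable_funM; last exact: measurableT_comp.
    by apply: measurable_indic; exact: measurable_cube.
  rewrite -EFinM lee_fin; have [Sx|Sx] := pselect (S x).
    rewrite (indic_in _ Sx) mulr1; case: Sx => /= h1 h2.
    by rewrite indic_in// mul1r.
  by rewrite (indic_notin _ Sx) mulr0 mulr_ge0// indicE.
by rewrite EFinM lee_pmul2l.
Qed.

Variables (s : R) (n0 : (0 < n)%N) (hs : 0 < s < 1) (Omega : set V).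
Hypotheses (oO : open Omega) (bO : bounded_set Omega).
Hypothesis (nO : minkowski_null (topo_boundary Omega)).

Let mO : measurable Omega := open_measurable_rV oO.

Let layer_bound : exists C r0 : R, [/\ 0 <= C, 0 < r0 &
  forall r, 0 < r <= r0 -> (mu (outer_layer r Omega) <= (C * r)%:E)%E].
Proof.
have [C [r0 [C0 r00 hC]]] := nO; exists C, r0; split => // r rr.
apply: le_trans (hC r rr); apply: le_measure; rewrite ?inE.
exact: measurable_outer_layer.
exact: measurable_tubular_nbhd.
exact: outer_layer_sub.
Qed.

(** Once d is fixed, the integral of the kernel over |w| >= d / 2 is a finite constant, and the cost
    k r of translations shorter than r is linear in r. The summand 1 in the witness for k makes it
    positive, for a later division. *)
Let layer_choice (e : R) : 0 < e -> exists d : R, [/\ 0 < d <= e,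
  (linteraction s Omega (outer_layer d Omega) <= e%:E)%E,
  (mu (outer_layer d Omega) <= e%:E)%E &
  exists2 k : R, 0 < k & forall r, 0 < r <= d -> (mu (outer_layer r Omega) *
    \int[mu]_w (\1_[set w : V | (d / 2 <= enorm w)%R] w * kern s w)%:E <= (k * r)%:E)%E].
Proof.
move=> e0; have [C [r0 [C0 r00 hC]]] := layer_bound.
have e1 : 0 < Num.min e (Num.min r0 (e / (C + 1))).
  by rewrite !lt_min e0 r00 divr_gt0// ltr_wpDl.
have [d /andP[d0 de] hd] := linteraction_outer_layer_cvg0 oO bO nO n0 hs e1.
move: (de); rewrite !le_min => /and3P[de' dr0 dC].
exists d; split => //.
by rewrite d0.
by apply: le_trans hd _; rewrite lee_fin ge_min lexx.
apply: le_trans (hC d _) _; first by rewrite d0.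
  rewrite lee_fin; apply: (@le_trans _ _ ((C + 1) * d)).
    by rewrite ler_wpM2r ?(ltW d0)// lerDl.
  by move: dC; rewrite ler_pdivlMr ?ltr_wpDl// mulrC.
have d2 : 0 < d / 2 by rewrite divr_gt0.
have := far_kern_integrable n0 hs d2; set K := (\int[mu]_w _)%E => Kfin.
have K0 : (0 <= K)%E.
  by apply: integral_ge0 => w _; rewrite lee_fin mulr_ge0 ?kern_ge0// indicE.
have Kf : K \is a fin_num by rewrite ge0_fin_numE.
exists (C * fine K + 1) => [|r /andP[r1 rd]].
  by rewrite ltr_wpDl// mulr_ge0// fine_ge0.
apply: (@le_trans _ _ ((C * r)%:E * K)%E).
  by apply: lee_wpmul2r => //; apply: hC; rewrite r1 (le_trans rd).
rewrite -(fineK Kf) -EFinM lee_fin mulrDl mul1r mulrAC lerDl; exact: ltW.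
Qed.

(** Energy budget: eps / 4 for emptying the layer, eps / 4 for the translations, eps / 8 for the
    perturbation; the remaining 3 eps / 8 is the room in which a level is selected. Volume budget:
    eps / 4 for the layer and eps / 4 for Chebyshev's inequality. *)
Lemma smooth_approximation E E0 (eps rho : R) : lebesgue_equiv E E0 ->
  (gagliardo s Omega (\1_E0 : V -> R) < +oo)%E -> 0 < eps -> 0 < rho ->
  exists A : set V, [/\ open A, smooth_boundary A,
    (gagliardo s Omega (\1_A : V -> R) <= gagliardo s Omega (\1_E0 : V -> R) + eps%:E)%E,
    (mu ((A `+` E0) `&` cube n rho) <= eps%:E)%E &
    topo_boundary A `\` tubular_nbhd eps (topo_boundary Omega) `<=`
      tubular_nbhd eps (measure_boundary E)].
Proof.
move=> EE0 Pfin eps0 rho0; have [_ mE0 _] := EE0.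
have gag0 u : (0 <= gagliardo s Omega u)%E.
  by apply: integral_ge0 => p _; exact: gagliardo_integrand_ge0.
pose P := fine (gagliardo s Omega (\1_E0 : V -> R)).
have PE : gagliardo s Omega (\1_E0 : V -> R) = P%:E by rewrite fineK// ge0_fin_numE.
have P0 : 0 <= P by rewrite fine_ge0.
have q0 : 0 < eps / 4 by rewrite divr_gt0.
have [d [/andP[d0 dq] dL dmu [k k0 hk]]] := layer_choice q0.
set T := outer_layer d Omega in dL dmu.
have mT : measurable T by exact: measurable_outer_layer.
pose E' := E0 `\` T.
have mE' : measurable E' by exact: measurableD.
have gE' : (gagliardo s Omega (\1_E' : V -> R) <= (P + eps / 4)%:E)%E.
  apply: le_trans (gagliardo_setD s mO mE0 mT _) _; first by move=> x [].
  by rewrite PE EFinD leeD2l.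
(* The second bound gives 2 tau (P + eps) <= eps / 4, hence P + 5 eps / 8 < (1 - 2 tau) (P + eps),
   as [exists_level] requires. *)
pose tau := Num.min 4^-1 (eps / (8 * (P + eps))).
have Pe : 0 < P + eps by rewrite ltr_wpDl.
have tau0 : 0 < tau by rewrite lt_min invr_gt0 ltr0n/= divr_gt0// mulr_gt0.
have tau4 : tau <= 4^-1 by rewrite ge_min lexx.
have tauP : tau * (8 * (P + eps)) <= eps.
  by rewrite -ler_pdivlMr ?mulr_gt0// ge_min lexx orbT.
(* The product of the threshold tau / 2 and of the volume eps / 4 in Chebyshev's inequality. *)
have e20 : 0 < eps * tau / 8 by rewrite divr_gt0// mulr_gt0.
have [_ /(_ rho _ rho0 e20)[rt rt0 hrt]] := measurable_translation_continuous mE'.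
(* The three bounds serve the energy estimate for translates, the closeness in L^1, and a
   translation cost k e of at most eps / 4. *)
pose e := Num.min (d / 2) (Num.min rt (eps / 4 / k)).
have e0 : 0 < e by rewrite !lt_min rt0 !divr_gt0.
have ed : e <= d / 2 by rewrite ge_min lexx.
have ert : e <= rt by rewrite /e !ge_min lexx orbT.
have ek : k * e <= eps / 4.
  by rewrite mulrC -ler_pdivlMr// /e !ge_min lexx !orbT.
have [eta [seta etae eta0 etap eta1]] := @exists_mollifier R n e e0.
have ceta := smooth_continuous seta.
have meta : measurable_fun setT eta by exact: continuous_measurable_rV.
have [C _ hC] := vanishes_outside_bounded ceta etae.
have etaC z : eta z <= C by apply: le_trans (ler_norm _) (hC z).
have etaz z : eta z != 0 -> enorm z < e.
  by move=> h; rewrite ltNge; apply/negP => /etae h'; rewrite h' eqxx in h.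
pose u := convol eta E'.
have su : smooth u by rewrite /u convol_conv//; exact: smooth_conv etae.
have mu_ : measurable_fun setT u by apply: continuous_measurable_rV; exact: smooth_continuous.
have gu : (gagliardo s Omega u <= (P + eps / 2)%:E)%E.
  apply: gagliardo_convol => // z /etaz ze.
  have E'T x : E' x -> ~ outer_layer d Omega x by case.
  apply: le_trans (gagliardo_shift s mO mE' E'T ed ze) _.
  have -> : (P + eps / 2)%:E = ((P + eps / 4)%:E + (eps / 4)%:E)%E :> \bar R.
    by rewrite -EFinD; congr (_%:E); lra.
  apply: leeD => //; apply: le_trans (hk e _) _; last by rewrite lee_fin.
  by rewrite e0 (le_trans ed)// ler_pdivrMr// ler_peMr ?(ltW d0)// ler1n.
have L1 : (\int[mu]_x (\1_(cube n rho) x * `|u x - \1_E' x|)%:E <= (eps * tau / 8)%:E)%E.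
  by apply: convol_L1_bound => // z /etaz ze; apply: hrt; exact: lt_le_trans ert.
set K1 := (\int[mu]_z (Num.min 1 (enorm z) * kern s z)%:E)%E.
have K10 : (0 <= K1)%E.
  by apply: integral_ge0 => z _; rewrite lee_fin mulr_ge0 ?kern_ge0// le_min ler01 enorm_ge0.
have K1f : K1 \is a fin_num by rewrite ge0_fin_numE//; exact: kern_integrable.
have Of : mu Omega \is a fin_num.
  by rewrite ge0_fin_numE//; exact: bounded_lebesgue_lty.
pose K2 := 2 * (fine (mu Omega) * fine K1).
have K20 : 0 <= K2 by rewrite !mulr_ge0// fine_ge0.
have K2E : (2%:E * (mu Omega * K1) = K2%:E)%E by rewrite -(fineK Of) -(fineK K1f).
(* [m] keeps the perturbation below tau / 2 uniformly and below eps / 8 in energy; the size [al] of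
   its coefficients absorbs the factor 4 n. *)
pose m := Num.min (tau / 2) (eps / 8 / (K2 + 1)).
have m0 : 0 < m by rewrite lt_min !divr_gt0// ltr_wpDl.
pose al := m / (4 * n%:R + 1).
have n4 : 0 < 4 * n%:R + 1 :> R by rewrite ltr_wpDl// mulr_ge0.
have al0 : 0 < al by rewrite divr_gt0.
have alm : 4 * n%:R * al <= m.
  rewrite /al mulrA ler_pdivrMr// mulrC ler_wpM2l ?(ltW m0)// lerDl//.
have [a aal [Z [mZ Z0] hZ]] := atan_perturb_regular su al0.
pose w (x : V) := \sum_i a ord0 i * atan (x ord0 i).
pose v := atan_perturb u a.
have sv : smooth v by exact: smooth_atan_perturb.
have cv := smooth_continuous sv.
have mv : measurable_fun setT v by exact: continuous_measurable_rV.
have mw : measurable_fun setT w.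
  apply: continuous_measurable_rV; apply: smooth_continuous; apply: smooth_sum => i.
  by apply: smooth_scale; apply: smooth_atan; exact: smooth_coord.
have wm x : `|w x| <= tau / 2.
  apply: le_trans (atan_sum_bound x (ltW aal)) _; apply: (le_trans alm).
  by rewrite ge_min lexx.
have gw : (gagliardo s Omega w <= (eps / 8)%:E)%E.
  apply: le_trans (gagliardo_lipschitz s mO mw (c := m) (ltW m0) _) _.
    move=> x y; apply: le_trans (atan_sum_lipschitz x y (ltW aal)) _.
    by rewrite ler_wpM2r// le_min ler01 enorm_ge0.
  rewrite -/K1 K2E -EFinM lee_fin; apply: (@le_trans _ _ (m * (K2 + 1))).
    by rewrite ler_wpM2l ?(ltW m0)// lerDl.
  by rewrite -ler_pdivlMr ?ltr_wpDl// ge_min lexx orbT.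
have gv : (gagliardo s Omega v <= (P + eps / 2 + eps / 8)%:E)%E.
  by apply: le_trans (gagliardoD s mO mu_ mw) _; rewrite EFinD leeD.
have [|||t [/andP[t0 t1] Zt gA]] := exists_level (tau := tau) (M := P + eps) mO mv _ _ mZ Z0 gv.
by rewrite tau0/=; move: tau4; lra.
exact: ltW.
by move: tauP eps0; rewrite mulrBl; lra.
exists [set x | t < v x]; split.
by apply: (@open_comp _ _ v [set r | t < r]) => [y _|]; [exact: cv|exact: open_gt].
by apply: regular_level_smooth_boundary => // x; exact: hZ.
by rewrite PE -EFinD.
pose S := [set x | tau / 2 <= `|u x - \1_E' x|].
have mf : measurable_fun setT (fun x => u x - \1_E' x).
  by apply: measurable_funB => //; exact: measurable_indic.
have muS : (mu (S `&` cube n rho) <= (eps / 4)%:E)%E.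
  apply: markov_cube => //; first by rewrite divr_gt0.
  by rewrite (_ : tau / 2 * (eps / 4) = eps * tau / 8)//; field.
have mS : measurable (S `&` cube n rho).
  apply: measurableI; last exact: measurable_cube.
  exact: measurable_norm_ge.
have mA : measurable [set x | t < v x].
  rewrite -[X in measurable X]setTI; apply: (mv measurableT [set r | t < r]).
  by rewrite (_ : [set r | t < r] = `]t, +oo[%classic)// set_itvoy.
apply: (@le_trans _ _ (mu (T `|` (S `&` cube n rho)))).
  apply: le_measure; rewrite ?inE.
  apply: measurableI; last exact: measurable_cube.
  by apply: measurableU; exact: measurableD.
  exact: measurableU.
  (* Off the layer, x belongs to only one of {v > t} and E'; as t is in ]tau, 1 - tau[ and |w| <=
     tau / 2, u differs from the indicator of E' by at least tau / 2 at x. *)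
  move=> x [AE xr]; have [Tx|nTx] := pselect (T x); first by left.
  right; split=> //; rewrite /S/=.
  have := wm x; rewrite ler_norml => /andP[w1 w2].
  have vE : v x = u x + w x by [].
  case: AE => -[/= h1 h2].
    have nE' : ~ E' x by case.
    rewrite (indic_notin _ nE') subr0; apply: le_trans (ler_norm _).
    by move: h1; rewrite vE; move: w2 t0; lra.
  have yE' : E' x by [].
  rewrite (indic_in _ yE') distrC; apply: le_trans (ler_norm _).
  by move/negP: h2; rewrite -leNgt vE; move: w1 t1; lra.
apply: le_trans (measureU2 _ mT mS) _.
apply: (@le_trans _ _ ((eps / 4)%:E + (eps / 4)%:E)%E); first exact: leeD.
by rewrite -EFinD lee_fin; move: eps0; lra.
move=> x [bx nx]; have vx := topo_boundary_superlevel cv bx.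
have uw : u x = t - w x by rewrite -vx /v /atan_perturb addrK.
(* v = t on the boundary, and |w| <= tau / 2 < tau keeps u = t - w strictly between 0 and 1. *)
have u01 : 0 < u x < 1.
  rewrite uw; have := wm x; rewrite ler_norml => /andP[w1 w2].
  by apply/andP; split; move: t0 t1 tau0 w1 w2; lra.
have [b1 b2] := convol_ball mE' meta eta0 eta1 etae etaC u01.
(* x is at distance at least eps from the boundary of Omega, the ball has radius at most eps / 8,
   and T lies within eps / 4 of that boundary. Hence E' and E0 agree in the ball. *)
have nT y : eball x e y -> ~ T y.
  move=> yx /(outer_layer_sub oO)/tubular_nbhdP[q bq yq]; apply: nx.
  apply/tubular_nbhdP; exists q => //.
  have := ler_enorm_triangle y x q; move: yx; rewrite /eball/= (enormB x y).
  by move: ed dq yq; lra.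
have EI : E' `&` eball x e = E0 `&` eball x e.
  apply/seteqP; split => y; first by case=> -[].
  by case=> Ey yx; split => //; split => //; exact: nT.
have ED : eball x e `\` E' = eball x e `\` E0.
  apply/seteqP; split => y [yx Ey]; split => //; last by case.
  by move=> E0y; apply: Ey; split => //; exact: nT.
rewrite EI in b1; rewrite ED in b2.
have [y yx By] := ball_measure_boundary EE0 e0 b1 b2.
apply/tubular_nbhdP; exists y => //; rewrite enormB.
by apply: lt_le_trans yx _; move: ed dq d0; lra.
Qed.

End smooth_approximation.

(** * Conclusion *)

(** A squeeze between the infima of the tails, which increase to the lower limit, and the bounds l +
    e h. *)
Lemma cvge_of_le_limn_einf {R : realType} (u : (\bar R)^nat) (l : R) (e : R^nat) :
  (forall h, u h <= (l + e h)%:E)%E -> e h @[h --> \oo] --> 0 ->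
  (l%:E <= limn_einf u)%E -> u h @[h --> \oo] --> l%:E.
Proof.
move=> ul e0 lu.
have upper : (l + e h)%:E @[h --> \oo] --> l%:E.
  apply: cvg_EFin; first exact: nearW.
  by rewrite -[X in _ --> X]addr0; apply: cvgD => //; exact: cvg_cst.
have einf_le h : (einfs u h <= u h)%E by apply: ereal_inf_lbound; exists h => /=.
have lower : einfs u @ \oo --> l%:E.
  suff <- : limn_einf u = l%:E by rewrite limn_einf_lim; exact: is_cvg_einfs.
  apply/eqP; rewrite eq_le lu andbT limn_einf_lim -(cvg_lim _ upper)//.
  apply: lee_lim; [exact: is_cvg_einfs|by apply/cvg_ex; exists l%:E|].
  by apply: nearW => h; exact: le_trans (einf_le h) (ul h).
apply: squeeze_cvge lower upper.
by apply: nearW => h; rewrite einf_le ul.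
Qed.

Section conclusion.
Context {R : realType} {n : nat}.
Notation V := 'rV[R]_n.
Local Notation mu := (@borel_lebesgue R n).
Local Notation leb := (@lebesgue R n).
Local Notation mu2 := (mu \x mu)%E.

(** Tolerances of sum 1, as Borel-Cantelli needs, in the form expected by [epsilon_trick0]. *)
Definition dyadic (h : nat) : R := 1 / (2 ^ h.+1)%:R.

Lemma dyadic_gt0 h : 0 < dyadic h.
Proof. by rewrite divr_gt0// ltr0n expn_gt0. Qed.

Lemma dyadic_le1 h : dyadic h <= 1.
Proof. by rewrite /dyadic ler_pdivrMr ?ltr0n ?expn_gt0// mul1r ler1n expn_gt0. Qed.

Lemma cvg_dyadic : dyadic h @[h --> \oo] --> 0.
Proof.
apply: (squeeze_cvgr (f := cst 0) (h := @harmonic R)); [|exact: cvg_cst|exact: cvg_harmonic].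
apply: nearW => h; rewrite (ltW (dyadic_gt0 h))/= /dyadic div1r /harmonic/=.
by rewrite lef_pV2 ?posrE ?ltr0n ?expn_gt0// ler_nat ltnW// ltn_expl.
Qed.

(* Changing the A h on a null set makes the indicators converge everywhere. *)
Lemma gagliardo_lower_semicontinuous s Omega (E0 : set V) (A : (set V)^nat) :
  measurable Omega -> measurable E0 -> (forall h, measurable (A h)) ->
  (forall h, mu ((A h `+` E0) `&` cube n h.+1%:R) <= (dyadic h)%:E)%E ->
  (gagliardo s Omega (\1_E0 : V -> R) <=
   limn_einf (fun h => gagliardo s Omega (\1_(A h) : V -> R)))%E.
Proof.
move=> mO mE0 mA hA.
pose F h := (A h `+` E0) `&` cube n h.+1%:R.
have mF h : measurable (F h).
  by apply: measurableI; [apply: measurableU; exact: measurableD|exact: measurable_cube].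
(* B is null by Borel-Cantelli. A point off B is in finitely many F h and in all cubes of large
   index, so that eventually A h and E0 both contain it or both miss it. *)
pose B := lim_sup_set F.
have mB : measurable B.
  by apply: bigcapT_measurable => k; apply: bigcup_measurable => j _; exact: mF.
have B0 : mu B = 0%E.
  apply: lim_sup_set_cvg0 => //; apply: le_lt_trans (ltry 1).
  apply: le_trans (epsilon_trick0 xpredT (@ler01 R)); apply: lee_nneseries => // h _.
  exact: hA.
pose A' h := (A h `\` B) `|` (E0 `&` B).
have mA' h : measurable (A' h) by apply: measurableU; [exact: measurableD|exact: measurableI].
have AA' h : gagliardo s Omega (\1_(A h) : V -> R) = gagliardo s Omega (\1_(A' h) : V -> R).
  rewrite -(perimeter_gagliardo s mO (lebesgue_equiv_refl (mA h))).
  apply: perimeter_gagliardo => //; split => //; first exact: borel_lebesgue_measurable.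
  have mD : measurable (A h `+` A' h) by apply: measurableU; exact: measurableD.
  rewrite lebesgueE//; apply/eqP; rewrite eq_le measure_ge0 andbT -B0.
  apply: le_measure; rewrite ?inE// => x [[Ax nx]|[[[Ax _]|[_ //]] nx]]; last by [].
  by apply: contrapT => nB; apply: nx; left.
under eq_fun do rewrite AA'.
have ev x : \forall h \near \oo, \1_(A' h) x = \1_E0 x :> R.
  have AE h : (A' h x <-> E0 x) -> \1_(A' h) x = \1_E0 x :> R.
    by move=> H; rewrite !indicE; congr ((nat_of_bool _)%:R); apply/idP/idP; rewrite !inE => /H.
  have [Bx|nBx] := pselect (B x).
    apply: nearW => h; apply: AE; split; last by right.
    by case=> -[].
  have [N hN] : exists N, forall h, (N <= h)%N -> ~ F h x.
    apply: contrapT => /forallNP H; apply: nBx => N _.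
    have := H N; move=> /existsNP[h /not_implyP[Nh /contrapT Fx]].
    by exists h.
  near=> h; apply: AE.
  have Nh : (N <= h)%N by near: h; exact: nbhs_infty_ge.
  have xh : cube n h.+1%:R x.
    move=> i; apply: le_lt_trans (normr_coord_enorm x i) _.
    apply: (@lt_le_trans _ _ (Num.truncn (enorm x)).+1%:R); first exact: truncnS_gt.
    rewrite ler_nat ltnS; near: h; exact: nbhs_infty_ge.
  have nFx := hN h Nh; split.
    move=> [[Ax _]|[]//]; apply: contrapT => nE; apply: nFx; split => //; by left.
  move=> Ex; left; split => //; apply: contrapT => nA; apply: nFx; split => //; by right.
pose f h p := (posdiff (\1_(A' h) : V -> R) p * (\1_(touching Omega) p * kernd s p))%:E.
have fE p : limn_einf (f^~ p) =
    (posdiff (\1_E0 : V -> R) p * (\1_(touching Omega) p * kernd s p))%:E.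
  apply: (cvg_limn_einf_sup _).1.
  apply: cvg_near_cst; near=> h; rewrite /f /posdiff.
  have -> : \1_(A' h) p.1 = \1_E0 p.1 :> R by near: h; exact: ev.
  by have -> : \1_(A' h) p.2 = \1_E0 p.2 :> R by near: h; exact: ev.
have := @fatou _ _ _ mu2 setT measurableT f.
rewrite (eq_integral (fun p => (posdiff (\1_E0 : V -> R) p * (\1_(touching Omega) p * kernd s p))%:E)).
  apply; last by move=> h p _; exact: gagliardo_integrand_ge0.
  by move=> h; apply: measurable_gagliardo => //; exact: measurable_indic.
by move=> p _; rewrite fE.
Unshelve. all: by end_near.
Qed.

(** A compact set lies in all cubes of large index, and passing from E to E0 costs a null set. *)
Lemma cvg_L1loc_of_dyadic (E E0 : set V) (A : (set V)^nat) : lebesgue_equiv E E0 ->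
  (forall h, measurable (A h)) ->
  (forall h, mu ((A h `+` E0) `&` cube n h.+1%:R) <= (dyadic h)%:E)%E ->
  cvg_L1loc A E.
Proof.
move=> [LE mE0 EE0] mA hA K cK.
have mK : measurable K.
  rewrite -(setCK K); apply: measurableC; apply: open_measurable_rV.
  by apply: closed_openC; exact: compact_closed.
have [M [_ hM]] := compact_bounded cK.
have KM x : K x -> forall i, `|x ord0 i| <= `|M| + 1.
  move=> Kx i; apply: le_trans (normr_coord_mx_norm x i) _; apply: hM => //.
  by rewrite ltr_pwDr// ler_norm.
apply: (@squeeze_cvge _ _ _ _ (cst 0%E) _ (fun h => (dyadic h)%:E)); last 2 first.
exact: cvg_cst.
apply: cvg_EFin; first exact: nearW.
  exact: cvg_dyadic.
near=> h; apply/andP; split; first by apply: integral_ge0 => x _; rewrite lee_fin.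
have Kh : K `<=` cube n h.+1%:R.
  move=> x Kx i; apply: le_lt_trans (KM x Kx i) _.
  apply: (@lt_le_trans _ _ (Num.truncn (`|M| + 1)).+1%:R); first exact: truncnS_gt.
  rewrite ler_nat ltnS; near: h; exact: nbhs_infty_ge.
have LA : lebesgue_measurable (A h) by exact: borel_lebesgue_measurable.
have LE0 : lebesgue_measurable E0 by exact: borel_lebesgue_measurable.
have LK : lebesgue_measurable K by exact: borel_lebesgue_measurable.
have LD : lebesgue_measurable (A h `+` E) by apply: measurableU; exact: measurableD.
have LF : lebesgue_measurable ((A h `+` E0) `&` cube n h.+1%:R).
  apply: borel_lebesgue_measurable; apply: measurableI; last exact: measurable_cube.
  by apply: measurableU; exact: measurableD.
have LEE : lebesgue_measurable (E `+` E0) by apply: measurableU; exact: measurableD.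
rewrite (eq_integral (fun x : lebesgueT R n => (\1_(A h `+` E : set (lebesgueT R n)) x)%:E)); last first.
  move=> x _; congr (_%:E); rewrite !indicE /setY in_setU !in_setD.
  by case: (x \in A h); case: (x \in E); rewrite /= ?subrr ?subr0 ?sub0r ?normrN ?normr0 ?normr1.
rewrite integral_indic//.
apply: (@le_trans _ _ (leb (((A h `+` E0) `&` cube n h.+1%:R) `|` (E `+` E0)))).
  apply: le_measure; rewrite ?inE.
  exact: measurableI.
  exact: measurableU.
  move=> x [AE Kx]; have [xEE|nEE] := pselect ((E `+` E0) x); first by right.
  left; split; last exact: Kh.
  have EE : E x <-> E0 x.
    split=> H; apply: contrapT => nH; apply: nEE; [left|right]; by split.
  by case: AE => -[h1 h2]; [left|right]; split => //; [move/EE.2|exact/EE.1].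
apply: le_trans (measureU2 _ LF LEE) _.
rewrite [X in (_ + X)%E]EE0 adde0; apply: le_trans (hA h).
rewrite le_eqVlt; apply/orP; left; apply/eqP/lebesgueE.
apply: measurableI; last exact: measurable_cube.
by apply: measurableU; exact: measurableD.
Unshelve. all: by end_near.
Qed.

End conclusion.

Unset Implicit Arguments.

Theorem theorem1p3 (R : realType) (n : nat) (hn : (0 < n)%N)
    (s : R) (hs : 0 < s < 1)
    (Omega : set 'rV[R]_n) (Omega_open : open Omega)
    (Omega_bounded : bounded_set Omega)
    (Omega_lipschitz : lipschitz_boundary Omega)
    (E : set 'rV[R]_n) (E_meas : lebesgue_measurable E) :
  (perimeter s E Omega < +oo)%E <->
  exists (Eh : nat -> set 'rV[R]_n) (eps : nat -> R),
    [/\ forall h, open (Eh h) /\ smooth_boundary (Eh h),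
        (forall h, 0 < eps h) /\ (eps h @[h --> \oo] --> 0),
        cvg_L1loc Eh E /\
          (ereal_sup [set perimeter s (Eh h) Omega | h in [set: nat]] < +oo)%E,
        perimeter s (Eh h) Omega @[h --> \oo] --> perimeter s E Omega &
        forall h,
          topo_boundary (Eh h) `\` tubular_nbhd (eps h) (topo_boundary Omega)
            `<=` tubular_nbhd (eps h) (measure_boundary E)].
Proof.
split=> [Pfin|[Eh [eps [_ _ [_ supfin] cvgP _]]]]; last first.
  apply: le_lt_trans supfin; apply: cvge_le cvgP; apply: nearW => h.
  by apply: ereal_sup_ubound; exists h.
have mO : measurable Omega by exact: open_measurable_rV.
have [E0 EE0] := exists_lebesgue_equiv E_meas; have [_ mE0 _] := EE0.
have PE : perimeter s E Omega = gagliardo s Omega (\1_E0 : 'rV[R]_n -> R).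
  exact: perimeter_gagliardo.
have Gfin : (gagliardo s Omega (\1_E0 : 'rV[R]_n -> R) < +oo)%E by rewrite -PE.
have G0 : (0 <= gagliardo s Omega (\1_E0 : 'rV[R]_n -> R))%E.
  by apply: integral_ge0 => p _; exact: gagliardo_integrand_ge0.
have nO := lipschitz_boundary_minkowski_null Omega_open Omega_bounded Omega_lipschitz.
have h0 (h : nat) : 0 < h.+1%:R :> R by rewrite ltr0n.
(* One tolerance, [dyadic h], serves for energy, volume and neighbourhoods, while the cubes of
   half-side h + 1 exhaust the space. *)
have H h := cid (smooth_approximation hn hs Omega_open Omega_bounded nO EE0 Gfin (@dyadic_gt0 R h) (h0 h)).
pose A h := projT1 (H h).
have AP h := projT2 (H h); rewrite -/(A _) in AP.
have oA h : open (A h) by have [] := AP h.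
have mA h : measurable (A h) by exact: open_measurable_rV.
have PA h : perimeter s (A h) Omega = gagliardo s Omega (\1_(A h) : 'rV[R]_n -> R).
  by apply: perimeter_gagliardo => //; exact: lebesgue_equiv_refl.
set P := fine (gagliardo s Omega (\1_E0 : 'rV[R]_n -> R)).
have GP : gagliardo s Omega (\1_E0 : 'rV[R]_n -> R) = P%:E by rewrite fineK// ge0_fin_numE.
have PAle h : (perimeter s (A h) Omega <= (P + dyadic h)%:E)%E.
  by have [_ _ + _ _] := AP h; rewrite PA EFinD -GP.
have muA h : (borel_lebesgue n ((A h `+` E0) `&` cube n h.+1%:R) <= (dyadic h)%:E)%E.
  by have [] := AP h.
exists A, dyadic; split.
by move=> h; split => //; have [] := AP h.
by split=> [h|]; [exact: dyadic_gt0|exact: cvg_dyadic].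
split; first exact: cvg_L1loc_of_dyadic muA.
  apply: (@le_lt_trans _ _ (P + 1)%:E); last exact: ltry.
  apply: ge_ereal_sup => _ [h _ <-]; apply: le_trans (PAle h) _.
  by rewrite lee_fin lerD2l dyadic_le1.
rewrite PE GP; apply: (cvge_of_le_limn_einf PAle); first exact: cvg_dyadic.
  rewrite -GP; under eq_fun do rewrite PA.
  exact: gagliardo_lower_semicontinuous.
by move=> h; have [] := AP h.
Qed.
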